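(* (1) Let $f:(\mathbb{C}^2,0)\to(\mathbb{C},0)$ be an irreducible germ of a holomorphic function and let $\gamma:(\mathbb{C},0)\to(\mathbb{C}^2,0)$ be a parametrisation of the curve germ $C_f=\{f=0\}$. Then $I_f=I_\gamma+3\mu(f)$. (2) With $f$ and $\gamma$ as in (1), $V_f=V_\gamma+6\mu(f)$. (3) Let $f=f_1\cdots f_n:(\mathbb{C}^2,0)\to(\mathbb{C},0)$ be a germ without repeated factors, where each $f_i$ is irreducible, and let $\gamma_i$ be a parametrisation of the branch $C_{f_i}=\{f_i=0\}$. Then $$I_f=\sum_{i=1}^n I_{\gamma_i}+3(\mu(f)+n-1),\qquad V_f=\sum_{i=1}^n V_{\gamma_i}+6(\mu(f)+n-1).$$
   Context: $\mathcal{O}_s$ is the ring of germs at $0$ of holomorphic functions on $\mathbb{C}^s$. For $\rho\in\mathcal{O}_1$, $\mathrm{ord}(\rho)=\dim_{\mathbb{C}}\mathcal{O}_1/\langle\rho\rangle\in\mathbb{N}\cup\{0,\infty\}$ is its order of vanishing. For $f,g\in\mathcal{O}_2$, $m(f,g)=\dim_{\mathbb{C}}\mathcal{O}_2/\langle f,g\rangle$ is the intersection number. $\mu(f)=m(f_x,f_y)$ is the Milnor number. All defining germs $f$ vanish at $0$ and have no repeated irreducible factors. A parametrisation of an irreducible curve germ is a germ $\gamma=(x,y):(\mathbb{C},0)\to(\mathbb{C}^2,0)$ whose image is the curve germ and which is injective, and an immersion away from $0$. For a parametrised germ $\gamma(t)=(x(t),y(t))$ put $$i_\gamma=x'y''-x''y',\qquad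 v_\gamma=(x'^2+y'^2)(x'y'''-x'''y')+3(x'x''+y'y'')(x''y'-x'y''),$$ and $I_\gamma=\mathrm{ord}(i_\gamma)$, $V_\gamma=\mathrm{ord}(v_\gamma)$ (possibly $\infty$). For $f\in\mathcal{O}_2$ put $$i_f=f_y^2f_{xx}-2f_xf_yf_{xy}+f_x^2f_{yy},$$ $$v_f=(f_x^2+f_y^2)\left(f_x^3f_{yyy}-3f_x^2f_yf_{xyy}+3f_xf_y^2f_{xxy}-f_y^3f_{xxx}\right)-3\left((f_x^2-f_y^2)f_{xy}-f_xf_y(f_{xx}-f_{yy})\right)i_f,$$ and $I_f=m(f,i_f)$, $V_f=m(f,v_f)$ (possibly $\infty$, with the usual conventions for sums). *)

(* Defs.v *)
From HB Require Import structures.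
From mathcomp Require Import all_boot all_order all_algebra.
From mathcomp Require Import complex.
From mathcomp Require Import all_classical all_reals all_analysis.

Set Implicit Arguments.
Unset Strict Implicit.
Unset Printing Implicit Defensive.

Import Order.TTheory GRing.Theory Num.Theory.
Import numFieldNormedType.Exports.

Local Open Scope ring_scope.
Local Open Scope classical_set_scope.

(* R[i] packed as a numFieldType: MathComp-Analysis equips the carrier of every
   numFieldType K with its canonical structure of normed K-module, so that
   [differentiable] below is complex (Frechet) differentiability. *)
Definition Cplx (R : realType) : numFieldType := R[i].

(* Germs at 0 are handled through representatives: total functions, considered
   up to equality near 0. *)
Section Germs.
Context {R : realType}.
Local Notation C := (Cplx R).

Definition holomorphic0 {V W : normedModType C} (f : V -> W) : Prop :=
  \forall z \near (0 : V), differentiable f z.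

Context {V : normedModType C}.

Definition germ_eq (f g : V -> C) : Prop :=
  \forall z \near (0 : V), f z = g z.

Definition germ_unit (f : V -> C) : Prop :=
  exists2 g : V -> C, holomorphic0 g & germ_eq (fun z => f z * g z) (fun=> 1).

Definition germ_irreducible (f : V -> C) : Prop :=
  [/\ holomorphic0 f, ~ germ_eq f (fun=> 0), ~ germ_unit f &
      forall g h : V -> C, holomorphic0 g -> holomorphic0 h ->
        germ_eq f (fun z => g z * h z) -> germ_unit g \/ germ_unit h].

Definition germ_squarefree (f : V -> C) : Prop :=
  forall g h : V -> C, germ_irreducible g -> holomorphic0 h ->
    ~ germ_eq f (fun z => g z ^+ 2 * h z).

Definition ideal1 (f : V -> C) : set (V -> C) :=
  [set h | exists2 a : V -> C, holomorphic0 a & germ_eq h (fun z => a z * f z)].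

Definition ideal2 (f g : V -> C) : set (V -> C) :=
  [set h | exists a b : V -> C, [/\ holomorphic0 a, holomorphic0 b &
     germ_eq h (fun z => a z * f z + b z * g z)]].

(* The dimension over C, in [0, +oo], of the ring of holomorphic germs modulo I:
   the supremum of the sizes of the finite families of germs whose classes
   modulo I are linearly independent. *)
Definition dim_quotient (I : set (V -> C)) : \bar R :=
  ereal_sup [set (n%:R%:E : \bar R) | n in
    [set n | exists2 h : 'I_n -> V -> C, forall i, holomorphic0 (h i) &
       forall c : 'I_n -> C,
         I (fun z => \sum_(i < n) c i * h i z) -> forall i, c i = 0]].

End Germs.

Section PlaneCurves.
Context {R : realType}.
Local Notation C := (Cplx R).

Definition ord0 (rho : C -> C) : \bar R := dim_quotient (ideal1 rho).

Definition intersection_number (f g : C * C -> C) : \bar R :=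
  dim_quotient (ideal2 f g).

Definition dx (f : C * C -> C) : C * C -> C := fun p => 'D_((1, 0) : C * C) f p.
Definition dy (f : C * C -> C) : C * C -> C := fun p => 'D_((0, 1) : C * C) f p.

Definition milnor (f : C * C -> C) : \bar R := intersection_number (dx f) (dy f).

(* The image of the germ [g] is the curve germ {f = 0}: the images of all
   sufficiently small neighbourhoods of 0 define the same set germ as {f = 0}. *)
Definition parametrisation (g : C -> C * C) (f : C * C -> C) : Prop :=
  [/\ holomorphic0 g, g 0 = 0 &
      exists2 U : set C, nbhs (0 : C) U &
        [/\ forall s t, U s -> U t -> g s = g t -> s = t,
            forall t, U t -> t != 0 -> injective ('d g t) &
            forall W : set C, nbhs (0 : C) W -> W `<=` U ->
              \forall p \near (0 : C * C), (g @` W) p <-> f p = 0]].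

Section Parametric.
Variable g : C -> C * C.
Let x : C -> C := fun t => (g t).1.
Let y : C -> C := fun t => (g t).2.
Let x1 : C -> C := (x^`(1))%classic.
Let x2 : C -> C := (x^`(2))%classic.
Let x3 : C -> C := (x^`(3))%classic.
Let y1 : C -> C := (y^`(1))%classic.
Let y2 : C -> C := (y^`(2))%classic.
Let y3 : C -> C := (y^`(3))%classic.

Definition i_param : C -> C := fun t =>
  x1 t * y2 t - x2 t * y1 t.

Definition v_param : C -> C := fun t =>
  (x1 t ^+ 2 + y1 t ^+ 2)
    * (x1 t * y3 t - x3 t * y1 t)
  + 3%:R * (x1 t * x2 t + y1 t * y2 t)
    * (x2 t * y1 t - x1 t * y2 t).

Definition I_param : \bar R := ord0 i_param.
Definition V_param : \bar R := ord0 v_param.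

End Parametric.

Section Implicit.
Variable f : C * C -> C.
Let fx := dx f.
Let fy := dy f.
Let fxx := dx fx.
Let fxy := dy fx.
Let fyy := dy fy.
Let fxxx := dx fxx.
Let fxxy := dy fxx.
Let fxyy := dy fxy.
Let fyyy := dy fyy.

Definition i_curve : C * C -> C := fun p =>
  fy p ^+ 2 * fxx p - 2%:R * fx p * fy p * fxy p + fx p ^+ 2 * fyy p.

Definition v_curve : C * C -> C := fun p =>
  (fx p ^+ 2 + fy p ^+ 2)
    * (fx p ^+ 3 * fyyy p - 3%:R * fx p ^+ 2 * fy p * fxyy p
       + 3%:R * fx p * fy p ^+ 2 * fxxy p - fy p ^+ 3 * fxxx p)
  - 3%:R * ((fx p ^+ 2 - fy p ^+ 2) * fxy p - fx p * fy p * (fxx p - fyy p))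
    * i_curve p.

Definition I_curve : \bar R := intersection_number f i_curve.
Definition V_curve : \bar R := intersection_number f v_curve.

End Implicit.

End PlaneCurves.

(* Main.v *)
(* The intersection number m(f, h) is the sum of the orders of h along the branches
   of f. Fix c such that no branch satisfies x + c y = 0 identically, and put
   X = x + c y and w = c f_x - f_y along a branch gamma. Differentiating
   f(gamma(t)) = 0 three times gives
     X'^3 i_f(gamma) = w^3 i_gamma   and   X'^6 v_f(gamma) = w^6 v_gamma,
   whose orders, summed over the branches, reduce both formulas to Teissier's lemma
   m(f, c f_x - f_y) = mu(f) + m(f, x + c y) - 1. After a linear change of coordinates
   this lemma reads m(f, f_y) = mu(f) + ord f(0, y) - 1: along a branch y = b(x) of
   the polar curve f_y = 0 the derivative of f(x, b(x)) is f_x(x, b(x)), so f and x f_x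
   have the same intersection number with f_y. *)
Require Import Defs.
From HB Require Import structures.
From mathcomp Require Import all_boot all_order all_algebra.
From mathcomp Require Import complex.
From mathcomp Require Import all_classical all_reals all_analysis.
From mathcomp Require Import ring lra zify.
From mathcomp Require cyclic separable cyclotomic.

Set Implicit Arguments.
Unset Strict Implicit.
Unset Printing Implicit Defensive.

Import Order.TTheory GRing.Theory Num.Theory.
Import numFieldNormedType.Exports.
Local Open Scope ring_scope.

(** * Complex differentiability *)

(** Germs are total functions, so power series are replaced by a quantitative calculus: Cauchy's
    formula comes from finite averages over roots of unity, and its main products are the regularity
    of derivatives and Hadamard division [F = F (x, 0) + y * G] with [G] holomorphic. The obstacle
    in the plane is that intersection numbers are dimensions of quotients of germs in two variables,
    while on a singular branch not every germ in the parameter is the pullback of a germ in the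
    plane. The substitution [x = s ^ e] removes it: an irreducible germ whose branch is not the axis
    [x = 0] becomes a unit times [e] smooth graphs, for which pullback is onto, and all intersection
    numbers are multiplied by the same [e]. The polar curve may be reducible or have repeated
    factors; it is never factored, but loses one Puiseux root at a time. The term [n - 1] arises
    because [ord X = 1 + ord X'] on each branch: in total [ord w - ord X'] is [mu + n - 1], weighted
    by the exponents 3 and 6. *)

Section Norm.
Variable R : realType.
Local Notation C := (Cplx R).
Implicit Types z w : C.

(* The norm of [Cplx R] takes values in [Cplx R]; [nrm] is its real counterpart. *)
Definition rc (r : R) : C := (r%:C)%C.
Definition nrm (z : C) : R := complex.Re (`|z| : R[i]).

Lemma nrmE z : `|z| = rc (nrm z).
Proof. by rewrite /rc /nrm RRe_real // normr_real. Qed.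

Lemma rc_le a b : (rc a <= rc b) = (a <= b). Proof. exact: lecR. Qed.
Lemma rc_lt a b : (rc a < rc b) = (a < b). Proof. exact: ltcR. Qed.
Lemma rcM a b : rc (a * b) = rc a * rc b.
Proof. exact: (rmorphM (real_complex R)). Qed.
Lemma rcD a b : rc (a + b) = rc a + rc b.
Proof. exact: (rmorphD (real_complex R)). Qed.
Lemma rc_inj : injective rc. Proof. exact: complexI. Qed.

Lemma gt0_rc (e : C) : 0 < e -> exists2 d : R, 0 < d & e = rc d.
Proof.
move=> e0; have [d ed] := complex_realP _ (gtr0_real e0).
by exists d => //; rewrite -rc_lt /rc -ed.
Qed.

Lemma nrm_ge0 z : 0 <= nrm z.
Proof. by rewrite -rc_le -nrmE normr_ge0. Qed.
Lemma nrmD z w : nrm (z + w) <= nrm z + nrm w.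
Proof. by rewrite -rc_le rcD -!nrmE ler_normD. Qed.
Lemma nrmN z : nrm (- z) = nrm z.
Proof. by rewrite /nrm normrN. Qed.
Lemma nrmB z w : nrm (z - w) <= nrm z + nrm w.
Proof. by rewrite -(nrmN w) nrmD. Qed.
Lemma nrmC z w : nrm (z - w) = nrm (w - z).
Proof. by rewrite -nrmN opprB. Qed.
Lemma nrmM z w : nrm (z * w) = nrm z * nrm w.
Proof. by apply: rc_inj; rewrite rcM -!nrmE normrM. Qed.
Lemma nrm0 : nrm 0 = 0.
Proof. by apply: rc_inj; rewrite -nrmE normr0. Qed.
Lemma nrm1 : nrm 1 = 1.
Proof. by apply: rc_inj; rewrite -nrmE normr1. Qed.
Lemma nrm_eq0 z : (nrm z == 0) = (z == 0).
Proof. by rewrite -(inj_eq rc_inj) -nrmE; exact: normr_eq0. Qed.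
Lemma nrm_gt0 z : (0 < nrm z) = (z != 0).
Proof. by rewrite lt_neqAle nrm_ge0 andbT eq_sym nrm_eq0. Qed.
Lemma nrmX z n : nrm (z ^+ n) = nrm z ^+ n.
Proof. by elim: n => [|n IH]; rewrite ?expr0 ?nrm1 // !exprS nrmM IH. Qed.
Lemma nrmV z : nrm z^-1 = (nrm z)^-1.
Proof.
have [->|z0] := eqVneq z 0; first by rewrite invr0 nrm0 invr0.
apply: (mulfI (x := nrm z)); first by rewrite nrm_eq0.
by rewrite -nrmM !divff ?nrm1 // nrm_eq0.
Qed.
Lemma nrm_div z w : nrm (z / w) = nrm z / nrm w.
Proof. by rewrite nrmM nrmV. Qed.
Lemma nrm_rc a : nrm (rc a) = `|a|.
Proof.
rewrite /nrm /rc normc_def /=.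
by rewrite expr0n /= addr0 sqrtr_sqr.
Qed.
Lemma nrm_nat n : nrm n%:R = n%:R.
Proof.
by rewrite -[n%:R]/(1 *+ n) -(rmorph_nat (real_complex R)) nrm_rc ger0_norm.
Qed.
Lemma nrm_dist z w : nrm z - nrm w <= nrm (z - w).
Proof. by rewrite lerBlDr (le_trans _ (nrmD _ _)) // subrK. Qed.
Lemma nrm_tri z w x : nrm (z - x) <= nrm (z - w) + nrm (w - x).
Proof. by rewrite (le_trans _ (nrmD _ _)) // addrA subrK. Qed.

Lemma nrm_le_eq0 z : (forall e, 0 < e -> nrm z <= e) -> z = 0.
Proof.
move=> h; apply/eqP; rewrite -nrm_eq0 eq_le nrm_ge0 andbT.
by apply/ler_addgt0Pr => e /h; rewrite add0r.
Qed.

Lemma near0C (z0 : C) (P : C -> Prop) :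
  (\forall z \near z0, P z) <->
  exists2 d : R, 0 < d & forall z, nrm (z - z0) < d -> P z.
Proof.
split=> [/nbhs_ballP[e /= e0 he]|[d d0 h]].
  have [d d0 ed] := gt0_rc e0; exists d => // z zd; apply: he.
  by rewrite -ball_normE /= distrC nrmE ed rc_lt.
apply/nbhs_ballP; exists (rc d); first by rewrite /= -[0]/(rc 0) rc_lt.
by move=> z; rewrite -ball_normE /= distrC nrmE rc_lt; exact: h.
Qed.

Lemma nrm_pair (p : C * C) : `|p| = rc (Num.max (nrm p.1) (nrm p.2)).
Proof.
rewrite prod_normE !nrmE maxEle rc_le maxEle.
by case: ifP.
Qed.

Lemma near0CC (p0 : C * C) (P : C * C -> Prop) :
  (\forall p \near p0, P p) <->
  exists2 d : R, 0 < d &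
    forall x y, nrm (x - p0.1) < d -> nrm (y - p0.2) < d -> P (x, y).
Proof.
split=> [/nbhs_ballP[e /= e0 he]|[d d0 h]].
  have [d d0 ed] := gt0_rc e0; exists d => // x y xd yd; apply: he.
  rewrite -ball_normE /= distrC nrm_pair ed rc_lt /=.
  by rewrite gt_max xd yd.
apply/nbhs_ballP; exists (rc d); first by rewrite /= -[0]/(rc 0) rc_lt.
move=> [x y]; rewrite -ball_normE /= distrC nrm_pair rc_lt gt_max /=.
by case/andP; exact: h.
Qed.

(** The derivative as a relation with an explicit real error bound, so that estimates stay within
    ordered field arithmetic; [has_dP] links it to [differentiable]. *)
Definition has_d (f : C -> C) (z l : C) : Prop :=
  forall e : R, 0 < e -> exists2 d : R, 0 < d &
    forall h, nrm h < d -> nrm (f (z + h) - f z - l * h) <= e * nrm h.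

Definition has_d2 (F : C * C -> C) (p a : C * C) : Prop :=
  forall e : R, 0 < e -> exists2 d : R, 0 < d &
    forall h k, nrm h < d -> nrm k < d ->
      nrm (F (p.1 + h, p.2 + k) - F p - a.1 * h - a.2 * k)
        <= e * Num.max (nrm h) (nrm k).

Lemma is_diff_near (V W : normedModType C) (f : V -> W) (x : V)
    (df : {linear V -> W}) (K : R) : (forall h, `|df h| <= rc K * `|h|) ->
  (forall e : C, 0 < e ->
     \forall h \near (0 : V), `|f (h + x) - f x - df h| <= e * `|h|) ->
  differentiable f x /\ 'd f x = df :> (V -> W).
Proof.
move=> dfK H.
have dfc : continuous df.
  apply: bounded_linear_continuous; exists (rc `|K|); split.
    by apply/complex_realP; exists `|K|.
  move=> M KM; apply/nbhs_ballP; exists 1 => [|h]; first exact: ltr01.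
  rewrite -ball_normE /= sub0r normrN => h1; apply: le_trans (dfK h) _.
  have KK : rc K <= rc `|K| by rewrite rc_le ler_norm.
  apply: le_trans (ler_wpM2r (normr_ge0 _) KK) _.
  have h1' : `|h| <= 1 by exact: ltW.
  have K0 : 0 <= rc `|K| by rewrite -[0]/(rc 0) rc_le.
  apply: le_trans (ler_wpM2l K0 h1') _.
  by rewrite mulr1 ltW.
have E : f \o shift x = cst (f x) + df +o_ 0 id.
  apply/eqaddoP => e e0; have := H e e0; apply: filterS => h.
  by rewrite /= /cst /shift /= opprD addrA.
have dE := diff_unique dfc E; split=> //.
by apply/diff_locallyP; rewrite dE.
Qed.

Lemma near_is_diff (V W : normedModType C) (f : V -> W) (x : V) :
  differentiable f x -> forall e : C, 0 < e ->
     \forall h \near (0 : V), `|f (h + x) - f x - 'd f x h| <= e * `|h|.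
Proof.
move=> /diff_locallyP[_] /eqaddoP H e e0; have := H e e0.
by apply: filterS => h; rewrite /= /cst /shift /= opprD addrA.
Qed.

Lemma has_dP (f : C -> C) z l :
  has_d f z l <-> differentiable f z /\ 'D_1 f z = l.
Proof.
split=> [H|[df <-] e e0].
  pose d (h : C) := h *: (l : C^o).
  have lin_scal : linear d by move=> ? ? ?; rewrite /d scalerDl scalerA.
  pose scallM := GRing.isLinear.Build _ _ _ _ _ lin_scal.
  pose scalL : {linear _ -> _} := HB.pack d scallM.
  have [|e e0|dfz dE] := @is_diff_near C C f z scalL (nrm l).
  - by move=> h; rewrite !nrmE -rcM rc_le -nrmM mulrC; exact: lexx.
  - have [d' d0 ->] := gt0_rc e0; have [del del0 Hd] := H _ d0.
    apply/near0C; exists del => // h; rewrite subr0 => /Hd.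
    by rewrite !nrmE -rcM rc_le [h + z]addrC [scalL h](mulrC h l).
  - by split=> //; rewrite deriveE // dE /= /d scale1r.
have := @near_is_diff C C f z df (rc e) => /(_ _)/wrap[].
  by rewrite -[0]/(rc 0) rc_lt.
move=> /near0C [d d0 H]; exists d => // h hd.
have := H h; rewrite subr0 => /(_ hd); rewrite !nrmE -rcM rc_le [h + z]addrC deriveE //.
have -> : 'd f z 1 * h = 'd f z h by rewrite -[in RHS](mulr1 h) linearZ mulrC.
by [].
Qed.

Lemma has_d2P (F : C * C -> C) p a :
  has_d2 F p a <->
  [/\ differentiable F p, 'D_((1, 0) : C * C) F p = a.1
    & 'D_((0, 1) : C * C) F p = a.2].
Proof.
split=> [H|[df E1 E2] e e0].
  pose d (h : C * C) := a.1 * h.1 + a.2 * h.2 : C.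
  have lin_scal : linear d.
    move=> c [h1 k1] [h2 k2].
    rewrite -[c *: _ + _]/(c * h1 + h2, c * k1 + k2) /d /=.
    rewrite -[c *: _]/(c * (a.1 * h1 + a.2 * k1)).
    by rewrite !mulrDr ![a.1 * (c * _)]mulrCA ![a.2 * (c * _)]mulrCA addrACA.
  pose scallM := GRing.isLinear.Build _ _ _ _ _ lin_scal.
  pose scalL : {linear _ -> _} := HB.pack d scallM.
  have [|e e0|dfz dE] := @is_diff_near (C * C)%type C F p scalL (nrm a.1 + nrm a.2).
  - move=> [h k]; rewrite nrmE nrm_pair -rcM rc_le /= /d /=.
    rewrite (le_trans (nrmD _ _)) // !nrmM mulrDl.
    by rewrite lerD // ler_wpM2l ?nrm_ge0 // le_max lexx ?orbT.
  - have [d' d0 ->] := gt0_rc e0; have [del del0 Hd] := H _ d0.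
    apply/near0CC; exists del => // h k; rewrite !subr0 => hd kd.
    have := Hd _ _ hd kd.
    rewrite nrmE nrm_pair -rcM rc_le.
    rewrite [(h, k) + p]addrC -[p + _]/(p.1 + h, p.2 + k) /= /d /=.
    by rewrite opprD addrA.
  - by split=> //; rewrite deriveE // dE /= /d /= mulr0 mulr1 ?addr0 ?add0r.
have := @near_is_diff (C * C)%type C F p df (rc e) => /(_ _)/wrap[].
  by rewrite -[0]/(rc 0) rc_lt.
move=> /near0CC [d d0 H]; exists d => // h k hd kd.
have := H h k; rewrite !subr0 => /(_ hd kd).
rewrite [(h, k) + p]addrC -[p + _]/(p.1 + h, p.2 + k).
rewrite nrmE nrm_pair -rcM rc_le -E1 -E2 !deriveE //.
have -> : 'd F p (h, k) = 'd F p (1,0) * h + 'd F p (0,1) * k.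
  have -> : ((h, k) : C * C) = h *: ((1, 0) : C * C) + k *: ((0, 1) : C * C).
    rewrite -[RHS]/(h * 1 + k * 0, h * 0 + k * 1).
    by rewrite !mulr1 !mulr0 addr0 add0r.
  rewrite linearD; congr (_ + _); rewrite linearZ; exact: mulrC.
by rewrite opprD addrA.
Qed.

End Norm.

(** * Goursat's theorem *)

Section Goursat.
Variable R : realType.
Local Notation C := (Cplx R).
Local Notation nrm := (@nrm R).

Lemma nrm_sqrt (z : C) :
  nrm z = Num.sqrt (complex.Re (z : R[i]) ^+ 2 + complex.Im (z : R[i]) ^+ 2).
Proof. by rewrite /nrm normc_def. Qed.

Lemma nrm_geRe (z : C) : `|complex.Re (z : R[i])| <= nrm z.
Proof. by rewrite nrm_sqrt -sqrtr_sqr ler_wsqrtr // lerDl sqr_ge0. Qed.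

Lemma nrm_geIm (z : C) : `|complex.Im (z : R[i])| <= nrm z.
Proof. by rewrite nrm_sqrt -sqrtr_sqr ler_wsqrtr // lerDr sqr_ge0. Qed.

Lemma nrm_leRI (z : C) :
  nrm z <= `|complex.Re (z : R[i])| + `|complex.Im (z : R[i])|.
Proof.
rewrite nrm_sqrt -[leRHS]ger0_norm ?addr_ge0 // -sqrtr_sqr ler_wsqrtr //.
by rewrite sqrrD !real_normK ?num_real // -addrA lerD2l lerDr mulrn_wge0 // mulr_ge0.
Qed.

Lemma ReB (z w : C) :
  complex.Re ((z - w : C) : R[i]) = complex.Re (z : R[i]) - complex.Re (w : R[i]).
Proof. by case: z; case: w. Qed.
Lemma ImB (z w : C) :
  complex.Im ((z - w : C) : R[i]) = complex.Im (z : R[i]) - complex.Im (w : R[i]).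
Proof. by case: z; case: w. Qed.

Definition lim_to (u : nat -> C) (l : C) : Prop :=
  forall e : R, 0 < e -> exists N, forall n, (N <= n)%N -> nrm (u n - l) <= e.

Lemma R_complete (u : nat -> R) :
  (forall e : R, 0 < e -> exists N, forall m n, (N <= m)%N -> (N <= n)%N ->
     `|u m - u n| <= e) ->
  exists l, forall e, 0 < e -> exists N, forall n, (N <= n)%N -> `|u n - l| <= e.
Proof.
move=> H; have cu : cauchy (u @ \oo)%classic.
  apply: cauchy_exP => e e0; have [N HN] := H (e / 2) ltac:(lra).
  exists (u N); exists N => // n /= Nn; rewrite /ball /=.
  by have := HN _ _ (leqnn N) Nn; lra.
have cv : cvg (u @ \oo)%classic by exact: cauchy_cvg.
exists (limn u) => e e0.
move/cvgrPdist_le : cv => /(_ e e0)[N _ HN]; exists N => n Nn.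
by rewrite distrC; exact: HN.
Qed.

Lemma C_complete (u : nat -> C) :
  (forall e : R, 0 < e -> exists N, forall m n, (N <= m)%N -> (N <= n)%N ->
     nrm (u m - u n) <= e) ->
  exists l, lim_to u l.
Proof.
move=> H.
have [e e0|a Ha] := @R_complete (fun n => complex.Re (u n : R[i])).
  have [N HN] := H e e0; exists N => m n Nm Nn; rewrite -ReB.
  exact: le_trans (nrm_geRe _) (HN _ _ Nm Nn).
have [e e0|b Hb] := @R_complete (fun n => complex.Im (u n : R[i])).
  have [N HN] := H e e0; exists N => m n Nm Nn; rewrite -ImB.
  exact: le_trans (nrm_geIm _) (HN _ _ Nm Nn).
exists (Complex a b : R[i]) => e e0.
have [N1 H1] := Ha (e / 2) ltac:(lra); have [N2 H2] := Hb (e / 2) ltac:(lra).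
exists (maxn N1 N2) => n; rewrite geq_max => /andP[/H1 h1 /H2 h2].
rewrite (le_trans (nrm_leRI _)) // ReB ImB /=; lra.
Qed.

Lemma lim_to_unique u l l' : lim_to u l -> lim_to u l' -> l = l'.
Proof.
move=> H H'; apply/eqP; rewrite -subr_eq0; apply/eqP/nrm_le_eq0 => e e0.
have [N HN] := H (e / 2) ltac:(lra); have [N' HN'] := H' (e / 2) ltac:(lra).
have := HN _ (leq_maxl N N'); have := HN' _ (leq_maxr N N').
rewrite [nrm (_ - l)]nrmC.
by have := nrm_tri l (u (maxn N N')) l'; lra.
Qed.

Lemma lim_to_le u l K N : lim_to u l -> (forall n, (N <= n)%N -> nrm (u n) <= K) ->
  nrm l <= K.
Proof.
move=> H HK; apply/ler_addgt0Pr => e e0; have [N' HN] := H e e0.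
have := HN _ (leq_maxl N' N); have := HK _ (leq_maxr N' N).
rewrite nrmC => h1 h2.
by have := nrm_tri l (u (maxn N' N)) 0; rewrite !subr0; lra.
Qed.

Lemma lim_toD u v l m : lim_to u l -> lim_to v m -> lim_to (fun n => u n + v n) (l + m).
Proof.
move=> H H' e e0.
have [N HN] := H (e / 2) ltac:(lra); have [N' HN'] := H' (e / 2) ltac:(lra).
exists (maxn N N') => n; rewrite geq_max => /andP[/HN h /HN' h'].
rewrite opprD addrACA (le_trans (nrmD _ _)) //; lra.
Qed.

Lemma lim_toM c u l : lim_to u l -> lim_to (fun n => c * u n) (c * l).
Proof.
move=> H e e0; have k0 := nrm_ge0 c.
have [|N HN] := H (e / (nrm c + 1)); first by rewrite divr_gt0 //; lra.
exists N => n /HN h; rewrite -mulrBr nrmM.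
have : (nrm c + 1) * nrm (u n - l) <= e.
  by rewrite mulrC -ler_pdivlMr //; lra.
have := nrm_ge0 (u n - l); nra.
Qed.

Lemma lim_to_cst l : lim_to (fun=> l) l.
Proof. by move=> e e0; exists 0%N => n _; rewrite subrr nrm0 ltW. Qed.

Lemma lim_toN u l : lim_to u l -> lim_to (fun n => - u n) (- l).
Proof. by move=> H e /H[N HN]; exists N => n /HN; rewrite -opprD nrmN. Qed.

(* Bisection: if every bad configuration contains a bad one of half its size,
   then there are arbitrarily small bad configurations around some point. *)
Lemma nested (X : Type) (s : X -> R) (v : X -> C) (bad : X -> Prop) :
  (forall x, bad x -> 0 <= s x) ->
  (forall x, bad x -> exists y, [/\ bad y, s y <= s x / 2 & nrm (v y - v x) <= s x]) ->
  forall x0, bad x0 ->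
  exists z, forall d, 0 < d -> exists y, [/\ bad y, s y < d & nrm (v y - z) <= 2 * s y].
Proof.
move=> s0 step x0 b0.
pose nx (p : {x | bad x}) : {x | bad x} :=
  let c := cid (step _ (proj2_sig p)) in
  exist _ (proj1_sig c) (let: And3 h _ _ := proj2_sig c in h).
pose q k := iter k nx (exist _ x0 b0).
have qS k : s (sval (q k.+1)) <= s (sval (q k)) / 2 /\
            nrm (v (sval (q k.+1)) - v (sval (q k))) <= s (sval (q k)).
  by rewrite /q iterS /nx /=; case: cid => y /= [].
have qb k : bad (sval (q k)) := proj2_sig (q k).
(* A step moves [v] by at most [s], and [s] then at least halves; hence twice the loss in [s]
   dominates the displacement and telescopes. *)
have qd n k : nrm (v (sval (q (n + k)%N)) - v (sval (q n)))
     <= 2 * s (sval (q n)) - 2 * s (sval (q (n + k)%N)).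
  elim: k => [|k IH]; first by rewrite addn0 subrr nrm0 subrr.
  rewrite addnS; have [h1 h2] := qS (n + k)%N.
  by have := nrm_tri (v (sval (q (n + k).+1))) (v (sval (q (n + k)%N))) (v (sval (q n))); lra.
have qg k : s (sval (q k)) <= s x0 / 2 ^+ k.
  elim: k => [|k IH]; first by rewrite expr0 divr1.
  have [h1 _] := qS k; rewrite exprS invfM mulrCA; lra.
have small d : 0 < d -> exists N, forall n, (N <= n)%N -> s (sval (q n)) < d.
  move=> d0; have := s0 _ b0 => sx0.
  have [N HN] : exists N : nat, s x0 / d < N%:R.
    by exists (Num.bound (s x0 / d)); apply: archi_boundP; rewrite divr_ge0 // ltW.
  exists N => n Nn; apply: le_lt_trans (qg n) _.
  rewrite ltr_pdivrMr ?exprn_gt0 // mulrC -ltr_pdivrMr //.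
  apply: lt_trans HN _; rewrite -natrX ltr_nat.
  by apply: leq_ltn_trans Nn _; exact: ltn_expl.
have [e e0|z Hz] := @C_complete (fun k => v (sval (q k))).
  have [N HN] := small (e / 4) ltac:(lra); exists N => m n Nm Nn.
  have h1 := qd N (m - N)%N; have h2 := qd N (n - N)%N.
  rewrite !subnKC // in h1 h2.
  have := s0 _ (qb m); have := s0 _ (qb n); have := HN _ (leqnn N).
  have := nrm_tri (v (sval (q m))) (v (sval (q N))) (v (sval (q n))).
  by rewrite [nrm (v (sval (q N)) - _)]nrmC; lra.
exists z => d d0; have [N HN] := small d d0.
exists (sval (q N)); split; [exact: qb|exact: HN|].
apply/ler_addgt0Pr => e e0; have [M HM] := Hz e e0.
have := qd N M; have := HM _ (leq_addl N M); have := s0 _ (qb (N + M)%N).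
have := nrm_tri (v (sval (q N))) (v (sval (q (N + M)%N))) z.
by rewrite [nrm (v (sval (q N)) - v _)]nrmC; lra.
Qed.

(** Bisection forms only midpoints and limits, so closure under these two operations stands in for
    closed convex domains. *)
Definition mclosed (D : C -> Prop) := forall a b, D a -> D b -> D ((a + b) / 2).
Definition sclosed (D : C -> Prop) :=
  forall z, (forall d, 0 < d -> exists2 w, D w & nrm (w - z) <= d) -> D z.

Lemma half_nrm (a b : C) : nrm ((a - b) / 2) = nrm (a - b) / 2.
Proof. by rewrite nrm_div nrm_nat. Qed.

Lemma mclosed_ball z r : mclosed (fun w => nrm (w - z) <= r).
Proof.
move=> a b ha hb.
have -> : (a + b) / 2 - z = ((a - z) - (z - b)) / 2 by field.
by rewrite half_nrm; have := nrmB (a - z) (z - b); rewrite [nrm (z - b)]nrmC; lra.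
Qed.

Lemma mclosed_oball z r : mclosed (fun w => nrm (w - z) < r).
Proof.
move=> a b ha hb.
have -> : (a + b) / 2 - z = ((a - z) - (z - b)) / 2 by field.
by rewrite half_nrm; have := nrmB (a - z) (z - b); rewrite [nrm (z - b)]nrmC; lra.
Qed.

Lemma sclosed_ball z r : sclosed (fun w => nrm (w - z) <= r).
Proof.
move=> x H; apply/ler_addgt0Pr => e /H[w wz h].
by have := nrm_tri x w z; rewrite [nrm (x - w)]nrmC; lra.
Qed.

Lemma mclosedI D E : mclosed D -> mclosed E -> mclosed (fun w => D w /\ E w).
Proof. by move=> h1 h2 a b [? ?] [? ?]; split; [apply: h1|apply: h2]. Qed.

Lemma halfsub (a b : C) : ((a + b) / 2 - a) = (b - a) / 2.
Proof. by field. Qed.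
Lemma halfsub' (a b : C) : (b - (a + b) / 2) = (b - a) / 2.
Proof. by field. Qed.

(** If a chord is steeper than [K + eta], so is one of its halves; chords shrinking to [z] then
    contradict the derivative at [z]. The slack [eta] absorbs the error term of the derivative and
    is arbitrary. *)
Lemma mvt (D : C -> Prop) (f : C -> C) (K : R) : mclosed D -> sclosed D ->
  (forall z, D z -> exists2 l, has_d f z l & nrm l <= K) ->
  forall a b, D a -> D b -> nrm (f b - f a) <= K * nrm (b - a).
Proof.
move=> mD sD df a b Da Db; have K0 : 0 <= K.
  by have [l _ /(le_trans (nrm_ge0 _))] := df a Da.
suff H eta : 0 < eta -> nrm (f b - f a) <= (K + eta) * nrm (b - a).
  apply/ler_addgt0Pr => e e0; have n0 := nrm_ge0 (b - a).
  have e1 : 0 < e / (nrm (b - a) + 1) by rewrite divr_gt0 //; lra.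
  have := H _ e1; rewrite mulrDl => /le_trans; apply.
  rewrite lerD2l mulrAC ler_pdivrMr; nra.
move=> eta0; case: leP => // B.
pose s (x : C * C) := nrm (x.2 - x.1).
pose bad (x : C * C) := [/\ D x.1, D x.2 &
  (K + eta) * nrm (x.2 - x.1) < nrm (f x.2 - f x.1)].
have [|[x y] [/= Dx Dy Hb]||z Hz] := @nested _ s fst bad _ _ (a, b).
- by move=> x _; exact: nrm_ge0.
- have Dm := mD _ _ Dx Dy; pose m := (x + y) / 2.
  have hx : nrm (m - x) = nrm (y - x) / 2 by rewrite /m halfsub half_nrm.
  have hy : nrm (y - m) = nrm (y - x) / 2 by rewrite /m halfsub' half_nrm.
  have n0 := nrm_ge0 (y - x).
  have [B1|B1] := ltP ((K + eta) * nrm (m - x)) (nrm (f m - f x)).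
    exists (x, m); rewrite /s /bad /= hx subrr nrm0; split=> //.
    by split => //; rewrite -hx.
  exists (m, y); rewrite /s /bad /= hx hy; split => //; last by lra.
  split=> //; rewrite -hy; have := nrm_tri (f y) (f m) (f x); nra.
- by [].
- have Dz : D z.
    apply: sD => d d0; have [[x y] [[/= Dx _ _]]] := Hz (d / 2) ltac:(lra).
    by rewrite /s /= => h1 h2; exists x => //; lra.
  (* The point [z] need not lie on the chord: the ends are within 2 and 3 chord lengths of it, so
     tolerance [eta / 6] costs at most 5/6 of [eta] per unit length. *)
  have [l dl lK] := df z Dz; have [d d0 Hd] := dl (eta / 6) ltac:(lra).
  have [[x y] [[/= Dx Dy Hb]]] := Hz (d / 3) ltac:(lra).
  rewrite /s /= => h1 h2; have n0 := nrm_ge0 (y - x).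
  have yz : nrm (y - z) <= 3 * nrm (y - x).
    by have := nrm_tri y x z; lra.
  have := Hd (x - z) ltac:(lra); have := Hd (y - z) ltac:(lra).
  rewrite !(addrC z) !subrK => hy hx.
  have : nrm (f y - f x) <= nrm (f y - f z - l * (y - z)) + nrm (f x - f z - l * (x - z))
      + nrm l * nrm (y - x).
    have -> : f y - f x = (f y - f z - l * (y - z)) - (f x - f z - l * (x - z)) + l * (y - x).
      by ring.
    by rewrite -nrmM (le_trans (nrmD _ _)) // lerD2r nrmB.
  have : 0 < nrm (y - x).
    rewrite nrm_gt0 subr_eq0; apply/eqP => xy; move: Hb.
    by rewrite xy !subrr nrm0; lra.
  by move: Hb; rewrite mulrDl; nra.
Qed.

(* The midpoint sum with [2 ^ n] panels for the integral of [f] from [a] to [b];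
   its limit replaces path integrals. *)
Fixpoint mid n (f : C -> C) (a b : C) : C :=
  if n is n'.+1 then mid n' f a ((a + b) / 2) + mid n' f ((a + b) / 2) b
  else f ((a + b) / 2) * (b - a).

Lemma mid_bound n D f K : mclosed D -> (forall w, D w -> nrm (f w) <= K) ->
  forall a b, D a -> D b -> nrm (mid n f a b) <= K * nrm (b - a).
Proof.
move=> mD HK; elim: n => [|n IH] a b Da Db /=.
  by rewrite nrmM ler_wpM2r ?nrm_ge0 // HK //; exact: mD.
have Dm := mD _ _ Da Db; have h1 := IH _ _ Da Dm; have h2 := IH _ _ Dm Db.
rewrite (le_trans (nrmD _ _)) //.
rewrite halfsub half_nrm in h1; rewrite halfsub' half_nrm in h2; lra.
Qed.

Lemma midB n f g a b :
  mid n (fun w => f w - g w) a b = mid n f a b - mid n g a b.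
Proof.
elim: n a b => [|n IH] a b /=; first by rewrite mulrBl.
by rewrite !IH opprD addrACA.
Qed.

(** The midpoint rule is exact on affine functions: the sum does not depend on [n], and around a
    closed triangle it vanishes. *)
Lemma mid_aff n z p q a b :
  mid n (fun w => p + q * (w - z)) a b
  = p * (b - a) + q * ((b - z) ^+ 2 - (a - z) ^+ 2) / 2.
Proof. by elim: n a b => [|n IH] a b /=; [field|rewrite !IH; field]. Qed.

Lemma mid_sym n f a b : mid n f b a = - mid n f a b.
Proof.
elim: n a b => [|n IH] a b /=; first by rewrite [b + a]addrC -mulrN opprB.
rewrite [b + a]addrC (IH a ((a + b) / 2)) (IH ((a + b) / 2) b); ring.
Qed.

Definition tri n f a b c := mid n f a b + mid n f b c + mid n f c a.

(** One level of the recursion is spent on halving the sides; the three inner segments are traversed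
    in both directions and cancel. *)
Lemma tri_split n f a b c :
  let ab := (a + b) / 2 in let bc := (b + c) / 2 in let ca := (c + a) / 2 in
  tri n.+1 f a b c = tri n f a ab ca + tri n f ab b bc + tri n f bc c ca + tri n f ab bc ca.
Proof.
move=> ab bc ca; rewrite /tri /= -/ab -/bc -/ca.
by rewrite (mid_sym n f ca ab) (mid_sym n f ab bc) (mid_sym n f bc ca); ring.
Qed.

(** Quadrisection: if the sums over a triangle exceed [e] times the squared perimeter for
    arbitrarily large [n], the same holds for one of the four half-size triangles. Near the limit
    point [f] is affine up to an error small against the distance, and affine functions contribute
    nothing. *)
Lemma goursat (D : C -> Prop) f : mclosed D -> sclosed D ->
  (forall z, D z -> exists l, has_d f z l) ->
  forall a b c, D a -> D b -> D c -> lim_to (fun n => tri n f a b c) 0.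
Proof.
move=> mD sD df a b c Da Db Dc e0 e00.
pose s (x : C * C * C) := nrm (x.1.2 - x.1.1) + nrm (x.2 - x.1.2) + nrm (x.1.1 - x.2).
pose e := e0 / (s (a, b, c) ^+ 2 + 1).
have s0 x : 0 <= s x by rewrite !addr_ge0 ?nrm_ge0.
have sp : 0 < s (a, b, c) ^+ 2 + 1 by have := sqr_ge0 (s (a, b, c)); lra.
have e_gt0 : 0 < e by rewrite divr_gt0.
(* Badness is required beyond every [N] because each subdivision uses up one level of [n]. *)
pose bad (x : C * C * C) := [/\ D x.1.1, D x.1.2, D x.2 &
  forall N, exists2 n, (N <= n)%N & e * s x ^+ 2 < nrm (tri n f x.1.1 x.1.2 x.2)].
have [nb|nb] := pselect (bad (a, b, c)); last first.
  apply: contrapT => H; apply: nb; split => // N; apply: contrapT => H'; apply: H.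
  exists N => n Nn; rewrite subr0; case: leP => // B; exfalso; apply: H'; exists n => //.
  apply: le_lt_trans B; rewrite /e mulrAC ler_pdivrMr //; nra.
exfalso; have [|[[x y] t] [/= Dx Dy Dt Hb]||z Hz] := @nested _ s (fun x => x.1.1) bad _ _ (a, b, c).
- by [].
- pose xy := (x + y) / 2; pose yt := (y + t) / 2; pose tx := (t + x) / 2.
  have Dxy : D xy by exact: mD.
  have Dyt : D yt by exact: mD.
  have Dtx : D tx by exact: mD.
  have q1 : nrm (xy - x) = nrm (y - x) / 2 by rewrite /xy halfsub half_nrm.
  have q2 : nrm (y - xy) = nrm (y - x) / 2 by rewrite /xy halfsub' half_nrm.
  have q3 : nrm (yt - y) = nrm (t - y) / 2 by rewrite /yt halfsub half_nrm.
  have q4 : nrm (t - yt) = nrm (t - y) / 2 by rewrite /yt halfsub' half_nrm.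
  have q5 : nrm (tx - t) = nrm (x - t) / 2 by rewrite /tx halfsub half_nrm.
  have q6 : nrm (x - tx) = nrm (x - t) / 2 by rewrite /tx halfsub' half_nrm.
  have q7 : nrm (yt - xy) = nrm (x - t) / 2.
    by rewrite nrmC -half_nrm; congr nrm; rewrite /yt /xy; field.
  have q8 : nrm (tx - yt) = nrm (y - x) / 2.
    by rewrite nrmC -half_nrm; congr nrm; rewrite /yt /tx; field.
  have q9 : nrm (xy - tx) = nrm (t - y) / 2.
    by rewrite nrmC -half_nrm; congr nrm; rewrite /tx /xy; field.
  have S1 : s (x, xy, tx) = s (x, y, t) / 2.
    by rewrite /s /= q1 q6 [nrm (tx - xy)]nrmC q9; field.
  have S2 : s (xy, y, yt) = s (x, y, t) / 2.
    by rewrite /s /= q2 q3 [nrm (xy - yt)]nrmC q7; field.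
  have S3 : s (yt, t, tx) = s (x, y, t) / 2.
    by rewrite /s /= q4 q5 [nrm (yt - tx)]nrmC q8; field.
  have S4 : s (xy, yt, tx) = s (x, y, t) / 2.
    by rewrite /s /= q7 q8 q9; field.
  have n1 := nrm_ge0 (y - x); have n2 := nrm_ge0 (t - y); have n3 := nrm_ge0 (x - t).
  have [b1|nb1] := pselect (bad (x, xy, tx)).
    by exists (x, xy, tx); split => //=; rewrite ?S1 // subrr nrm0; exact: s0.
  have [b2|nb2] := pselect (bad (xy, y, yt)).
    by exists (xy, y, yt); split => //=; rewrite ?S2 // q1 /s /=; lra.
  have [b3|nb3] := pselect (bad (yt, t, tx)).
    exists (yt, t, tx); split => //=; rewrite ?S3 //.
    by have := nrm_tri yt y x; rewrite q3 /s /=; lra.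
  have [b4|nb4] := pselect (bad (xy, yt, tx)).
    by exists (xy, yt, tx); split => //=; rewrite ?S4 // q1 /s /=; lra.
  exfalso.
  have nbP u v w : D u -> D v -> D w -> ~ bad (u, v, w) ->
      exists N, forall n, (N <= n)%N -> nrm (tri n f u v w) <= e * s (u, v, w) ^+ 2.
    move=> Du Dv Dw nb'; apply: contrapT => H; apply: nb'; split => //= N.
    apply: contrapT => H'; apply: H; exists N => n Nn; case: leP => // B.
    by exfalso; apply: H'; exists n.
  have [N1 H1] := nbP _ _ _ Dx Dxy Dtx nb1.
  have [N2 H2] := nbP _ _ _ Dxy Dy Dyt nb2.
  have [N3 H3] := nbP _ _ _ Dyt Dt Dtx nb3.
  have [N4 H4] := nbP _ _ _ Dxy Dyt Dtx nb4.
  have [[//|n] Nn] := Hb (maxn (maxn N1 N2) (maxn N3 N4)).+1.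
  rewrite ltnS !geq_max in Nn; case/andP: Nn => /andP[/H1 h1 /H2 h2] /andP[/H3 h3 /H4 h4].
  rewrite tri_split -/xy -/yt -/tx.
  move: h1 h2 h3 h4; rewrite S1 S2 S3 S4 => h1 h2 h3 h4.
  have g1 := nrmD (tri n f x xy tx + tri n f xy y yt + tri n f yt t tx) (tri n f xy yt tx).
  have g2 := nrmD (tri n f x xy tx + tri n f xy y yt) (tri n f yt t tx).
  have g3 := nrmD (tri n f x xy tx) (tri n f xy y yt).
  have : e * (s (x, y, t) / 2) ^+ 2 = e * s (x, y, t) ^+ 2 / 4 by field.
  lra.
- by [].
- have Dz : D z.
    apply: sD => d d0; have [[[x y] t] [[/= Dx _ _ _]]] := Hz (d / 2) ltac:(lra).
    by move=> h1 h2; exists x => //; lra.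
  have [l dl] := df z Dz; have [d d0 Hd] := dl (e / 4) ltac:(lra).
  have [[[x y] t] [[/= Dx Dy Dt Hb]]] := Hz (d / 4) ltac:(lra).
  set S := s _ in Hb * => h1 h2.
  have n1 := nrm_ge0 (y - x); have n2 := nrm_ge0 (t - y); have n3 := nrm_ge0 (x - t).
  have SE : S = nrm (y - x) + nrm (t - y) + nrm (x - t) by [].
  have yz : nrm (y - z) <= 3 * S by have := nrm_tri y x z; lra.
  have tz : nrm (t - z) <= 3 * S.
    by have := nrm_tri t x z; rewrite [nrm (t - x)]nrmC; lra.
  have xz : nrm (x - z) <= 3 * S by have := s0 (x, y, t); rewrite -/S; lra.
  have [n _] := Hb 0%N.
  (* The affine approximation at [z]. The vertices lie within [3 * S] of [z], so tolerance [e / 4]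
     yields three quarters of [e * S ^ 2]. *)
  pose g w := f z + l * (w - z).
  have Hg w : nrm (w - z) <= 3 * S -> nrm (f w - g w) <= (e / 4 * (3 * S)).
    move=> wz; have := Hd (w - z) ltac:(lra); rewrite (addrC z) subrK /g opprD addrA.
    move=> /le_trans; apply; rewrite ler_wpM2l //; lra.
  have M u v : nrm (u - z) <= 3 * S -> nrm (v - z) <= 3 * S ->
      nrm (mid n f u v - mid n g u v) <= (e / 4 * (3 * S)) * nrm (v - u).
    by move=> hu hv; rewrite -midB; exact: (mid_bound _ (@mclosed_ball z (3 * S)) Hg).
  have -> : tri n f x y t = (mid n f x y - mid n g x y) + (mid n f y t - mid n g y t)
     + (mid n f t x - mid n g t x).
    by rewrite /tri !mid_aff; field.
  have := M _ _ xz yz; have := M _ _ yz tz; have := M _ _ tz xz.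
  set A := mid _ _ t x - _; set B := mid _ _ y t - _; set A' := mid _ _ x y - _.
  have := nrmD (A' + B) A; have := nrmD A' B.
  have S0 : 0 <= S by exact: s0.
  have : e / 4 * (3 * S) * nrm (y - x) + e / 4 * (3 * S) * nrm (t - y)
      + e / 4 * (3 * S) * nrm (x - t) = 3 / 4 * (e * S ^+ 2) by rewrite SE; field.
  have : 0 <= e * S ^+ 2 by rewrite mulr_ge0 ?sqr_ge0 // ltW.
  lra.
Qed.

(** Bisection applied to the failure of the Cauchy condition: a segment is bad when sums of
    arbitrarily high level differ by more than [e] times its length. Near the limit point [f] is
    almost constant, and every sum is close to [f z] times the increment. *)
Lemma mid_cvg (D : C -> Prop) f : mclosed D -> sclosed D ->
  (forall z, D z -> forall e, 0 < e -> exists2 d, 0 < d &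
      forall w, nrm (w - z) < d -> nrm (f w - f z) <= e) ->
  forall a b, D a -> D b -> exists l, lim_to (fun n => mid n f a b) l.
Proof.
move=> mD sD cf a b Da Db; apply: C_complete => e0 e00.
pose s (x : C * C) := nrm (x.2 - x.1).
pose e := e0 / (s (a, b) + 1).
have s0 x : 0 <= s x by exact: nrm_ge0.
have sp : 0 < s (a, b) + 1 by have := s0 (a, b); lra.
have e_gt0 : 0 < e by rewrite divr_gt0.
pose bad (x : C * C) := [/\ D x.1, D x.2 &
  forall N, exists m n, [/\ (N <= m)%N, (N <= n)%N &
    e * s x < nrm (mid m f x.1 x.2 - mid n f x.1 x.2)]].
have nbP u v : D u -> D v -> ~ bad (u, v) ->
    exists N, forall m n, (N <= m)%N -> (N <= n)%N ->
       nrm (mid m f u v - mid n f u v) <= e * s (u, v).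
  move=> Du Dv nb'; apply: contrapT => H; apply: nb'; split => //= N.
  apply: contrapT => H'; apply: H; exists N => m n Nm Nn; case: leP => // B.
  by exfalso; apply: H'; exists m, n.
have [nb|nb] := pselect (bad (a, b)); last first.
  have [N HN] := nbP _ _ Da Db nb; exists N => m n Nm Nn.
  apply: le_trans (HN _ _ Nm Nn) _; rewrite /e mulrAC ler_pdivrMr //.
  by have := s0 (a, b); nra.
exfalso; have [|[x y] [/= Dx Dy Hb]||z Hz] := @nested _ s fst bad _ _ (a, b).
- by [].
- have Dm := mD _ _ Dx Dy; pose m := (x + y) / 2.
  have hx : nrm (m - x) = nrm (y - x) / 2 by rewrite /m halfsub half_nrm.
  have hy : nrm (y - m) = nrm (y - x) / 2 by rewrite /m halfsub' half_nrm.
  have n0 := nrm_ge0 (y - x).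
  have [b1|nb1] := pselect (bad (x, m)).
    by exists (x, m); split => //=; rewrite /s /= ?hx // subrr nrm0.
  have [b2|nb2] := pselect (bad (m, y)).
    by exists (m, y); split => //=; rewrite /s /= ?hy // hx; lra.
  have [N1 H1] := nbP _ _ Dx Dm nb1; have [N2 H2] := nbP _ _ Dm Dy nb2.
  exfalso; have [k [k' [+ +]]] := Hb (maxn N1 N2).+1.
  case: k => [//|p]; case: k' => [//|q].
  rewrite !ltnS !geq_max => /andP[p1 p2] /andP[r1 r2] /=.
  have := H1 _ _ p1 r1; have := H2 _ _ p2 r2; rewrite /s /= -/m hx hy.
  rewrite opprD addrACA.
  by have := nrmD (mid p f x m - mid q f x m) (mid p f m y - mid q f m y); nra.
- by [].
- have Dz : D z.
    apply: sD => d d0; have [[x y] [[/= Dx _ _]]] := Hz (d / 2) ltac:(lra).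
    by rewrite /s /= => h1 h2; exists x => //; lra.
  have [d d0 Hd] := cf z Dz (e / 2) ltac:(lra).
  have [[x y] [[/= Dx Dy Hb]]] := Hz (d / 4) ltac:(lra).
  rewrite /s /= => h1 h2; have n0 := nrm_ge0 (y - x).
  have yz : nrm (y - z) < d.
    by have := nrm_tri y x z; lra.
  have xz : nrm (x - z) < d by lra.
  have [m [n [_ _]]] := Hb 0%N; rewrite /s /=.
  have H k : nrm (mid k f x y - f z * (y - x)) <= e / 2 * nrm (y - x).
    have -> : f z * (y - x) = mid k (fun w => f z + 0 * (w - z)) x y.
      by rewrite mid_aff; ring.
    rewrite -midB; apply: (mid_bound _ (@mclosed_oball z d)) => // w wz.
    by rewrite mul0r addr0 Hd.
  have := H m; have := H n.
  by have := nrm_tri (mid m f x y) (f z * (y - x)) (mid n f x y);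
     rewrite [nrm (_ * _ - _)]nrmC; lra.
Qed.

Lemma has_d_cont f z l : has_d f z l -> forall e, 0 < e -> exists2 d, 0 < d &
   forall w, nrm (w - z) < d -> nrm (f w - f z) <= e.
Proof.
move=> H e e0; have [d d0 Hd] := H 1 ltr01; have l0 := nrm_ge0 l.
exists (Num.min d (e / (nrm l + 1))).
  by rewrite lt_min d0 divr_gt0 //; lra.
move=> w; rewrite lt_min => /andP[wd we].
have := Hd _ wd; rewrite (addrC z) subrK mul1r => h.
have : (nrm l + 1) * nrm (w - z) < e by rewrite mulrC -ltr_pdivlMr //; lra.
have := nrmD (f w - f z - l * (w - z)) (l * (w - z)); rewrite subrK nrmM; lra.
Qed.

(** A primitive is recorded through its increments as limits of sums, not through its derivative:
    this gives increment bounds over any midpoint-closed set ([prim_bound]), and the derivative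
    wherever [f] is continuous ([prim_d]). *)
Definition prim (r : R) (f P : C -> C) := forall a b, nrm a < r -> nrm b < r ->
  lim_to (fun n => mid n f a b) (P b - P a).

(** Here [P] is the integral from 0; that its increments are integrals is Goursat's theorem for the
    triangle with vertices [0], [a], [b]. *)
Lemma primitive r f : 0 < r -> (forall z, nrm z < r -> exists l, has_d f z l) ->
  exists P, prim r f P.
Proof.
move=> r0 df.
have H z : exists l, nrm z < r -> lim_to (fun n => mid n f 0 z) l.
  have [zr|] := ltP (nrm z) r; last by exists 0.
  have [|||l Hl] := mid_cvg (@mclosed_ball 0 (nrm z)) (@sclosed_ball 0 (nrm z)) (f := f) _ (a := 0) (b := z).
  - move=> w; rewrite subr0 => wz.
    by have [l dl] := df w (le_lt_trans wz zr); exact: has_d_cont dl.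
  - by rewrite subrr nrm0 nrm_ge0.
  - by rewrite subr0.
  - by exists l.
have [P HP] := choice H; exists P => a b ar br.
pose r' := Num.max (nrm a) (nrm b).
have r'r : r' < r by rewrite gt_max ar br.
have G : lim_to (fun n => tri n f 0 a b) 0.
  apply: (goursat (@mclosed_ball 0 r') (@sclosed_ball 0 r')).
  - by move=> z; rewrite subr0 => zr; apply: df; exact: le_lt_trans zr r'r.
  - by rewrite subrr nrm0 le_max nrm_ge0.
  - by rewrite subr0 le_max lexx.
  - by rewrite subr0 le_max lexx orbT.
have := lim_toD G (lim_toD (HP b br) (lim_toN (HP a ar))); rewrite add0r.
move=> L e /L[N HN]; exists N => n /HN; congr (_ <= _); congr nrm; congr (_ - _).
by rewrite /tri (mid_sym n f 0 b); ring.
Qed.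

Lemma prim_bound r f P (D : C -> Prop) q K a b : prim r f P -> nrm a < r -> nrm b < r ->
  mclosed D -> D a -> D b -> (forall w, D w -> nrm (f w - q) <= K) ->
  nrm (P b - P a - q * (b - a)) <= K * nrm (b - a).
Proof.
move=> H ar br mD Da Db HK.
have L := lim_toD (H _ _ ar br) (lim_to_cst (- (q * (b - a)))).
apply: (lim_to_le (N := 0) L) => n _.
have -> : q * (b - a) = mid n (fun w => q + 0 * (w - 0)) a b by rewrite mid_aff; ring.
by rewrite -midB; apply: (mid_bound _ mD) => // w Dw; rewrite mul0r addr0 HK.
Qed.

Lemma prim_d r f P z : prim r f P -> nrm z < r ->
  (forall e, 0 < e -> exists2 d, 0 < d &
     forall w, nrm (w - z) < d -> nrm (f w - f z) <= e) ->
  has_d P z (f z).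
Proof.
move=> H zr cf e e0; have [d d0 Hd] := cf e e0.
exists (Num.min d (r - nrm z)); first by rewrite lt_min d0 subr_gt0.
move=> h; rewrite lt_min => /andP[hd hr].
have zh : nrm (z + h) < r by have := nrmD z h; lra.
have := prim_bound H zr zh (@mclosed_oball z d) _ _ Hd.
by rewrite subrr nrm0 [z + h - z]addrC addKr => /(_ d0 hd).
Qed.

End Goursat.

(** * Cauchy's formula *)

Section Cauchy.
Variable R : realType.
Local Notation C := (Cplx R).
Local Notation nrm := (@nrm R).

Definition sq (z : C) : C := sqrtc (z : R[i]).
Lemma sqK z : sq z ^+ 2 = z. Proof. exact: sqr_sqrtc. Qed.
Lemma nrm_sq z : nrm z = 1 -> nrm (sq z) = 1.
Proof.
move=> h; have := nrm_ge0 (sq z); have : nrm (sq z) ^+ 2 = 1 by rewrite -nrmX sqK.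
by move/eqP; rewrite sqrf_eq1 => /orP[/eqP//|/eqP->]; lra.
Qed.

(* The mean of [phi] over the [2 ^ n]-th roots of unity, a discrete circle
   integral. *)
Fixpoint avg n (phi : C -> C) : C :=
  if n is n'.+1 then avg n' (fun eta => (phi (sq eta) + phi (- sq eta)) / 2)
  else phi 1.

Lemma avg_ext n phi psi : (forall z, nrm z = 1 -> phi z = psi z) ->
  avg n phi = avg n psi.
Proof.
elim: n phi psi => [|n IH] phi psi H /=; first by rewrite H ?nrm1.
by apply: IH => z /nrm_sq h; rewrite !H ?nrmN.
Qed.

Lemma avg_bound n phi K : (forall z, nrm z = 1 -> nrm (phi z) <= K) ->
  nrm (avg n phi) <= K.
Proof.
elim: n phi => [|n IH] phi H /=; first by rewrite H ?nrm1.
apply: IH => z /nrm_sq h; rewrite nrm_div nrm_nat.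
have h1 := H (sq z) h; have h2 := H (- sq z); rewrite nrmN in h2; have {}h2 := h2 h.
by have := nrmD (phi (sq z)) (phi (- sq z)); lra.
Qed.

Lemma avgD n phi psi : avg n (fun z => phi z + psi z) = avg n phi + avg n psi.
Proof.
elim: n phi psi => [|n IH] phi psi //=; rewrite -IH.
by apply: avg_ext => z _; field.
Qed.

Lemma avgZ n c phi : avg n (fun z => c * phi z) = c * avg n phi.
Proof.
elim: n phi => [|n IH] phi //=; rewrite -IH.
by apply: avg_ext => z _; field.
Qed.

Lemma avgB n phi psi : avg n (fun z => phi z - psi z) = avg n phi - avg n psi.
Proof.
rewrite avgD -mulN1r -avgZ; congr (_ + _).
by apply: avg_ext => z _; rewrite mulN1r.
Qed.

Lemma sqr_eq (a b : C) : a ^+ 2 = b ^+ 2 -> a = b \/ a = - b.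
Proof. by move/eqP; rewrite eqf_sqr => /orP[]/eqP; [left|right]. Qed.

(** The points [om * sq z] and [sq (om ^ 2 * z)] agree up to sign, and the sum over both signs does
    not see the difference; squaring [om] lowers the exponent for the induction. *)
Lemma avg_rot n om phi : om ^+ (2 ^ n) = 1 -> avg n (fun z => phi (om * z)) = avg n phi.
Proof.
elim: n om phi => [|n IH] om phi /=; first by rewrite expn0 expr1 => ->; rewrite mul1r.
rewrite expnS exprM => omn; rewrite -[RHS](IH (om ^+ 2)) //.
apply: avg_ext => z _.
have : (om * sq z) ^+ 2 = sq (om ^+ 2 * z) ^+ 2 by rewrite exprMn !sqK.
rewrite mulrN => /sqr_eq[->//|->]; rewrite opprK.
by rewrite [phi (- _) + _]addrC.
Qed.

Lemma nrm_neq (a b : C) : nrm a <> nrm b -> a - b != 0.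
Proof. by move=> h; apply/eqP => /subr0_eq ab; apply: h; rewrite ab. Qed.

(** Averaging [z / (z - u)] over the two square roots of [eta] gives [eta / (eta - u ^ 2)], so each
    level squares [u]. This is the discrete Cauchy integral of the constant 1. *)
Lemma avg_geom n u : nrm u < 1 ->
  avg n (fun z => z / (z - u)) = 1 / (1 - u ^+ (2 ^ n)).
Proof.
elim: n u => [|n IH] u u1 /=; first by rewrite expn0 expr1.
rewrite expnS exprM -IH; last by rewrite nrmX expr_lt1 ?nrm_ge0.
apply: avg_ext => z z1; have s1 := nrm_sq z1.
have h1 : sq z - u != 0 by apply: nrm_neq; rewrite s1; lra.
have h2 : - sq z - u != 0 by apply: nrm_neq; rewrite nrmN s1; lra.
have h3 : sq z ^+ 2 - u ^+ 2 != 0.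
  by apply: nrm_neq; rewrite sqK z1 nrmX; have := nrm_ge0 u; nra.
move: (sq z) h1 h2 h3 (sqK z) => s h1 h2 h3 <-; field.
by rewrite h1 h2 h3.
Qed.

Lemma has_dD f g z l m : has_d f z l -> has_d g z m ->
  has_d (fun w => f w + g w : C) z (l + m).
Proof.
move=> H1 H2 e e0; have [d1 d10 h1] := H1 (e / 2) ltac:(lra).
have [d2 d20 h2] := H2 (e / 2) ltac:(lra).
exists (Num.min d1 d2); first by rewrite lt_min d10.
move=> h; rewrite lt_min => /andP[/h1 {}h1 /h2 {}h2].
have -> : f (z + h) + g (z + h) - (f z + g z) - (l + m) * h =
  (f (z + h) - f z - l * h) + (g (z + h) - g z - m * h) by ring.
rewrite (le_trans (nrmD _ _)) //; lra.
Qed.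

Lemma has_dZ c f z l : has_d f z l -> has_d (fun w => c * f w : C) z (c * l).
Proof.
move=> H e e0; have k0 := nrm_ge0 c.
have [|d d0 Hd] := H (e / (nrm c + 1)); first by rewrite divr_gt0 //; lra.
exists d => // h hd; have {}Hd := Hd h hd.
have -> : c * f (z + h) - c * f z - c * l * h = c * (f (z + h) - f z - l * h) by ring.
rewrite nrmM; have n0 := nrm_ge0 (f (z + h) - f z - l * h).
have : (nrm c + 1) * nrm (f (z + h) - f z - l * h) <= e * nrm h.
  by rewrite mulrC -ler_pdivlMr 1?mulrAC //; lra.
nra.
Qed.

Lemma has_d_aff (f : C -> C) p v s l : has_d f (p + s * v) l ->
  has_d (fun t => f (p + t * v)) s (l * v).
Proof.
move=> H e e0; have k0 := nrm_ge0 v.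
have [|d d0 Hd] := H (e / (nrm v + 1)); first by rewrite divr_gt0 //; lra.
exists (d / (nrm v + 1)); first by rewrite divr_gt0 //; lra.
move=> h; rewrite ltr_pdivlMr; last by lra.
move=> hd; have h0 := nrm_ge0 h; have := Hd (h * v); rewrite nrmM => /(_ ltac:(nra)).
have -> : p + (s + h) * v = p + s * v + h * v by ring.
have -> : l * v * h = l * (h * v) by ring.
move=> /le_trans; apply; rewrite mulrAC ler_pdivrMr; last by lra.
nra.
Qed.

Lemma avg_has_d n (phi : C -> C -> C) phi' s :
  (forall z, nrm z = 1 -> has_d (phi z) s (phi' z)) ->
  has_d (fun t => avg n (phi^~ t)) s (avg n phi').
Proof.
elim: n phi phi' => [|n IH] phi phi' H /=; first by apply: H; rewrite nrm1.
apply: (IH (fun eta t => (phi (sq eta) t + phi (- sq eta) t) / 2)) => z /nrm_sq z1.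
have := has_dZ 2^-1 (has_dD (H (sq z) z1) (H (- sq z) _)); rewrite nrmN => /(_ z1).
rewrite mulrC => K e /K[d d0 Hd]; exists d => // h /Hd.
by rewrite ![2^-1 * _]mulrC.
Qed.

(** A square root [s] of [om] with nonnegative real part satisfies [nrm (s + 1) >= 4 / 3], and
    [(s - 1) * (s + 1) = om - 1]; so iterated square roots of -1 approach 1 geometrically. *)
Lemma exists_root n : exists2 om : C, om ^+ (2 ^ n) = -1 & nrm (om - 1) <= 2 * (3 / 4) ^+ n.
Proof.
elim: n => [|n [om omn omb]].
  by exists (-1); rewrite ?expr1 // expr0 mulr1 -opprD nrmN -[1 + 1]/(2%:R) nrm_nat.
have om1 : nrm om = 1.
  apply/eqP; rewrite -(@pexpr_eq1 _ _ (2 ^ n)) ?nrm_ge0 ?expn_gt0 //.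
  by rewrite -nrmX omn nrmN nrm1.
have [s sE sR] : exists2 s : C, s ^+ 2 = om & 0 <= complex.Re (s : R[i]).
  have [h|h] := leP 0 (complex.Re (sq om : R[i])); first by exists (sq om); rewrite ?sqK.
  exists (- sq om); first by rewrite sqrrN sqK.
  by move: h; case: (sq om) => a b /=; lra.
exists s; first by rewrite expnS exprM sE.
have h : 4 / 3 <= nrm (s + 1).
  have := nrm_geRe (s + 1); suff -> : complex.Re ((s + 1 : C) : R[i]) = complex.Re (s : R[i]) + 1.
    move=> /(le_trans (ler_norm _)).
    have : nrm s ^+ 2 = 1 by rewrite -nrmX sE om1.
    have e2 (z : C) : nrm z ^+ 2 = complex.Re (z : R[i]) ^+ 2 + complex.Im (z : R[i]) ^+ 2.
      by rewrite nrm_sqrt sqr_sqrtr // addr_ge0 ?sqr_ge0.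
    rewrite e2; have := e2 (s + 1).
    have -> : complex.Re ((s + 1 : C) : R[i]) = complex.Re (s : R[i]) + 1 by case: (s).
    have -> : complex.Im ((s + 1 : C) : R[i]) = complex.Im (s : R[i]).
      by case: (s) => a b /=; rewrite addr0.
    have := nrm_ge0 (s + 1); nra.
  by case: (s).
have E : nrm (s - 1) * nrm (s + 1) = nrm (om - 1).
  by rewrite -nrmM -sE; congr nrm; ring.
have := nrm_ge0 (s - 1); rewrite exprS; nra.
Qed.

Lemma geom_small (q : R) : 0 <= q -> q < 1 -> forall e, 0 < e ->
  exists N, forall n, (N <= n)%N -> q ^+ n <= e.
Proof.
move=> q0 q1 e e0.
have := @cvg_expr _ q; rewrite ger0_norm // => /(_ q1)/cvgrPdist_le/(_ e e0)[N _ HN].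
exists N => n Nn; have := HN n Nn; rewrite sub0r normrN ger0_norm //.
exact: exprn_ge0.
Qed.

Lemma root_small e : 0 < e -> exists N, forall n, (N <= n)%N ->
  exists om : C, [/\ om ^+ (2 ^ n) = 1, om != 1 & nrm (om - 1) <= e].
Proof.
move=> e0; have [||N HN] := @geom_small (3 / 4) _ _ (e / 2) ltac:(lra); [lra|lra|].
exists N.+1 => -[//|n] Nn; have [om omn omb] := exists_root n; exists om; split.
- by rewrite expnSr exprM omn sqrrN expr1n.
- apply/eqP => om1; move: omn; rewrite om1 expr1n => /eqP.
  by rewrite -subr_eq0 opprK -[1 + 1]/(2%:R) pnatr_eq0.
- by have := HN n Nn; lra.
Qed.

(** First-order expansion with a uniform quadratic remainder. Unlike differentiability it survives
    pointwise limits ([c11_lim]), and it bounds the effect of a small rotation in [cauchy_avg]. *)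
Definition c11 (D : C -> Prop) (f f' : C -> C) (K : R) :=
  forall z h, D z -> D (z + h) -> nrm (f (z + h) - f z - f' z * h) <= K * nrm h ^+ 2.

Local Notation disc r := (fun z : C => nrm z < r).

Lemma c11_d r f f' K z : c11 (disc r) f f' K -> nrm z < r -> has_d f z (f' z).
Proof.
move=> H zr e e0; exists (Num.min (r - nrm z) (e / (`|K| + 1))).
  have := normr_ge0 K.
  by rewrite lt_min subr_gt0 zr divr_gt0 //; lra.
move=> h; rewrite lt_min => /andP[hr]; have K0 := normr_ge0 K.
rewrite ltr_pdivlMr; last by lra.
have := H z h zr; have := nrmD z h; have := nrm_ge0 h; have := ler_norm K => k0 h0 h1 h2 h3.
have h4 := h2 ltac:(lra); nra.
Qed.

(* The averages of [x * f (z + s * (x - z)) / (x - z)] over the circle go from a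
   multiple of [f z] at [s = 0] to the discrete Cauchy integral at [s = 1]; their
   derivative in [s] is small because averages are invariant under rotation by [om]. *)
Lemma cauchy_avg rho r f f' K z n om : 0 < r -> 2 * r <= rho -> nrm z < r ->
  c11 (disc rho) f f' K -> om ^+ (2 ^ n) = 1 -> om != 1 ->
  nrm (f z / (1 - (z / rc r) ^+ (2 ^ n))
       - avg n (fun x => f (rc r * x) * (rc r * x) / (rc r * x - z)))
  <= K * r ^+ 2 * nrm (om - 1).
Proof.
move=> r0 r2 zr H omn om1.
have nr : nrm (rc r) = r by rewrite nrm_rc gtr0_norm.
have rc0 : rc r != 0 by rewrite -nrm_gt0 nr.
pose p s x : C := z + s * (rc r * x - z).
have dn x : nrm x = 1 -> rc r * x - z != 0.
  by move=> x1; apply: nrm_neq; rewrite nrmM nr x1; lra.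
pose g s := avg n (fun x => rc r * x / (rc r * x - z) * f (p s x)).
(* The parameter [s] is complex; the disc with diameter from 0 to 1 is midpoint-closed and keeps
   both [s] and [1 - s] of norm at most 1, hence [p s x] within [2 * r]. *)
pose D (s : C) := nrm (s - 2^-1) <= 2^-1.
have half : nrm (2^-1 : C) = 2^-1 by rewrite nrmV nrm_nat.
have Ds s : D s -> nrm s <= 1 /\ nrm (1 - s) <= 1.
  rewrite /D => h; split.
    by have := nrmD (s - 2^-1) 2^-1; rewrite subrK half; lra.
  have -> : 1 - s = (2^-1 - s) + 2^-1 by field.
  by have := nrmD (2^-1 - s) 2^-1; rewrite [nrm (_ - s)]nrmC half; lra.
have pD s x : nrm s <= 1 -> nrm (1 - s) <= 1 -> nrm x = 1 -> nrm (p s x) < rho.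
  move=> s1 s2 x1; have -> : p s x = (1 - s) * z + s * (rc r * x) by rewrite /p; ring.
  have := nrmD ((1 - s) * z) (s * (rc r * x)); rewrite !nrmM nr x1.
  have := nrm_ge0 s; have := nrm_ge0 (1 - s); have := nrm_ge0 z; nra.
pose g' s := avg n (fun x => rc r * x * f' (p s x)).
have rho0 : 0 < rho by lra.
have K0 : 0 <= K.
  have := H 0 (rc r); rewrite nrm0 add0r nr => /(_ ltac:(lra) ltac:(lra)).
  by move=> /(le_trans (nrm_ge0 _)); rewrite pmulr_lge0 // exprn_gt0.
have om1' : 0 < nrm (om - 1) by rewrite nrm_gt0 subr_eq0.
have gd s : D s -> has_d g s (g' s).
  move=> /Ds[s1 s2]; apply: avg_has_d => x x1.
  have -> : rc r * x * f' (p s x) =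
      rc r * x / (rc r * x - z) * (f' (p s x) * (rc r * x - z)).
    by field; exact: dn.
  by apply: has_dZ; apply: has_d_aff; apply: c11_d H _; exact: pD.
have g'b s : D s -> nrm (g' s) <= K * r ^+ 2 * nrm (om - 1).
  move=> /Ds[s1 s2]; have [->|s0] := eqVneq s 0.
    suff -> : g' 0 = 0 by rewrite nrm0 !mulr_ge0 // ltW.
    (* At [s = 0] the derivative is a multiple of the average of the roots of unity. Rotation by
       [om != 1] both fixes that average and multiplies it by [om], so it is 0. *)
    have E : g' 0 = f' z * rc r * avg n id.
      rewrite /g' -avgZ; apply: avg_ext => x _.
      by rewrite /p mul0r addr0; ring.
    have : om * avg n id = avg n id by rewrite -avgZ (avg_rot id omn).
    move/eqP; rewrite -subr_eq0 -[X in _ - X]mul1r -mulrBl mulf_eq0 subr_eq0 (negPf om1) /=.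
    by rewrite E => /eqP->; rewrite mulr0.
  (* Replacing [x] by [om * x] leaves the average of [f (p s x)] unchanged, so only the linear term
     survives, and the quadratic remainder bounds it. *)
  have E : avg n (fun x => f (p s (om * x)) - f (p s x)
              - f' (p s x) * (s * rc r * x * (om - 1))) = - (s * (om - 1) * g' s).
    rewrite !avgB (avg_rot (fun x => f (p s x)) omn) subrr sub0r -avgZ; congr (- _).
    by apply: avg_ext => x _; ring.
  have om_n : nrm om = 1.
    apply/eqP; rewrite -(@pexpr_eq1 _ _ (2 ^ n)) ?nrm_ge0 ?expn_gt0 //.
    by rewrite -nrmX omn nrm1.
  have B : nrm (s * (om - 1) * g' s) <= K * (nrm s * r * nrm (om - 1)) ^+ 2.
    rewrite -nrmN -E; apply: avg_bound => x x1.
    have -> : p s (om * x) = p s x + s * rc r * x * (om - 1) by rewrite /p; ring.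
    apply: le_trans (H _ _ (pD _ _ s1 s2 x1) _) _.
      have -> : p s x + s * rc r * x * (om - 1) = p s (om * x) by rewrite /p; ring.
      by apply: pD => //; rewrite nrmM om_n x1 mulr1.
    by rewrite !nrmM nr x1 mulr1.
  have s0' : 0 < nrm s by rewrite nrm_gt0.
  move: B; rewrite !nrmM => B.
  have -> : K * r ^+ 2 * nrm (om - 1) = (K * (nrm s * r * nrm (om - 1)) ^+ 2)
      / (nrm s * nrm (om - 1)) / nrm s.
    by field; rewrite !gt_eqF.
  rewrite ler_pdivlMr // ler_pdivlMr ?mulr_gt0 //.
  have h1 : 0 <= nrm s * nrm (om - 1) * nrm (g' s) by rewrite !mulr_ge0 ?nrm_ge0.
  by apply: le_trans B; rewrite mulrAC -mulrA mulrC [leLHS]mulrC; nra.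
have D0 : D 0 by rewrite /D sub0r nrmN half.
have D1 : D 1.
  rewrite /D; have -> : (1 - 2^-1 : C) = 2^-1 by field.
  by rewrite half.
have := mvt (@mclosed_ball _ 2^-1 2^-1) (@sclosed_ball _ 2^-1 2^-1)
  (fun s Ds => ex_intro2 _ _ (g' s) (gd s Ds) (g'b s Ds)) D0 D1.
rewrite subr0 nrm1 mulr1 nrmC; congr (_ <= _); congr nrm; congr (_ - _).
  have -> : g 0 = f z * avg n (fun x => x / (x - z / rc r)).
    rewrite /g -avgZ; apply: avg_ext => x x1.
    have h0 := dn x x1; rewrite /p mul0r addr0.
    have h1 : x - z / rc r != 0.
      have -> : x - z / rc r = (rc r * x - z) / rc r by field.
      by rewrite mulf_neq0 // invr_eq0.
    move: rc0 h0 h1; move: (rc r) => a a0 h0 h1; field.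
    by rewrite a0 [x * a]mulrC h0.
  by rewrite avg_geom ?mul1r // nrm_div nr ltr_pdivrMr // mul1r.
apply: avg_ext => x x1; rewrite /p mul1r [z + _]addrC subrK.
by rewrite [LHS]mulrC [LHS]mulrA.
Qed.

Lemma c11_bound rho f f' K z : c11 (disc rho) f f' K -> nrm z < rho ->
  nrm (f z) <= nrm (f 0) + nrm (f' 0) * rho + `|K| * rho ^+ 2.
Proof.
move=> H zr; have z0 := nrm_ge0 z.
have := H 0 z; rewrite nrm0 add0r => /(_ (le_lt_trans z0 zr) zr) h.
have -> : f z = (f z - f 0 - f' 0 * z) + (f 0 + f' 0 * z) by ring.
have h1 := nrmD (f z - f 0 - f' 0 * z) (f 0 + f' 0 * z).
have h2 := nrmD (f 0) (f' 0 * z); rewrite nrmM in h2.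
have h3 : K * nrm z ^+ 2 <= `|K| * rho ^+ 2.
  apply: le_trans (ler_wpM2r (sqr_ge0 _) (ler_norm K)) _.
  by rewrite ler_wpM2l // lerXn2r ?nnegrE // ltW // (le_lt_trans z0).
have h4 : nrm (f' 0) * nrm z <= nrm (f' 0) * rho by rewrite ler_wpM2l ?nrm_ge0 ?ltW.
lra.
Qed.

(** Both defects in [cauchy_avg] disappear as [n] grows: [(z / rc r) ^ (2 ^ n)] tends to 0, and the
    root of unity [om != 1] can be taken closer and closer to 1. *)
Lemma cauchy_lim rho r f f' K z : 0 < r -> 2 * r <= rho -> nrm z < r ->
  c11 (disc rho) f f' K ->
  lim_to (fun n => avg n (fun x => f (rc r * x) * (rc r * x) / (rc r * x - z))) (f z).
Proof.
move=> r0 r2 zr H e e0.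
have nr : nrm (rc r) = r by rewrite nrm_rc gtr0_norm.
have rc0 : rc r != 0 by rewrite -nrm_gt0 nr.
pose B := nrm (f 0) + nrm (f' 0) * rho + `|K| * rho ^+ 2.
pose M := B * r / (r - nrm z).
pose q := nrm z / r.
have B0 : 0 <= B.
  rewrite /B !addr_ge0 ?mulr_ge0 ?nrm_ge0 ?sqr_ge0 //; lra.
have q0 : 0 <= q by rewrite divr_ge0 ?nrm_ge0 // ltW.
have q1 : q < 1 by rewrite ltr_pdivrMr // mul1r.
have rz : 0 < r - nrm z by rewrite subr_gt0.
have M0 : 0 <= M by rewrite /M divr_ge0 ?mulr_ge0 // ltW.
have e1 : 0 < e / (2 * (M + 1)) by rewrite divr_gt0 //; lra.
have [N1 H1] := geom_small q0 q1 e1.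
have [|N2 H2] := @root_small (e / (4 * (`|K| * r ^+ 2 + 1))).
  rewrite divr_gt0 // mulr_gt0 //.
  by have := mulr_ge0 (normr_ge0 K) (sqr_ge0 r); lra.
exists (maxn N1 N2) => n; rewrite geq_max => /andP[n1 n2].
have [om [omn om1 ome]] := H2 n n2.
have := cauchy_avg r0 r2 zr H omn om1; set A := avg n _.
have AM : nrm A <= M.
  apply: avg_bound => x x1; rewrite nrm_div !nrmM nr x1 mulr1.
  have h1 := @c11_bound _ _ _ _ (rc r * x) H; rewrite nrmM nr x1 mulr1 in h1.
  have {}h1 := h1 ltac:(lra).
  have := nrm_dist (rc r * x) z; rewrite nrmM nr x1 mulr1 => h2.
  have r0' := ltW r0; apply: ler_pM.
  - by rewrite mulr_ge0 ?nrm_ge0.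
  - by rewrite invr_ge0 nrm_ge0.
  - by rewrite ler_wpM2r.
  - by rewrite lef_pV2 // posrE //; lra.
set u := (z / rc r) ^+ (2 ^ n).
have uq : nrm u <= e / (2 * (M + 1)).
  rewrite /u nrmX nrm_div nr; apply: H1; apply: leq_trans n1 _.
  by rewrite ltnW // ltn_expl.
have u1 : nrm u < 1.
  rewrite /u nrmX nrm_div nr expr_lt1 // expn_gt0 //.
have u2 : 1 - u != 0 by apply: nrm_neq; rewrite nrm1; lra.
set w := om - 1 in ome *.
move=> h.
have E : A - f z = u * A - (1 - u) * (f z / (1 - u) - A).
  by field.
have h1 : nrm (A - f z) <= nrm u * nrm A + nrm (1 - u) * (K * r ^+ 2 * nrm w).
  rewrite E (le_trans (nrmB _ _)) // !nrmM lerD2l ler_wpM2l ?nrm_ge0 //.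
have h2 : nrm (1 - u) <= 2 by have := nrmB 1 u; rewrite nrm1; lra.
have h3 : nrm u * nrm A <= e / 2.
  apply: le_trans (_ : e / (2 * (M + 1)) * (M + 1) <= _).
    by apply: ler_pM; rewrite ?nrm_ge0 //; lra.
  by rewrite invfM mulrA -mulrA mulVf ?mulr1 // gt_eqF //; lra.
have kr : 0 < `|K| * r ^+ 2 + 1.
  by have := mulr_ge0 (normr_ge0 K) (sqr_ge0 r); lra.
have h4 : K * r ^+ 2 * nrm w <= e / 4.
  apply: le_trans (_ : (`|K| * r ^+ 2 + 1) * (e / (4 * (`|K| * r ^+ 2 + 1))) <= _).
    have k1 : K * r ^+ 2 <= `|K| * r ^+ 2 + 1.
      by have := ler_norm K; have := sqr_ge0 r; nra.
    apply: le_trans (ler_wpM2r (nrm_ge0 _) k1) _.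
    by rewrite ler_wpM2l // ltW.
  have -> : (`|K| * r ^+ 2 + 1) * (e / (4 * (`|K| * r ^+ 2 + 1))) = e / 4.
    by field; rewrite gt_eqF.
  by [].
have := nrm_ge0 (1 - u); nra.
Qed.

End Cauchy.

(** * Cauchy estimates and regularity *)

Section Estimates.
Variable R : realType.
Local Notation C := (Cplx R).
Local Notation nrm := (@nrm R).
Local Notation disc r := (fun z : C => nrm z < r).

Lemma has_d_unique f (z l m : C) : has_d f z l -> has_d f z m -> l = m.
Proof. by move=> /has_dP[_ <-] /has_dP[_ <-]. Qed.

Lemma c11_ext D (f f' g g' : C -> C) K : (forall z, D z -> f z = g z) ->
  (forall z, D z -> f' z = g' z) -> c11 D f f' K -> c11 D g g' K.
Proof. by move=> e e' H z h Dz Dzh; rewrite -!e // -e' //; exact: H. Qed.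

Lemma c11_le D (f f' : C -> C) K L : K <= L -> c11 D f f' K -> c11 D f f' L.
Proof.
move=> KL H z h Dz Dzh; apply: le_trans (H _ _ Dz Dzh) _.
by rewrite ler_wpM2r // sqr_ge0.
Qed.

(** A derivative is determined up to [K * eta] by the values at [z] and [z + eta]; with [K] common
    to all [n], pointwise convergence of the functions makes the derivatives a Cauchy sequence. *)
Lemma c11_lim r (P dP : nat -> C -> C) F K :
  (forall n, c11 (disc r) (P n) (dP n) K) ->
  (forall z, nrm z < r -> lim_to (fun n => P n z) (F z)) ->
  exists F', (forall z, nrm z < r -> lim_to (fun n => dP n z) (F' z)) /\
    c11 (disc r) F F' K.
Proof.
move=> HP HF.
have H z : exists l, nrm z < r -> lim_to (fun n => dP n z) l.
  have [zr|] := ltP (nrm z) r; last by exists 0.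
  have [|l Hl] := @C_complete R (fun n => dP n z); last by exists l.
  move=> e e0; pose K' : R := `|K|; have K0 : 0 <= K' by exact: normr_ge0.
  have KK : K <= K' by exact: ler_norm.
  pose eta := Num.min ((r - nrm z) / 2) (e / (4 * (K' + 1))).
  have eta0 : 0 < eta.
    by rewrite lt_min !divr_gt0 ?subr_gt0 //; lra.
  have eta1 : eta <= (r - nrm z) / 2 by rewrite ge_min lexx.
  have eta2 : eta * (4 * (K' + 1)) <= e.
    by rewrite -ler_pdivlMr ?ge_min ?lexx ?orbT //; lra.
  pose h := rc eta; have nh : nrm h = eta by rewrite nrm_rc gtr0_norm.
  have zh : nrm (z + h) < r by have := nrmD z h; rewrite nh; lra.
  have tol0 : 0 < e * eta / 8 by rewrite !mulr_gt0.
  have [N1 H1] := HF _ zr _ tol0; have [N2 H2] := HF _ zh _ tol0.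
  exists (maxn N1 N2) => m n; rewrite !geq_max => /andP[m1 m2] /andP[n1 n2].
  have a1 := HP m z h zr zh; have a2 := HP n z h zr zh.
  have b1 := H1 _ m1; have b2 := H1 _ n1; have c1 := H2 _ m2; have c2 := H2 _ n2.
  rewrite nh in a1 a2.
  suff : nrm (dP m z - dP n z) * eta <= e * eta by rewrite ler_pM2r.
  rewrite -nh -nrmM.
  have -> : (dP m z - dP n z) * h =
     (P n (z + h) - P n z - dP n z * h) - (P m (z + h) - P m z - dP m z * h)
     + ((P m (z + h) - F (z + h)) - (P n (z + h) - F (z + h)) -
     ((P m z - F z) - (P n z - F z))) by ring.
  have g1 := nrmD ((P n (z + h) - P n z - dP n z * h) - (P m (z + h) - P m z - dP m z * h))
     ((P m (z + h) - F (z + h)) - (P n (z + h) - F (z + h)) -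
     ((P m z - F z) - (P n z - F z))).
  have g2 := nrmB (P n (z + h) - P n z - dP n z * h) (P m (z + h) - P m z - dP m z * h).
  have g3 := nrmB ((P m (z + h) - F (z + h)) - (P n (z + h) - F (z + h)))
     ((P m z - F z) - (P n z - F z)).
  have g4 := nrmB (P m (z + h) - F (z + h)) (P n (z + h) - F (z + h)).
  have g5 := nrmB (P m z - F z) (P n z - F z).
  have g6 : K * eta ^+ 2 <= e * eta / 4.
    apply: le_trans (ler_wpM2r (sqr_ge0 _) KK) _.
    by have := ler_wpM2r (ltW eta0) eta2; have := sqr_ge0 eta; nra.
  rewrite nh; lra.
have [F' HF'] := choice H; exists F'; split=> // z h zr zh.
have L := lim_toD (lim_toD (HF _ zh) (lim_toN (HF _ zr)))
   (lim_toN (lim_toM h (HF' _ zr))).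
rewrite [F' z * h]mulrC; apply: (lim_to_le (N := 0) L) => n _.
by rewrite [h * _]mulrC; exact: HP.
Qed.

Definition reg (D : C -> Prop) f f' (K : R) := [/\ 0 <= K, forall z, D z -> nrm (f z) <= K,
  forall z, D z -> nrm (f' z) <= K & c11 D f f' K].

Lemma regM (D : C -> Prop) f f' g g' K L d :
  (forall z h, D z -> D (z + h) -> nrm h <= d) -> 0 <= d ->
  reg D f f' K -> reg D g g' L ->
  reg D (fun z => f z * g z) (fun z => f' z * g z + f z * g' z) (K * L * (3 + d)).
Proof.
move=> Dd d0 [K0 fK f'K Hf] [L0 gL g'L Hg]; have KL0 := mulr_ge0 K0 L0.
split.
- by rewrite mulr_ge0 //; lra.
- move=> z Dz; rewrite nrmM; have := ler_pM (nrm_ge0 _) (nrm_ge0 _) (fK z Dz) (gL z Dz).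
  by have := mulr_ge0 KL0 d0; nra.
- move=> z Dz; rewrite (le_trans (nrmD _ _)) // !nrmM.
  have := ler_pM (nrm_ge0 _) (nrm_ge0 _) (fK z Dz) (g'L z Dz).
  have := ler_pM (nrm_ge0 _) (nrm_ge0 _) (f'K z Dz) (gL z Dz).
  by have := mulr_ge0 KL0 d0; nra.
- move=> z h Dz Dzh; have hd := Dd z h Dz Dzh; have h0 := nrm_ge0 h.
  have -> : f (z + h) * g (z + h) - f z * g z - (f' z * g z + f z * g' z) * h =
    f (z + h) * (g (z + h) - g z - g' z * h) + (f (z + h) - f z - f' z * h) * g z
    + (f (z + h) - f z - f' z * h + f' z * h) * (g' z * h) by ring.
  have a1 := Hf z h Dz Dzh; have a2 := Hg z h Dz Dzh.
  set u := f (z + h) - f z - f' z * h in a1 *; set v := g (z + h) - g z - g' z * h in a2 *.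
  have b1 : nrm (f (z + h) * v) <= K * (L * nrm h ^+ 2).
    by rewrite nrmM ler_pM ?nrm_ge0 // fK.
  have b2 : nrm (u * g z) <= K * nrm h ^+ 2 * L.
    by rewrite nrmM ler_pM ?nrm_ge0 // gL.
  have b3 : nrm (u + f' z * h) <= K * (1 + d) * nrm h.
    have := nrmD u (f' z * h); rewrite nrmM.
    have := ler_wpM2r h0 (f'K z Dz).
    have : nrm h ^+ 2 <= d * nrm h by rewrite expr2 ler_wpM2r.
    by move=> /(ler_wpM2l K0); lra.
  have b4 : nrm ((u + f' z * h) * (g' z * h)) <= K * (1 + d) * nrm h * (L * nrm h).
    by rewrite nrmM ler_pM ?nrm_ge0 // nrmM ler_wpM2r // g'L.
  have := nrmD (f (z + h) * v + u * g z) ((u + f' z * h) * (g' z * h)).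
  have := nrmD (f (z + h) * v) (u * g z).
  lra.
Qed.

Definition ker m (a z : C) : C := (a - z)^-1 ^+ m.

(** The constant is the same for all [a] on the circle, as averaging over the circle requires;
    induction on [m] multiplies by the kernel of exponent 1. *)
Lemma ker_reg r m : 0 < r -> exists K, forall a, nrm a = r ->
  reg (disc (r / 2)) (ker m a) (fun z => m%:R * ker m.+1 a z) K.
Proof.
move=> r0.
have az a z : nrm a = r -> nrm z < r / 2 -> r / 2 <= nrm (a - z).
  by move=> ar zr; have := nrm_dist a z; lra.
have az0 a z : nrm a = r -> nrm z < r / 2 -> a - z != 0.
  by move=> ar zr; rewrite -nrm_gt0; have := az _ _ ar zr; lra.
pose q := 2 / r; have q0 : 0 < q by rewrite divr_gt0.
have azq a z : nrm a = r -> nrm z < r / 2 -> nrm ((a - z)^-1) <= q.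
  move=> ar zr; rewrite nrmV /q -[2 / r]invrK invf_div lef_pV2 ?posrE ?az //.
    by rewrite nrm_gt0 az0.
  by rewrite divr_gt0.
have reg1 a : nrm a = r -> reg (disc (r / 2)) (ker 1 a) (ker 2 a) (q + q ^+ 2 + q ^+ 3).
  move=> ar; have q2 := exprn_gt0 2 q0; have q3 := exprn_gt0 3 q0; split.
  - lra.
  - by move=> z zr; rewrite /ker expr1; have := azq _ _ ar zr; lra.
  - move=> z zr; rewrite /ker nrmX; have := azq _ _ ar zr => h.
    by have := lerXn2r 2 (nrm_ge0 _) (ltW q0) h; lra.
  - move=> z h zr zhr; have h1 := az0 _ _ ar zr; have h2 := az0 _ _ ar zhr.
    have -> : ker 1 a (z + h) - ker 1 a z - ker 2 a z * h =
       (a - z)^-1 ^+ 2 * (a - (z + h))^-1 * h ^+ 2.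
      by rewrite /ker; field; rewrite h1 h2.
    rewrite nrmM [nrm (h ^+ 2)]nrmX ler_wpM2r ?sqr_ge0 // nrmM nrmX.
    have := ler_pM (exprn_ge0 2 (nrm_ge0 _)) (nrm_ge0 _)
       (lerXn2r 2 (nrm_ge0 _) (ltW q0) (azq _ _ ar zr)) (azq _ _ ar zhr).
    by rewrite -exprSr; lra.
elim: m => [|m [K HK]].
  exists 1 => a ar; split=> //.
  - by move=> z _; rewrite /ker expr0 nrm1.
  - by move=> z _; rewrite mul0r nrm0.
  - by move=> z h _ _; rewrite /ker !expr0 subrr !mul0r subrr nrm0 mul1r sqr_ge0.
exists ((q + q ^+ 2 + q ^+ 3) * K * (3 + r)) => a ar.
have [|| h0 h1 h2 h3] := @regM (disc (r / 2)) _ _ _ _ _ _ r _ _ (reg1 a ar) (HK a ar).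
- move=> z h zr zhr; have -> : h = (z + h) - z by ring.
  by have := nrmB (z + h) z; lra.
- exact: ltW.
have E z : nrm z < r / 2 ->
   ker 2 a z * ker m a z + ker 1 a z * (m%:R * ker m.+1 a z) = m.+1%:R * ker m.+2 a z.
  by move=> zr; rewrite /ker -[in RHS]natr1 !exprS expr0; ring.
split=> //.
- by move=> z zr; have := h1 z zr; rewrite /ker -exprD.
- by move=> z zr; rewrite -E //; exact: h2.
- by apply: c11_ext h3 => z zr; rewrite ?E // /ker -exprD.
Qed.

Lemma prim0 r (f P : C -> C) : prim r f P -> prim r f (fun z => P z - P 0).
Proof.
move=> H a b ar br; have -> : P b - P 0 - (P a - P 0) = P b - P a by ring.
exact: H.
Qed.

(* The second primitive [G] of [f] is C^{1,1}, so the discrete Cauchy formula holds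
   for it; differentiating the kernel then bounds [f = G''] and its derivatives. *)
Lemma regularity (r0 M : R) : 0 < r0 -> 0 <= M -> exists2 K, 0 <= K &
  forall f : C -> C, (forall z, nrm z < r0 -> exists l, has_d f z l) ->
    (forall z, nrm z < r0 -> nrm (f z) <= M) ->
  exists f1 f2, reg (disc (r0 / 4)) f f1 K /\ reg (disc (r0 / 4)) f1 f2 K.
Proof.
(* [cauchy_lim] requires [2 * r <= r0], and the kernels are controlled for [nrm z < r / 2]; hence
   the radius [r0 / 4]. *)
move=> r00 M0; pose r := r0 / 2; have r_gt0 : 0 < r by rewrite divr_gt0.
have rE : r0 / 4 = r / 2 by rewrite /r; field.
have nr : nrm (rc r) = r by rewrite nrm_rc gtr0_norm.
pose Mc := M * r0 ^+ 3; have Mc0 : 0 <= Mc by rewrite mulr_ge0 // exprn_ge0 // ltW.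
have [Ks HKs] := choice (fun m => @ker_reg r m r_gt0).
have Ks0 m : 0 <= Ks m by have [] := HKs m (rc r) nr.
pose Km m := m`!%:R * (Mc * Ks m.+1).
have Km0 m : 0 <= Km m by apply: mulr_ge0; [rewrite ler0n|apply: mulr_ge0].
pose K := M + Km 0%N + Km 1%N + Km 2%N + Km 3%N + Km 4%N.
have K0 := Km0 0%N; have K1 := Km0 1%N; have K2 := Km0 2%N; have K3 := Km0 3%N.
have K4 := Km0 4%N.
exists K; first by rewrite /K; lra.
move=> f df fM; have [P0 /prim0 HP0] := primitive r00 df.
pose P z := P0 z - P0 0; have HP : prim r0 f P := HP0; have P00 : P 0 = 0 by rewrite /P subrr.
have dP z : nrm z < r0 -> has_d P z (f z).
  move=> zr; apply: (prim_d HP zr); have [l] := df z zr; exact: has_d_cont.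
have PL a b : nrm a < r0 -> nrm b < r0 -> nrm (P b - P a) <= M * nrm (b - a).
  move=> ar br; have := @prim_bound _ r0 f P (fun w => nrm (w - 0) < r0) 0 M a b HP ar br
    (@mclosed_oball _ 0 r0).
  rewrite !subr0 mul0r subr0; apply=> // w; rewrite !subr0; exact: fM.
have [G0 /prim0 HG0] := primitive r00 (fun z zr => ex_intro _ _ (dP z zr)).
pose G z := G0 z - G0 0; have HG : prim r0 P G := HG0; have G00 : G 0 = 0 by rewrite /G subrr.
have GC : c11 (disc r0) G P M.
  move=> z h zr zhr.
  have := @prim_bound _ r0 P G (fun w => nrm (w - z) <= nrm h /\ nrm (w - 0) < r0)
    (P z) (M * nrm h) z (z + h) HG zr zhr
    (mclosedI (@mclosed_ball _ z (nrm h)) (@mclosed_oball _ 0 r0)).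
  rewrite subrr nrm0 !subr0 [z + h - z]addrC addKr => H.
  rewrite expr2 mulrA; apply: H; [by rewrite nrm_ge0|by []|].
  move=> w [wh]; rewrite subr0 => wr; apply: le_trans (PL _ _ zr wr) _.
  by rewrite ler_wpM2l.
have PB z : nrm z < r0 -> nrm (P z) <= M * r0.
  move=> zr; have := PL 0 z; rewrite nrm0 P00 !subr0 => /(_ r00 zr) /le_trans; apply.
  by rewrite ler_wpM2l // ltW.
have GB z : nrm z < r0 -> nrm (G z) <= M * r0 ^+ 2.
  move=> zr; have := GC 0 z; rewrite nrm0 add0r G00 P00 mul0r !subr0 => /(_ r00 zr).
  move=> /le_trans; apply; rewrite ler_wpM2l // lerXn2r ?nnegrE ?nrm_ge0 // ltW //.
pose c x := G (rc r * x) * (rc r * x).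
have cB x : nrm x = 1 -> nrm (c x) <= Mc.
  move=> x1; have rx : nrm (rc r * x) = r by rewrite nrmM nr x1 mulr1.
  rewrite /c nrmM rx /Mc exprSr mulrA ler_pM ?nrm_ge0 ?(ltW r_gt0) ?GB ?rx //; rewrite /r; lra.
(* The discrete Cauchy integral for the [m]-th derivative of [G]. *)
pose W m n z := m`!%:R * avg n (fun x => c x * ker m.+1 (rc r * x) z).
have WC m n : c11 (disc (r / 2)) (W m n) (W m.+1 n) (Km m).
  move=> z h zr zhr.
  have -> : W m n (z + h) - W m n z - W m.+1 n z * h =
     m`!%:R * avg n (fun x => c x * (ker m.+1 (rc r * x) (z + h) - ker m.+1 (rc r * x) z
         - m.+1%:R * ker m.+2 (rc r * x) z * h)).
    rewrite /W factS natrM [m.+1%:R * _]mulrC -![m`!%:R * _ * _]mulrA -!mulrBr; congr (_ * _).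
    rewrite [m.+1%:R * _]mulrC -mulrA mulrC -avgZ -!avgB; apply: avg_ext => x _; ring.
  rewrite nrmM nrm_nat /Km -mulrA ler_wpM2l ?ler0n //; apply: avg_bound => x x1.
  have rx : nrm (rc r * x) = r by rewrite nrmM nr x1 mulr1.
  have [_ _ _ H] := HKs m.+1 _ rx.
  rewrite nrmM -[leRHS]mulrA; apply: ler_pM; rewrite ?nrm_ge0 ?cB //; exact: (H z h zr zhr).
have WB m n z : nrm z < r / 2 -> nrm (W m n z) <= Km m.
  move=> zr; rewrite nrmM nrm_nat ler_wpM2l ?ler0n //; apply: avg_bound => x x1.
  have rx : nrm (rc r * x) = r by rewrite nrmM nr x1 mulr1.
  have [_ H _ _] := HKs m.+1 _ rx.
  rewrite nrmM; apply: ler_pM; rewrite ?nrm_ge0 ?cB //; exact: H.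
have W0 z : nrm z < r / 2 -> lim_to (fun n => W 0%N n z) (G z).
  move=> zr; have := @cauchy_lim _ r0 r G P M z r_gt0 _ _ GC.
  have -> : 2 * r <= r0 by rewrite /r; lra.
  move=> /(_ isT ltac:(lra)) H e /H[N HN]; exists N => n /HN.
  congr (_ <= _); congr nrm; congr (_ - _).
  by rewrite /W fact0 mul1r; apply: avg_ext => x _; rewrite /ker expr1.
(* The limits of [W 0] to [W 4] are [G], [G1 = P], [G2 = f] and the first two derivatives of [f]. *)
have [G1 [W1 C1]] := c11_lim (WC 0%N) W0.
have [G2 [W2 C2]] := c11_lim (WC 1%N) W1.
have [G3 [W3 C3]] := c11_lim (WC 2%N) W2.
have [G4 [W4 C4]] := c11_lim (WC 3%N) W3.
have sub z : nrm z < r / 2 -> nrm z < r0 by rewrite /r; lra.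
have E1 z : nrm z < r / 2 -> G1 z = P z.
  move=> zr; apply: has_d_unique (c11_d C1 zr) (c11_d GC (sub _ zr)).
have E2 z : nrm z < r / 2 -> G2 z = f z.
  move=> zr; apply: has_d_unique (c11_d _ zr) (dP _ (sub _ zr)).
  by apply: c11_ext C2 => // w wr; rewrite E1.
have B m g : (forall z, nrm z < r / 2 -> lim_to (fun n => W m n z) (g z)) ->
    forall z, nrm z < r / 2 -> nrm (g z) <= Km m.
  by move=> H z zr; apply: (lim_to_le (N := 0) (H z zr)) => n _; exact: WB.
have B3 := B _ _ W3; have B4 := B _ _ W4.
exists G3, G4; rewrite rE; split; split.
- rewrite /K; lra.
- by move=> z /sub zr; have := fM z zr; rewrite /K; lra.
- by move=> z zr; have := B3 z zr; rewrite /K; lra.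
- by apply: c11_le (c11_ext E2 _ C3) => //; rewrite /K; lra.
- rewrite /K; lra.
- by move=> z zr; have := B3 z zr; rewrite /K; lra.
- by move=> z zr; have := B4 z zr; rewrite /K; lra.
- by apply: c11_le C4; rewrite /K; lra.
Qed.

End Estimates.

(** * Holomorphic germs in two variables *)

Section GermCalculus.
Variable R : realType.
Local Notation C := (Cplx R).
Local Notation nrm := (@nrm R).
Implicit Types V W U : normedModType C.

Lemma differentiable_near V W (f g : V -> W) (z : V) :
  (\forall w \near z, f w = g w) -> differentiable f z ->
  differentiable g z /\ 'd g z = 'd f z :> (V -> W).
Proof.
move=> fg df; have [k k0 Hk] := linear_lipschitz (diff_continuous df).
have [K K0 KE] := gt0_rc k0; rewrite KE in Hk.
apply: (is_diff_near Hk) => e e0; have H := near_is_diff df e0.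
have fgz := nbhs_singleton fg.
have S : \forall h \near (0 : V), f (h + z) = g (h + z).
  by move: fg; rewrite (near_shift 0) /= subr0; apply: filterS => h.
by apply: filterS2 H S => h + E; rewrite E fgz.
Qed.

Lemma holo_eq V W (f g : V -> W) : (\forall w \near (0 : V), f w = g w) ->
  holomorphic0 f -> holomorphic0 g.
Proof.
move=> /nbhs_interior; apply: filterS2 => z fg df.
exact: (proj1 (differentiable_near fg df)).
Qed.

Lemma holo_cst V W (a : W) : holomorphic0 (fun _ : V => a).
Proof. by apply: filterE => z; exact: differentiable_cst. Qed.

Lemma holo_id V : holomorphic0 (fun z : V => z).
Proof. by apply: filterE => z; exact: ex_diff. Qed.

Lemma holoD V W (f g : V -> W) : holomorphic0 f -> holomorphic0 g ->
  holomorphic0 (fun z => f z + g z).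
Proof. by apply: filterS2 => z; exact: differentiableD. Qed.

Lemma holoN V W (f : V -> W) : holomorphic0 f -> holomorphic0 (fun z => - f z).
Proof. by apply: filterS => z; exact: differentiableN. Qed.

Lemma holoB V W (f g : V -> W) : holomorphic0 f -> holomorphic0 g ->
  holomorphic0 (fun z => f z - g z).
Proof. by move=> hf hg; apply: holoD => //; exact: holoN. Qed.

Lemma holoM V (f g : V -> C) : holomorphic0 f -> holomorphic0 g ->
  holomorphic0 (fun z => f z * g z).
Proof. by apply: filterS2 => z; exact: differentiableM. Qed.

Lemma holoX V (f : V -> C) n : holomorphic0 f -> holomorphic0 (fun z => f z ^+ n).
Proof.
move=> hf; elim: n => [|n IH]; first exact: holo_cst.
by apply: holo_eq (holoM hf IH); apply: filterE => z; rewrite exprS.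
Qed.

Lemma holo_sum V (I : Type) (r : seq I) (f : I -> V -> C) :
  (forall i, holomorphic0 (f i)) -> holomorphic0 (fun z => \sum_(i <- r) f i z).
Proof.
move=> hf; elim: r => [|i r IH].
  by apply: holo_eq (holo_cst V (0 : C)); apply: filterE => z; rewrite big_nil.
by apply: holo_eq (holoD (hf i) IH); apply: filterE => z; rewrite big_cons.
Qed.

Lemma holo_prod V (I : Type) (r : seq I) (f : I -> V -> C) :
  (forall i, holomorphic0 (f i)) -> holomorphic0 (fun z => \prod_(i <- r) f i z).
Proof.
move=> hf; elim: r => [|i r IH].
  by apply: holo_eq (holo_cst V (1 : C)); apply: filterE => z; rewrite big_nil.
by apply: holo_eq (holoM (hf i) IH); apply: filterE => z; rewrite big_cons.
Qed.

Lemma holo_pair V W U (f : V -> W) (g : V -> U) : holomorphic0 f -> holomorphic0 g ->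
  holomorphic0 (fun z => (f z, g z)).
Proof. by apply: filterS2 => z; exact: differentiable_pair. Qed.

Lemma holo_cont V W (f : V -> W) : holomorphic0 f -> {for 0, continuous f}.
Proof. by move/nbhs_singleton; exact: differentiable_continuous. Qed.

Lemma near_comp V W (g : V -> W) (P : W -> Prop) : holomorphic0 g -> g 0 = 0 ->
  (\forall w \near (0 : W), P w) -> \forall v \near (0 : V), P (g v).
Proof. by move=> /holo_cont + g0 HP => /(_ P); rewrite /nbhs /= g0; apply. Qed.

Lemma holo_comp V W U (f : W -> U) (g : V -> W) : holomorphic0 f -> holomorphic0 g ->
  g 0 = 0 -> holomorphic0 (fun z => f (g z)).
Proof.
move=> hf hg g0; have := near_comp hg g0 hf.
by apply: filterS2 hg => z dg df; exact: differentiable_comp.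
Qed.

Lemma has_d2_fst (p : C * C) : has_d2 (fun q : C * C => q.1) p (1, 0).
Proof.
move=> e e0; exists 1 => // h k _ _ /=.
have -> : p.1 + h - p.1 - 1 * h - 0 * k = 0 by ring.
by rewrite nrm0 mulr_ge0 ?(ltW e0) // le_max nrm_ge0.
Qed.

Lemma has_d2_snd (p : C * C) : has_d2 (fun q : C * C => q.2) p (0, 1).
Proof.
move=> e e0; exists 1 => // h k _ _ /=.
have -> : p.2 + k - p.2 - 0 * h - 1 * k = 0 by ring.
by rewrite nrm0 mulr_ge0 ?(ltW e0) // le_max nrm_ge0.
Qed.

Lemma holo_fst : holomorphic0 (fun q : C * C => q.1).
Proof. by apply: filterE => z; have /has_d2P[] := has_d2_fst z. Qed.

Lemma holo_snd : holomorphic0 (fun q : C * C => q.2).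
Proof. by apply: filterE => z; have /has_d2P[] := has_d2_snd z. Qed.

Lemma has_d2_dd (F : C * C -> C) p : differentiable F p -> has_d2 F p (dx F p, dy F p).
Proof. by move=> dF; apply/has_d2P. Qed.

Lemma has_d2_unique (F : C * C -> C) p a : has_d2 F p a -> dx F p = a.1 /\ dy F p = a.2.
Proof. by move=> /has_d2P[]. Qed.

Lemma has_d2_y (F : C * C -> C) x y a : has_d2 F (x, y) a ->
  has_d (fun t => F (x, t)) y a.2.
Proof.
case: a => a b H e /H[d d0 Hd]; exists d => // k kd.
have := Hd 0 k; rewrite nrm0 max_r ?nrm_ge0 // => /(_ d0 kd) /=.
by rewrite addr0 mulr0 subr0.
Qed.

Lemma has_d2_x (F : C * C -> C) x y a : has_d2 F (x, y) a ->
  has_d (fun t => F (t, y)) x a.1.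
Proof.
case: a => a b H e /H[d d0 Hd]; exists d => // k kd.
have := Hd k 0; rewrite nrm0 max_l ?nrm_ge0 // => /(_ kd d0) /=.
by rewrite addr0 mulr0 subr0.
Qed.

Lemma slice_y (F : C * C -> C) x y : differentiable F (x, y) ->
  has_d (fun t => F (x, t)) y (dy F (x, y)).
Proof. by move=> /has_d2_dd /has_d2_y. Qed.

Lemma slice_x (F : C * C -> C) x y : differentiable F (x, y) ->
  has_d (fun t => F (t, y)) x (dx F (x, y)).
Proof. by move=> /has_d2_dd /has_d2_x. Qed.

Lemma has_d2_bound (F : C * C -> C) p : differentiable F p ->
  exists2 d, 0 < d & forall h k, nrm h < d -> nrm k < d ->
    nrm (F (p.1 + h, p.2 + k) - F p) <= 1.
Proof.
move=> /has_d2_dd H; have [d d0 Hd] := H 1 ltr01.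
move: (dx F p, dy F p) Hd => a Hd; have a1 := nrm_ge0 a.1; have a2 := nrm_ge0 a.2.
pose t := 1 / (1 + nrm a.1 + nrm a.2).
have t0 : 0 < t by rewrite divr_gt0 //; lra.
have tE : t * (1 + nrm a.1 + nrm a.2) = 1 by rewrite divfK // gt_eqF //; lra.
exists (Num.min d t); first by rewrite lt_min d0.
move=> h k; rewrite !lt_min => /andP[hd ht] /andP[kd kt].
have := Hd h k hd kd; rewrite mul1r.
set u := F _ - _ => H1; have -> : u = (u - a.1 * h - a.2 * k) + (a.1 * h + a.2 * k) by ring.
have := nrmD (u - a.1 * h - a.2 * k) (a.1 * h + a.2 * k); have := nrmD (a.1 * h) (a.2 * k).
rewrite !nrmM; have : Num.max (nrm h) (nrm k) < t by rewrite gt_max ht.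
have := ler_wpM2l a1 (ltW ht); have := ler_wpM2l a2 (ltW kt); lra.
Qed.

Lemma polydisc (F : C * C -> C) : holomorphic0 F ->
  exists rho M, [/\ 0 < rho, 0 <= M & forall x y, nrm x < rho -> nrm y < rho ->
    differentiable F (x, y) /\ nrm (F (x, y)) <= M].
Proof.
move=> hF; have [d d0 Hd] := has_d2_bound (nbhs_singleton hF).
have /near0CC[d' d'0 Hd'] := hF.
exists (Num.min d d'), (nrm (F 0) + 1); split.
- by rewrite lt_min d0.
- by rewrite addr_ge0 ?nrm_ge0.
move=> x y; rewrite !lt_min => /andP[xd xd'] /andP[yd yd']; split.
  by apply: Hd'; rewrite subr0.
have := Hd x y xd yd; rewrite /= !add0r => h.
by have := nrmD (F (x, y) - F 0) (F 0); rewrite subrK; lra.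
Qed.

Local Notation disc r := (fun z : C => nrm z < r).

(** Joint differentiability only lacks control of [Fx (x, y + k) - Fx (x, y)]. This is read off
    difference quotients in [x] with a small step [t]: they determine [Fx] up to order [t], and
    [nrm k < t * t] makes the change in [y] negligible against [t]. *)
Lemma osgood (F Fx Fy : C * C -> C) d K : 0 <= K ->
  (forall y, nrm y < d -> c11 (disc d) (fun x => F (x, y)) (fun x => Fx (x, y)) K) ->
  (forall x, nrm x < d -> c11 (disc d) (fun y => F (x, y)) (fun y => Fy (x, y)) K) ->
  (forall x y, nrm x < d -> nrm y < d -> nrm (Fy (x, y)) <= K) ->
  forall x y, nrm x < d -> nrm y < d -> has_d2 F (x, y) (Fx (x, y), Fy (x, y)).
Proof.
move=> K0 HX HY HB x y xd yd e e0 /=.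
pose t := Num.min ((d - nrm x) / 2) (e / (8 * (K + 1))).
have t0 : 0 < t by rewrite lt_min !divr_gt0 ?subr_gt0 //; lra.
have t1 : t <= (d - nrm x) / 2 by rewrite ge_min lexx.
have t2 : t * (8 * (K + 1)) <= e.
  by rewrite -ler_pdivlMr ?ge_min ?lexx ?orbT //; lra.
clearbody t; have nt : nrm (rc t) = t by rewrite nrm_rc gtr0_norm.
have xt : nrm (x + rc t) < d by have := nrmD x (rc t); rewrite nt; lra.
pose del := Num.min (Num.min (d - nrm x) (d - nrm y)) (Num.min (Num.min 1 t) (t * t)).
exists del.
  by rewrite !lt_min !subr_gt0 xd yd ltr01 t0 mulr_gt0.
move=> h k; rewrite !lt_min => /andP[/andP[h1 h2] /andP[/andP[h3 h5] h4]] /andP[/andP[k1 k2] /andP[/andP[k3 k5] k4]].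
have h0 := nrm_ge0 h; have k0 := nrm_ge0 k.
have xh : nrm (x + h) < d by have := nrmD x h; lra.
have yk : nrm (y + k) < d by have := nrmD y k; lra.
have A1 := HX (y + k) yk x h xd xh; have A2 := HY x xd y k yd yk.
have B1 := HX (y + k) yk x (rc t) xd xt; have B2 := HX y yd x (rc t) xd xt.
have B3 := HY (x + rc t) xt y k yd yk.
rewrite nt in B1 B2.
have L3 : nrm (F (x + rc t, y + k) - F (x + rc t, y)) <= 2 * K * nrm k.
  have := nrmD (F (x + rc t, y + k) - F (x + rc t, y) - Fy (x + rc t, y) * k)
    (Fy (x + rc t, y) * k); rewrite subrK nrmM.
  have := ler_wpM2r k0 (HB _ _ xt yd).
  have : K * nrm k ^+ 2 <= K * nrm k by rewrite ler_wpM2l // expr2 ler_piMl // ltW.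
  lra.
have L2 : nrm (F (x, y + k) - F (x, y)) <= 2 * K * nrm k.
  have := nrmD (F (x, y + k) - F (x, y) - Fy (x, y) * k)
    (Fy (x, y) * k); rewrite subrK nrmM.
  have := ler_wpM2r k0 (HB _ _ xd yd).
  have : K * nrm k ^+ 2 <= K * nrm k by rewrite ler_wpM2l // expr2 ler_piMl // ltW.
  lra.
have D : nrm (Fx (x, y + k) - Fx (x, y)) * t <= (2 * K * t + 4 * K * t) * t.
  rewrite -{1}nt -nrmM.
  have -> : (Fx (x, y + k) - Fx (x, y)) * rc t =
    (F (x + rc t, y) - F (x, y) - Fx (x, y) * rc t)
     - (F (x + rc t, y + k) - F (x, y + k) - Fx (x, y + k) * rc t)
    + ((F (x + rc t, y + k) - F (x + rc t, y)) - (F (x, y + k) - F (x, y))) by ring.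
  set a := _ - Fx (x, y) * _ in B2 *; set b := _ - Fx (x, y + k) * _ in B1 *.
  have := nrmD (a - b) ((F (x + rc t, y + k) - F (x + rc t, y)) - (F (x, y + k) - F (x, y))).
  have := nrmB a b.
  have := nrmB (F (x + rc t, y + k) - F (x + rc t, y)) (F (x, y + k) - F (x, y)).
  have := ler_wpM2l K0 (ltW k4); lra.
have {}D : nrm (Fx (x, y + k) - Fx (x, y)) <= 3 / 4 * e.
  have : nrm (Fx (x, y + k) - Fx (x, y)) <= 6 * (K * t).
    by rewrite -(ler_pM2r t0); lra.
  lra.
set m := Num.max _ _; have hm : nrm h <= m by rewrite le_max lexx.
have km : nrm k <= m by rewrite le_max lexx orbT.
have -> : F (x + h, y + k) - F (x, y) - Fx (x, y) * h - Fy (x, y) * k =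
   (F (x + h, y + k) - F (x, y + k) - Fx (x, y + k) * h)
   + (F (x, y + k) - F (x, y) - Fy (x, y) * k) + (Fx (x, y + k) - Fx (x, y)) * h by ring.
set a := _ - Fx (x, y + k) * _ in A1 *; set b := _ - Fy _ * _ in A2 *.
have := nrmD (a + b) ((Fx (x, y + k) - Fx (x, y)) * h); rewrite nrmM.
have := nrmD a b; have := ler_pM (nrm_ge0 _) h0 D hm.
have Kt : K * t <= e / 8 by lra.
have sqb u : 0 <= u -> u < t -> u <= m -> K * u ^+ 2 <= e / 8 * m.
  move=> u0 ut um; rewrite expr2 mulrA; apply: ler_pM => //; first by rewrite mulr_ge0.
  by apply: le_trans Kt; rewrite ler_wpM2l // ltW.
have := sqb _ h0 h5 hm; have := sqb _ k0 k5 km.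
lra.
Qed.

(* [dy F] is differentiable in [y] by [regularity], and in [x] as a locally bounded
   limit of difference quotients; [osgood] makes this joint. *)
Lemma partial_reg (rho M : R) : 0 < rho -> 0 <= M -> exists2 K, 0 <= K &
  forall F : C * C -> C, (forall x y, nrm x < rho -> nrm y < rho ->
     differentiable F (x, y) /\ nrm (F (x, y)) <= M) ->
  (forall x, nrm x < rho -> exists Fyy,
      reg (disc (rho / 4)) (fun y => F (x, y)) (fun y => dy F (x, y)) K /\
      reg (disc (rho / 4)) (fun y => dy F (x, y)) Fyy K) /\
  (forall x y, nrm x < rho / 4 -> nrm y < rho / 4 -> differentiable (dy F) (x, y)).
Proof.
move=> rho0 M0; have [K K0 HK] := regularity rho0 M0.
have M1 : 0 <= K * (1 + rho) by rewrite mulr_ge0 //; lra.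
have [L L0 HL] := regularity rho0 M1.
exists K => // F HF.
have P1 x : nrm x < rho -> exists Fyy,
      reg (disc (rho / 4)) (fun y => F (x, y)) (fun y => dy F (x, y)) K /\
      reg (disc (rho / 4)) (fun y => dy F (x, y)) Fyy K.
  move=> xr; have [y yr|y yr|f1 [f2 [r1 r2]]] := HK (fun y => F (x, y)).
  - by exists (dy F (x, y)); apply: slice_y; have [] := HF x y xr yr.
  - by have [] := HF x y xr yr.
  have E y : nrm y < rho / 4 -> f1 y = dy F (x, y).
    move=> yr; have [_ _ _ c1] := r1; apply: has_d_unique (c11_d c1 yr) _.
    by apply: slice_y; have [] := HF x y xr ltac:(lra).
  case: r1 => a1 a2 a3 a4; case: r2 => b1 b2 b3 b4; exists f2; split; split => //.
  - by move=> z zr; rewrite -E // a3.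
  - exact: c11_ext a4.
  - by move=> z zr; rewrite -E // b2.
  - exact: c11_ext b4.
split=> // x0 y0 x0r y0r; set d := rho / 4.
have Q1 y : nrm y < d -> exists Fyx, (forall x, nrm x < d -> nrm (Fyx x) <= L) /\
    c11 (disc d) (fun x => dy F (x, y)) Fyx L.
  move=> yd; pose t := (d - nrm y) / 2; have t0 : 0 < t by rewrite divr_gt0 ?subr_gt0.
  pose s n : C := rc (t / n.+1%:R).
  have ns n : nrm (s n) = t / n.+1%:R by rewrite nrm_rc gtr0_norm // divr_gt0 // ltr0n.
  have s0 n : s n != 0 by rewrite -nrm_gt0 ns divr_gt0 // ltr0n.
  have st n : nrm (s n) <= t.
    by rewrite ns ler_pdivrMr ?ltr0n // ler_peMr ?ler1n // ltW.
  have td : t < d by rewrite /t; have := nrm_ge0 y; rewrite /d; lra.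
  have ys n : nrm (y + s n) < d.
    by have := nrmD y (s n); have := st n; rewrite /t in t0 td *; lra.
  have dr : d < rho by rewrite /d; lra.
  pose P n x := (F (x, y + s n) - F (x, y)) / s n.
  have Pb n x : nrm x < rho -> nrm (P n x - dy F (x, y)) <= K * nrm (s n).
    move=> xr; have [Fyy [[_ _ _ H] _]] := P1 x xr; have := H y (s n) yd (ys n).
    have -> : P n x - dy F (x, y) = (F (x, y + s n) - F (x, y) - dy F (x, y) * s n) / s n.
      rewrite /P; move: (dy F (x, y)) (F (x, y + s n)) (F (x, y)) (s n) (s0 n) => u v w a a0.
      by field.
    by rewrite nrm_div ler_pdivrMr ?nrm_gt0 // expr2 mulrA.
  have PB n x : nrm x < rho -> nrm (P n x) <= K * (1 + rho).
    move=> xr; have [Fyy [[_ _ H _] _]] := P1 x xr; have := H y yd; have := Pb n x xr.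
    have := nrmD (P n x - dy F (x, y)) (dy F (x, y)); rewrite subrK.
    have : nrm (s n) <= rho by have := st n; lra.
    by move=> /(ler_wpM2l K0); lra.
  have Pd n x : nrm x < rho -> exists l, has_d (P n) x l.
    move=> xr; have yr : nrm y < rho by lra.
    have ysr : nrm (y + s n) < rho by have := ys n; lra.
    have := has_dZ (s n)^-1 (has_dD (slice_x (proj1 (HF x (y + s n) xr ysr)))
      (has_dZ (-1) (slice_x (proj1 (HF x y xr yr))))).
    set l := _ * _ => H; exists l => e /H[d' d'0 Hd']; exists d' => // h /Hd'.
    by rewrite !mulN1r /P ![_ / s n]mulrC.
  have [dP HdP] := choice (fun n => HL (P n) (Pd n) (PB n)).
  have HdP1 n : c11 (disc d) (P n) (dP n) L by have [f2 [[]]] := HdP n.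
  have HdP2 n z : nrm z < d -> nrm (dP n z) <= L.
    by have [f2 [[_ _ H _] _]] := HdP n; exact: H.
  have [x xd|Fyx [H1 H2]] := c11_lim HdP1 (F := fun x => dy F (x, y)).
    move=> e e0; pose N := Num.bound (K * t / e); exists N => n Nn.
    apply: le_trans (Pb _ _ (lt_trans xd dr)) _.
    rewrite ns mulrA ler_pdivrMr ?ltr0n // [e * _]mulrC -ler_pdivrMr // ltW //.
    have kt : 0 <= K * t / e.
      by apply: divr_ge0; [apply: mulr_ge0 => //; exact: ltW|exact: ltW].
    apply: lt_le_trans (archi_boundP kt) _.
    by rewrite ler_nat (leq_trans Nn).
  exists Fyx; split=> // x xd; apply: (lim_to_le (N := 0) (H1 x xd)) => n _.
  exact: HdP2.
have Q1' y : exists Fyx, nrm y < d -> (forall x, nrm x < d -> nrm (Fyx x) <= L) /\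
    c11 (disc d) (fun x => dy F (x, y)) Fyx L.
  have [/Q1[f H]|] := ltP (nrm y) d; last by exists (fun=> 0).
  by exists f.
have [Fyx HFyx] := choice Q1'.
have Q2 x : exists Fyy, nrm x < d -> (forall y, nrm y < d -> nrm (Fyy y) <= K) /\
    c11 (disc d) (fun y => dy F (x, y)) Fyy K.
  have [xr|] := ltP (nrm x) rho; last by exists (fun=> 0); rewrite /d; lra.
  by have [Fyy [_ []]] := P1 x xr; exists Fyy.
have [Fyy HFyy] := choice Q2.
suff : has_d2 (dy F) (x0, y0) (Fyx y0 x0, Fyy x0 y0) by move=> /has_d2P[].
have KL : 0 <= Num.max K L by rewrite le_max K0.
apply: (@osgood (dy F) (fun p => Fyx p.2 p.1) (fun p => Fyy p.1 p.2) d _ KL) => //.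
- move=> y yd; apply: c11_le (proj2 (HFyx y yd)); by rewrite le_max lexx orbT.
- move=> x xd; apply: c11_le (proj2 (HFyy x xd)); by rewrite le_max lexx.
- move=> x y xd yd; apply: le_trans (proj1 (HFyy x xd) y yd) _; by rewrite le_max lexx.
Qed.

Definition swapc (p : C * C) : C * C := (p.2, p.1).

Lemma swapcK p : swapc (swapc p) = p. Proof. by case: p. Qed.

Lemma holo_swapc : holomorphic0 swapc.
Proof. by apply: holo_pair; [exact: holo_snd|exact: holo_fst]. Qed.

Lemma holo_swap (F : C * C -> C) : holomorphic0 F -> holomorphic0 (fun p => F (swapc p)).
Proof. by move=> hF; apply: (holo_comp hF holo_swapc). Qed.

Lemma has_d2_swap (F : C * C -> C) x y a b : has_d2 F (x, y) (a, b) ->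
  has_d2 (fun p => F (swapc p)) (y, x) (b, a).
Proof.
move=> H e /H[d d0 Hd]; exists d => // h k hd kd.
have := Hd k h kd hd; rewrite /swapc /= maxC.
by rewrite -[in X in X -> _]addrA [- (a * k) - _]addrC addrA.
Qed.

Lemma d_swap (F : C * C -> C) p : differentiable F (swapc p) ->
  dx (fun q => F (swapc q)) p = dy F (swapc p) /\
  dy (fun q => F (swapc q)) p = dx F (swapc p).
Proof. by case: p => x y /has_d2_dd /has_d2_swap /has_d2_unique. Qed.

Lemma holo_dy (F : C * C -> C) : holomorphic0 F -> holomorphic0 (dy F).
Proof.
move=> /polydisc[rho [M [rho0 M0 HF]]]; have [K _ HK] := partial_reg rho0 M0.
apply/near0CC; exists (rho / 4); first by rewrite divr_gt0.
by move=> x y; rewrite !subr0; have [_] := HK F HF; apply.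
Qed.

Lemma holo_dx (F : C * C -> C) : holomorphic0 F -> holomorphic0 (dx F).
Proof.
move=> hF; have hd := near_comp holo_swapc (erefl : swapc 0 = 0) hF.
apply: holo_eq (holo_swap (holo_dy (holo_swap hF))).
have := near_comp holo_swapc (erefl : swapc 0 = 0) hd.
apply: filterS => p dp; have [_ ->] := d_swap dp; by rewrite swapcK.
Qed.

End GermCalculus.

(** * Hadamard division and the order of a germ *)

Section LocalTheory.
Variable R : realType.
Local Notation C := (Cplx R).
Local Notation nrm := (@nrm R).
Local Notation disc r := (fun z : C => nrm z < r).

Lemma has_d_sqr z : has_d (fun w : C => w ^+ 2) z (2 * z).
Proof.
move=> e e0; exists e => // h hd.
have -> : (z + h) ^+ 2 - z ^+ 2 - 2 * z * h = h * h by ring.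
by rewrite nrmM ler_wpM2r ?nrm_ge0 // ltW.
Qed.

Lemma has_d_id (z : C) : has_d (fun w => w) z 1.
Proof.
move=> e e0; exists 1 => // h hd.
have -> : z + h - z - 1 * h = 0 by ring.
by rewrite nrm0 mulr_ge0 ?nrm_ge0 // ltW.
Qed.

Lemma taylor2 r (f f' f'' : C -> C) K k : 0 <= K -> nrm k < r ->
  (forall z, nrm z < r -> has_d f z (f' z)) -> c11 (disc r) f' f'' K ->
  nrm (f k - f 0 - f' 0 * k - f'' 0 / 2 * k ^+ 2) <= K * nrm k ^+ 2 * nrm k.
Proof.
move=> K0 kr df Hc.
pose phi w := f w + (- f' 0 * w + (- (f'' 0 / 2)) * w ^+ 2).
have := @mvt R (fun w => nrm (w - 0) <= nrm k) phi (K * nrm k ^+ 2)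
  (@mclosed_ball _ 0 (nrm k)) (@sclosed_ball _ 0 (nrm k)) _ 0 k.
rewrite !subr0 nrm0 nrm_ge0 lexx => H.
have -> : f k - f 0 - f' 0 * k - f'' 0 / 2 * k ^+ 2 = phi k - phi 0.
  by rewrite /phi; ring.
apply: H => // w; rewrite subr0 => wk; have wr := le_lt_trans wk kr.
exists (f' w - f' 0 - f'' 0 * w).
  have := has_dD (df w wr) (has_dD (has_dZ (- f' 0) (has_d_id w))
     (has_dZ (- (f'' 0 / 2)) (has_d_sqr w))).
  by congr has_d; field.
have := Hc 0 w; rewrite nrm0 add0r => /(_ (le_lt_trans (nrm_ge0 _) kr) wr).
move=> /le_trans; apply; rewrite ler_wpM2l // lerXn2r // ?nnegrE ?nrm_ge0 //.
Qed.

Lemma nbhs_cont (F : C * C -> C) (p : C * C) : differentiable F p ->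
  forall e, 0 < e -> exists2 d, 0 < d & forall x y, nrm (x - p.1) < d ->
    nrm (y - p.2) < d -> nrm (F (x, y) - F p) <= e.
Proof.
move=> dF e e0.
have : {for p, continuous F} by exact: differentiable_continuous.
have B : \forall w \near F p, nrm (w - F p) <= e.
  by apply/near0C; exists e => // z; exact: ltW.
by move=> /(_ _ B) /near0CC.
Qed.

(** The quotient is the difference quotient in [y], completed by [dy F] on the axis.
    Differentiability is delicate only on the axis: there [G (x, k)] equals
    [dy F (x, 0) + dy (dy F) (x, 0) / 2 * k] up to a quadratic error uniform in [x]. *)
Lemma hadamard (F : C * C -> C) : holomorphic0 F ->
  exists G : C * C -> C, [/\ holomorphic0 G, forall x y, F (x, y) = F (x, 0) + y * G (x, y)
    & forall x, G (x, 0) = dy F (x, 0)].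
Proof.
move=> hF; have [rho [M [rho0 M0 HF]]] := polydisc hF.
have [K K0 HK] := partial_reg rho0 M0; have [H1 H2] := HK F HF.
have hFyy := holo_dy (holo_dy hF).
have /near0CC[d1 d10 Hd1] := hFyy.
pose d := Num.min d1 (rho / 4).
have d0 : 0 < d by rewrite lt_min d10 divr_gt0.
have dd1 : d <= d1 by rewrite ge_min lexx.
have dr : d <= rho / 4 by rewrite ge_min lexx orbT.
clearbody d.
pose Fy := dy F; pose Fyy := dy Fy.
have dF x y : nrm x < d -> nrm y < d -> differentiable F (x, y).
  by move=> xd yd; have [] := HF x y ltac:(lra) ltac:(lra).
have dFy x y : nrm x < d -> nrm y < d -> differentiable Fy (x, y).
  by move=> xd yd; apply: H2; lra.
have dFyy x y : nrm x < d -> nrm y < d -> differentiable Fyy (x, y).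
  by move=> xd yd; apply: Hd1; rewrite subr0; lra.
have cFy x : nrm x < d -> c11 (disc d) (fun y => Fy (x, y)) (fun y => Fyy (x, y)) K.
  move=> xd; have [g [_ [_ _ _ H]]] := H1 x ltac:(lra).
  move=> z h zd zhd.
  rewrite (_ : Fyy (x, z) = g z); first by apply: H; apply: lt_le_trans dr.
  apply: (has_d_unique _ (c11_d H (lt_le_trans zd dr))).
  by apply: slice_y; exact: dFy.
have sF x y : nrm x < d -> nrm y < d -> has_d (fun t => F (x, t)) y (Fy (x, y)).
  by move=> xd yd; apply: slice_y; exact: dF.
rewrite -/Fy; clearbody Fyy; clearbody Fy.
pose G p := if p.2 == 0 then Fy (p.1, 0) else (F p - F (p.1, 0)) / p.2.
exists G; split; last by move=> x; rewrite /G /= eqxx.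
  apply/near0CC; exists d => // x0 y0; rewrite !subr0 => xd yd.
  have [y00|y00] := eqVneq y0 0; last first.
    apply: (proj1 (@differentiable_near R _ _ (fun p : C * C => (F p - F (p.1, 0)) / p.2) G (x0, y0) _ _)).
      apply/near0CC; exists (nrm y0); first by rewrite nrm_gt0.
      move=> x y _ yy; rewrite /G /=; case: eqP => // y_0; exfalso.
      by move: yy; rewrite y_0 sub0r nrmN ltxx.
    apply: differentiableM; last first.
      apply: differentiableV => //.
      by have /has_d2P[] := has_d2_snd (x0, y0).
    apply: differentiableB; first exact: dF.
    apply: (@differentiable_comp _ _ _ _ (fun p : C * C => (p.1, 0 : C)) F).
      apply: differentiable_pair; last exact: differentiable_cst.
      by have /has_d2P[] := has_d2_fst (x0, y0).
    by apply: dF; rewrite // nrm0.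
  rewrite {y0 yd}y00.
  have E x k : nrm x < d -> nrm k < d ->
      nrm (G (x, k) - Fy (x, 0) - Fyy (x, 0) / 2 * k) <= K * nrm k ^+ 2.
    move=> {}xd kd; rewrite /G /=; case: eqP => [->|/eqP k0].
      by rewrite mulr0 subr0 subrr nrm0 mulr_ge0 ?sqr_ge0.
    have := taylor2 K0 kd (fun z zd => sF x z xd zd) (cFy x xd).
    set u := F (x, k); set v := F (x, 0); set a := Fy _; set b := Fyy _.
    have -> : u - v - a * k - b / 2 * k ^+ 2 = ((u - v) / k - a - b / 2 * k) * k by field.
    by rewrite nrmM ler_pM2r // nrm_gt0.
  have D := has_d2_dd (dFy x0 0 xd ltac:(by rewrite nrm0)).
  move: (dx Fy _) (dy Fy _) D => a b D.
  suff : has_d2 G (x0, 0) (a, Fyy (x0, 0) / 2) by move=> /has_d2P[].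
  move=> e e0 /=; have [d2 d20 Hd2] := D (e / 4) ltac:(lra).
  have [d3 d30 Hd3] := nbhs_cont (dFyy x0 0 xd ltac:(by rewrite nrm0)) (e := e / 4) ltac:(lra).
  exists (Num.min (Num.min (d - nrm x0) d2) (Num.min (Num.min d d3) (e / (4 * (K + 1))))).
    by rewrite !lt_min subr_gt0 xd d20 d0 d30 divr_gt0 //; lra.
  move=> h k; rewrite !lt_min => /andP[/andP[h1 h2] /andP[/andP[h3 h4] h5]].
  move=> /andP[/andP[k1 k2] /andP[/andP[k3 k4] k5]].
  have xh : nrm (x0 + h) < d by have := nrmD x0 h; lra.
  have B1 := E _ _ xh k3; have B2 := Hd2 h 0 h2; rewrite nrm0 /= addr0 mulr0 subr0 in B2.
  have {}B2 := B2 d20; rewrite max_l ?nrm_ge0 // in B2.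
  have B3 := Hd3 (x0 + h) 0; rewrite /= [x0 + h - x0]addrC addKr subrr nrm0 in B3.
  have {}B3 := B3 h4 d30.
  rewrite add0r {2}/G /= eqxx.
  set m := Num.max _ _; have hm : nrm h <= m by rewrite le_max lexx.
  have km : nrm k <= m by rewrite le_max lexx orbT.
  have -> : G (x0 + h, k) - Fy (x0, 0) - a * h - Fyy (x0, 0) / 2 * k =
     (G (x0 + h, k) - Fy (x0 + h, 0) - Fyy (x0 + h, 0) / 2 * k)
     + (Fy (x0 + h, 0) - Fy (x0, 0) - a * h)
     + (Fyy (x0 + h, 0) - Fyy (x0, 0)) / 2 * k by field.
  set u1 := _ - _ * k in B1 *; set u2 := _ - a * h in B2 *; set u3 := Fyy _ - _ in B3 *.
  have := nrmD (u1 + u2) (u3 / 2 * k); have := nrmD u1 u2.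
  rewrite nrmM nrm_div nrm_nat.
  have k0 := nrm_ge0 k; have u30 := nrm_ge0 u3.
  have : nrm u3 / 2 * nrm k <= e / 8 * m by apply: ler_pM => //; lra.
  have : K * nrm k ^+ 2 <= e / 4 * m.
    rewrite expr2 mulrA; apply: ler_pM => //; first by rewrite mulr_ge0.
    have : nrm k * (4 * (K + 1)) < e by rewrite -ltr_pdivlMr //; lra.
    by nra.
  have : e / 4 * nrm h <= e / 4 * m by rewrite ler_wpM2l //; lra.
  have m0 : 0 <= e * m by rewrite mulr_ge0 ?(le_trans _ hm) ?nrm_ge0 // ltW.
  lra.
move=> x y; rewrite /G /=; case: eqP => [->|/eqP y0]; first by rewrite mul0r addr0.
by rewrite mulrC divfK // addrC subrK.
Qed.

Lemma holo_snd_comp (f : C -> C) : holomorphic0 f -> holomorphic0 (fun p : C * C => f p.2).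
Proof. by move=> hf; apply: (holo_comp hf (@holo_snd R)). Qed.

Lemma holo_inr : holomorphic0 (fun y : C => (0 : C, y)).
Proof. by apply: holo_pair; [exact: holo_cst|exact: holo_id]. Qed.
Lemma holo_inl : holomorphic0 (fun x : C => (x, 0 : C)).
Proof. by apply: holo_pair; [exact: holo_id|exact: holo_cst]. Qed.

Lemma holo_has_d (f : C -> C) : holomorphic0 f -> \forall z \near (0 : C), has_d f z (f^`()%classic z).
Proof. by apply: filterS => z df; apply/has_dP; rewrite derive1E. Qed.

Lemma has_d_derive1 (f : C -> C) z l : has_d f z l -> f^`()%classic z = l.
Proof. by move=> /has_dP[_ <-]; rewrite derive1E. Qed.

Lemma holo_derive1 (f : C -> C) : holomorphic0 f -> holomorphic0 (f^`()%classic : C -> C).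
Proof.
move=> hf; have hF := holo_snd_comp hf.
apply: holo_eq (holo_comp (holo_dy hF) holo_inr erefl).
have := near_comp holo_inr erefl hF; apply: filterS => y dF.
by rewrite (has_d_derive1 (slice_y dF)).
Qed.

Lemma hadamard1 (f : C -> C) : holomorphic0 f ->
  exists2 g : C -> C, holomorphic0 g & forall z, f z = f 0 + z * g z.
Proof.
move=> hf; have [G [hG HG _]] := hadamard (holo_snd_comp hf).
exists (fun y => G (0, y)); first exact: holo_comp hG holo_inr erefl.
by move=> z; exact: (HG 0 z).
Qed.

(** A weak maximum principle from Cauchy's formula: for [z] below half the radius the kernel has
    weight at most 2. The factor 2 is harmless in [order_dichotomy], where high powers beat it. *)
Lemma disc_bound (rho : R) (h : C -> C) (M : R) : 0 < rho ->
  (forall z, nrm z < rho -> exists l, has_d h z l) ->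
  (forall z, nrm z < rho -> nrm (h z) <= M) ->
  forall B z, (forall w, nrm w = rho / 8 -> nrm (h w) <= B) -> nrm z < rho / 16 ->
  nrm (h z) <= 2 * B.
Proof.
move=> rho0 dh hM B z HB zr.
have M0 : 0 <= M by have := hM 0; rewrite nrm0 => /(_ rho0); exact: le_trans (nrm_ge0 _).
have [K K0 HK] := regularity rho0 M0; have [f1 [f2 [[_ _ _ H] _]]] := HK h dh hM.
have r0 : 0 < rho / 8 by rewrite divr_gt0.
have := cauchy_lim r0 _ _ H (z := z) => /(_ ltac:(lra) ltac:(lra)) L.
apply: (lim_to_le (N := 0) L) => n _; apply: avg_bound => x x1.
have nx : nrm (rc (rho / 8) * x) = rho / 8 by rewrite nrmM x1 mulr1 nrm_rc gtr0_norm.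
have B0 : 0 <= B by apply: le_trans (HB _ nx); exact: nrm_ge0.
rewrite nrm_div nrmM nx -mulrA; have := HB _ nx => hB.
rewrite mulrC; apply: ler_pM => //; rewrite ?nrm_ge0 //.
  by rewrite divr_ge0 ?nrm_ge0 // ltW.
have := nrm_dist (rc (rho / 8) * x) z; rewrite nx => h1.
rewrite ler_pdivrMr; lra.
Qed.

Definition ordform (f : C -> C) (k : nat) := exists u : C -> C,
  [/\ holomorphic0 u, u 0 != 0 & germ_eq f (fun z => z ^+ k * u z)].

(** If no finite order exists, [f] is divisible by every [z ^ k]. Bounding [f / z ^ k] by its values
    on one fixed circle gives [nrm (f z) <= 2 * M * (nrm z / (rho / 8)) ^ k] for all [k], with ratio
    at most 1/2 near 0. *)
Lemma order_dichotomy (f : C -> C) : holomorphic0 f ->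
  germ_eq f (fun=> 0) \/ exists k, ordform f k.
Proof.
move=> hf; have [|nex] := pselect (exists k, ordform f k); first by right.
left; have step k : exists g : C -> C, holomorphic0 g /\ germ_eq f (fun z => z ^+ k * g z).
  elim: k => [|k [g [hg Hg]]].
    by exists f; split => //; apply: filterE => z; rewrite expr0 mul1r.
  have g0 : g 0 = 0.
    by apply: contrapT => /eqP g0; apply: nex; exists k, g; split.
  have [g' hg' Eg] := hadamard1 hg; exists g'; split => //.
  by apply: filterS Hg => z ->; rewrite Eg g0 add0r exprS mulrA [z * _]mulrC.
have [M [rho [rho0 M0 Hrho]]] : exists M rho, [/\ 0 < rho, 0 <= M & forall z, nrm z < rho ->
    differentiable f z /\ nrm (f z) <= M].
  have [rho [M [? ? H]]] := polydisc (holo_snd_comp hf); exists M, rho; split=> // z zr.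
  have [dF FM] := H 0 z ltac:(by rewrite nrm0) zr; split=> //.
  by have /has_dP[] := slice_y dF.
have key k z : nrm z < rho / 16 -> nrm (f z) <= 2 * M * (nrm z / (rho / 8)) ^+ k.
  move=> zr; have [g [hg Hg]] := step k.
  (* The quotient germ [g] is known only on a disc depending on [k]; [h] continues it to the whole
     disc of radius [rho]. *)
  pose h w := if w == 0 then g 0 else f w / w ^+ k.
  have /near0C[d d0 Hd] := Hg.
  have hgE w : nrm w < d -> h w = g w.
    move=> wd; rewrite /h; case: eqP => [->//|/eqP w0].
    by rewrite Hd ?subr0 // mulrC mulKf // expf_neq0.
  have [d1 [Mg [d10 Mg0 Hg1]]] : exists rho M, [/\ 0 < rho, 0 <= M & forall z, nrm z < rho ->
      differentiable g z /\ nrm (g z) <= M].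
    have [r' [M' [? ? H]]] := polydisc (holo_snd_comp hg); exists r', M'; split=> // w wr.
    have [dF FM] := H 0 w ltac:(by rewrite nrm0) wr; split=> //.
    by have /has_dP[] := slice_y dF.
  pose d2 := Num.min d d1; have d20 : 0 < d2 by rewrite lt_min d0.
  have dh w : nrm w < rho -> exists l, has_d h w l.
    move=> wr; exists ('D_1 h w); apply/has_dP; split=> //.
    have [wd|wd] := ltP (nrm w) d2.
      move: wd; rewrite lt_min => /andP[wd wd1].
      apply: (proj1 (differentiable_near (f := g) _ _)); last by have [] := Hg1 w wd1.
      apply/near0C; exists (d - nrm w); first by rewrite subr_gt0.
      by move=> v vw; rewrite hgE //; have := nrmD (v - w) w; rewrite subrK; lra.
    have w0 : w != 0 by rewrite -nrm_gt0; exact: lt_le_trans wd.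
    apply: (proj1 (differentiable_near (f := fun v => f v / v ^+ k) _ _)).
      apply/near0C; exists (nrm w); first by rewrite nrm_gt0.
      move=> v vw; rewrite /h; case: eqP => // v0; move: vw.
      by rewrite v0 sub0r nrmN ltxx.
    apply: differentiableM; first by have [] := Hrho w wr.
    apply: differentiableV; last by rewrite expf_neq0.
    by apply/derivable1_diffP; exact: exprn_derivable.
  have hM w : nrm w < rho -> nrm (h w) <= Mg + M / d2 ^+ k.
    move=> wr; have d2k := exprn_gt0 k d20.
    have Md : 0 <= M / d2 ^+ k by rewrite divr_ge0 // ltW.
    have [wd|wd] := ltP (nrm w) d2.
      move: wd; rewrite lt_min => /andP[wd wd1]; rewrite hgE //.
      by have [_] := Hg1 w wd1; lra.
    have w0 : w != 0 by rewrite -nrm_gt0; exact: lt_le_trans wd.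
    rewrite /h (negPf w0) nrm_div nrmX.
    apply: le_trans (_ : M / d2 ^+ k <= _); last by lra.
    apply: ler_pM; rewrite ?nrm_ge0 ?invr_ge0 ?exprn_ge0 ?nrm_ge0 //.
      by have [] := Hrho w wr.
    by rewrite lef_pV2 ?posrE ?exprn_gt0 ?nrm_gt0 // lerXn2r ?nnegrE ?nrm_ge0 // ltW.
  have [->|z0] := eqVneq z 0.
    have f0 := Hd 0; rewrite subrr nrm0 in f0; have {}f0 := f0 d0.
    have [k0|k0] := posnP k.
      by rewrite k0 expr0 mulr1; have [_] := Hrho 0 ltac:(by rewrite nrm0); lra.
    by rewrite f0 nrm0 [0 / _]mul0r !expr0n (gtn_eqF k0) mul0r nrm0 mulr0.
  have r8 : 0 < rho / 8 by rewrite divr_gt0.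
  have zk : 0 < nrm z ^+ k by rewrite exprn_gt0 // nrm_gt0.
  have := @disc_bound rho h _ rho0 dh hM (M / (rho / 8) ^+ k) z _ zr.
  rewrite /h (negPf z0) nrm_div nrmX ler_pdivrMr // => H.
  rewrite expr_div_n mulrA; apply: le_trans (H _) _.
    move=> w wr; have w0 : w != 0 by rewrite -nrm_gt0 wr.
    rewrite (negPf w0) nrm_div nrmX wr ler_pM2r ?invr_gt0 ?exprn_gt0 //.
    by have [] := Hrho w ltac:(lra).
  by rewrite le_eqVlt; apply/orP; left; apply/eqP; field; rewrite expf_neq0 ?gt_eqF.
apply/near0C; exists (rho / 16); first by rewrite divr_gt0.
move=> z; rewrite subr0 => zr; apply: nrm_le_eq0 => e e0.
have [|||N HN] := @geom_small R (1 / 2) _ _ (e / (2 * M + 1)); [lra|lra| |].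
  by rewrite divr_gt0 //; lra.
have := key N z zr; have := HN N (leqnn N).
have q0 : 0 <= nrm z / (rho / 8) by rewrite !divr_ge0 ?nrm_ge0 // ltW.
have q1 : nrm z / (rho / 8) <= 1 / 2.
  by rewrite ler_pdivrMr ?divr_gt0 //; lra.
have := lerXn2r N q0 _ q1 => /(_ ltac:(by rewrite nnegrE; lra)).
rewrite ler_pdivlMr; last by lra.
have := exprn_ge0 N q0; nra.
Qed.

End LocalTheory.

(** * Implicit functions and mixed derivatives *)

Section Calculus2.
Variable R : realType.
Local Notation C := (Cplx R).
Local Notation nrm := (@nrm R).
Local Notation disc r := (fun z : C => nrm z < r).

Lemma has_dM (f g : C -> C) z l m : has_d f z l -> has_d g z m ->
  has_d (fun w => f w * g w) z (l * g z + f z * m).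
Proof.
move=> /has_dP[df <-] /has_dP[dg <-]; apply/has_dP; split; first exact: differentiableM.
have := deriveM (f := f) (g := g) (x := z) (v := 1).
rewrite /GRing.mul /= => ->; try exact/derivable1_diffP.
by rewrite addrC /GRing.scale /=; congr (_ + _); exact: mulrC.
Qed.

Lemma has_dX (f : C -> C) z l n : has_d f z l ->
  has_d (fun w => f w ^+ n) z (n%:R * f z ^+ n.-1 * l).
Proof.
move=> df; elim: n => [|n IH].
  move=> e e0; exists 1 => // h _; rewrite !expr0 !mul0r subrr sub0r oppr0 nrm0.
  by rewrite mulr_ge0 ?nrm_ge0 // ltW.
have := has_dM df IH; rewrite [X in has_d _ _ X](_ : _ = n.+1%:R * f z ^+ n * l); last first.
  case: n {IH} => [|n]; first by rewrite expr0; ring.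
  by rewrite /= -[n.+2%:R]natr1 exprS; ring.
by move=> H e /H[d d0 Hd]; exists d => // h /Hd; rewrite -!exprS.
Qed.

Lemma has_dP2 (f : C -> C) z l : differentiable f z -> 'd f z 1 = l -> has_d f z l.
Proof. by move=> df <-; apply/has_dP; rewrite deriveE. Qed.

Lemma diff2E (F : C * C -> C) p h k : differentiable F p ->
  'd F p (h, k) = dx F p * h + dy F p * k.
Proof.
move=> dF; rewrite /dx /dy !deriveE //.
have -> : ((h, k) : C * C) = h *: ((1, 0) : C * C) + k *: ((0, 1) : C * C).
  rewrite -[RHS]/(h * 1 + k * 0, h * 0 + k * 1).
  by rewrite !mulr1 !mulr0 addr0 add0r.
by rewrite linearD; congr (_ + _); rewrite linearZ; exact: mulrC.
Qed.

Lemma chain2 (F : C * C -> C) (a b : C -> C) t a' b' :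
  differentiable F (a t, b t) -> has_d a t a' -> has_d b t b' ->
  has_d (fun s => F (a s, b s)) t (dx F (a t, b t) * a' + dy F (a t, b t) * b').
Proof.
move=> dF /has_dP[da aE] /has_dP[db bE].
have dg : differentiable (fun s => (a s, b s)) t by exact: differentiable_pair.
apply: has_dP2; first exact: (differentiable_comp dg dF).
rewrite (@diff_comp _ _ _ _ (fun s => (a s, b s)) F) //= diff_pair // diff2E //.
by rewrite -aE -bE !deriveE.
Qed.

Lemma differentiable_addM (f g : C -> C) (a z : C) : differentiable f z ->
  differentiable g z -> differentiable (fun x => f x + a * g x) z.
Proof.
move=> df dg; apply: (differentiableD df).
by apply: differentiableM dg; exact: differentiable_cst.
Qed.

(** Newton iteration with frozen slope: [T x] contracts by 1/2 where [dy F] is within [nrm c / 2] of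
    its value [c] at 0. All iterates are holomorphic in [x] and bounded by [rho], so they share one
    C^{1,1} constant and [c11_lim] makes their limit holomorphic. *)
Lemma ift (F : C * C -> C) : holomorphic0 F -> F 0 = 0 -> dy F 0 != 0 ->
  exists b : C -> C, [/\ holomorphic0 b, b 0 = 0 & \forall x \near (0 : C), F (x, b x) = 0].
Proof.
move=> hF F0 c0.
have cn : 0 < nrm (dy F 0) by rewrite nrm_gt0.
have [d1 d10 H1] := nbhs_cont (nbhs_singleton (holo_dy hF)) (e := nrm (dy F 0) / 2)
   ltac:(by rewrite divr_gt0).
have [d2 [M2 [d20 _ H2]]] := polydisc hF.
have sF x y : nrm x < d2 -> nrm y < d2 -> has_d (fun t => F (x, t)) y (dy F (x, y)).
  by move=> xd yd; apply: slice_y; have [] := H2 x y xd yd.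
move: (dy F) c0 cn H1 sF => Fy; move: (Fy 0) => c c0 cn H1 sF.
pose rho := Num.min d1 d2 / 2.
have rho0 : 0 < rho by rewrite divr_gt0 // lt_min d10.
have rd1 : rho < d1.
  by have : Num.min d1 d2 <= d1 := (ltac:(by rewrite ge_min lexx)); rewrite /rho in rho0 *; lra.
have rd2 : rho < d2.
  by have : Num.min d1 d2 <= d2 := (ltac:(by rewrite ge_min lexx orbT)); rewrite /rho in rho0 *; lra.
clearbody rho.
have [d3 d30 H3] := nbhs_cont (nbhs_singleton hF) (e := rho * nrm c / 4)
   ltac:(by rewrite divr_gt0 // mulr_gt0).
pose sg := Num.min d3 rho; have sg0 : 0 < sg by rewrite lt_min d30.
have sg3 : sg <= d3 by rewrite ge_min lexx.
have sgr : sg <= rho by rewrite ge_min lexx orbT.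
clearbody sg.
pose T x y := y + - c^-1 * F (x, y).
have T0 x : nrm x < sg -> nrm (T x 0) <= rho / 4.
  move=> xs; have := H3 x 0; rewrite !subr0 nrm0 F0 subr0 => /(_ ltac:(lra) d30) h.
  by rewrite /T add0r nrmM nrmN nrmV mulrC ler_pdivrMr //; lra.
have TL x y y' : nrm x < sg -> nrm y <= rho -> nrm y' <= rho ->
    nrm (T x y' - T x y) <= 1 / 2 * nrm (y' - y).
  move=> xs yr y'r; apply: (mvt (@mclosed_ball _ 0 rho) (@sclosed_ball _ 0 rho)); rewrite ?subr0 //.
  move=> w; rewrite subr0 => wr; exists (1 + - c^-1 * Fy (x, w)).
    by apply: has_dD; [exact: has_d_id|apply: has_dZ; apply: sF; lra].
  have -> : 1 + - c^-1 * Fy (x, w) = (c - Fy (x, w)) / c by field.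
  rewrite nrm_div ler_pdivrMr // nrmC; have := H1 x w; rewrite !subr0.
  by move=> /(_ ltac:(lra) ltac:(lra)); lra.
pose b k x := iter k (T x) 0.
have p2 k : 0 < (1 / 2 : R) ^+ k by rewrite exprn_gt0 // divr_gt0.
have bS k x : nrm x < sg -> nrm (b k x) <= rho / 2 * (1 - (1 / 2) ^+ k) /\
     nrm (b k.+1 x - b k x) <= rho / 4 * (1 / 2) ^+ k.
  move=> xs; elim: k => [|k [IH1 IH2]].
    by rewrite expr0 subrr mulr0 /= nrm0 subr0 mulr1 T0.
  have p2k := p2 k; have p2k' := p2 k.+1.
  have B1 : nrm (b k.+1 x) <= rho / 2 * (1 - (1 / 2) ^+ k.+1).
    have := nrmD (b k.+1 x - b k x) (b k x); rewrite subrK exprS; lra.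
  split=> //; have := TL x (b k x) (b k.+1 x) xs _ _.
  have := mulr_gt0 rho0 p2k; have := mulr_gt0 rho0 p2k' => q1 q2.
  move=> /(_ ltac:(lra) ltac:(lra)); rewrite exprS /=; lra.
have bB k x : nrm x < sg -> nrm (b k x) <= rho / 2.
  by move=> /(bS k)[h _]; have := mulr_gt0 rho0 (p2 k); lra.
have bC x n k : nrm x < sg -> nrm (b (n + k)%N x - b n x) <= rho / 2 * ((1 / 2) ^+ n - (1 / 2) ^+ (n + k)).
  move=> xs; elim: k => [|k IH]; first by rewrite addn0 !subrr nrm0 mulr0.
  rewrite addnS; have [_ h] := bS (n + k)%N x xs.
  have := nrmD (b (n + k).+1 x - b (n + k)%N x) (b (n + k)%N x - b n x).
  by rewrite addrA subrK exprS; lra.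
have bl x : exists l, nrm x < sg -> lim_to (fun k => b k x) l.
  have [xs|] := ltP (nrm x) sg; last by exists 0.
  have [|l Hl] := @C_complete R (fun k => b k x); last by exists l.
  move=> e e0; have [|||N HN] := @geom_small R (1 / 2) _ _ (e / (2 * rho)); [lra|lra| |].
    by rewrite divr_gt0 // mulr_gt0.
  exists N => m n Nm Nn; have h := HN N (leqnn N).
  rewrite ler_pdivlMr ?mulr_gt0 // in h.
  have := bC x N (m - N)%N xs; have := bC x N (n - N)%N xs; rewrite !subnKC //.
  have := nrm_tri (b m x) (b N x) (b n x); rewrite [nrm (b N x - _)]nrmC.
  have := mulr_gt0 rho0 (p2 m); have := mulr_gt0 rho0 (p2 n); have := mulr_gt0 rho0 (p2 N); lra.
have [bb Hbb] := choice bl.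
have bbB x : nrm x < sg -> nrm (bb x) <= rho / 2.
  by move=> xs; apply: (lim_to_le (N := 0) (Hbb x xs)) => n _; exact: bB.
have bd k x : nrm x < sg -> differentiable (b k) x.
  move=> xs; elim: k => [|k IH]; first exact: differentiable_cst.
  apply: (differentiable_addM (g := fun x => F (x, b k x)) (- c^-1) IH).
  apply: (@differentiable_comp _ _ _ _ (fun x => (x, b k x)) F).
    by apply: differentiable_pair.
  by have xb := bB k x xs; have [] := H2 x (b k x) ltac:(lra) ltac:(lra).
have [K K0 HK] := regularity sg0 (ltW rho0).
have Hc k : exists g, c11 (disc (sg / 4)) (b k) g K.
  have [z zs|z zs|f1 [f2 [[_ _ _ H] _]]] := HK (b k).
  - by exists ('D_1 (b k) z); apply/has_dP; split=> //; exact: bd.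
  - by have := bB k z zs; lra.
  by exists f1.
have [bd' Hbd'] := choice Hc.
have [z zs|bb' [_ Hbb']] := c11_lim Hbd' (F := bb); first by apply: Hbb; lra.
exists bb; split.
- apply/near0C; exists (sg / 4); first by rewrite divr_gt0.
  by move=> z; rewrite subr0 => /(c11_d Hbb')/has_dP[].
- have b00 k : b k 0 = 0.
    by elim: k => // k IH; rewrite /b iterS -/(b k 0) IH /T F0 mulr0 addr0.
  apply: (lim_to_unique (Hbb 0 _)); first by rewrite nrm0.
  by move=> e e0; exists 0%N => n _; rewrite b00 subrr nrm0 ltW.
- apply/near0C; exists sg => // x; rewrite subr0 => xs.
  have TT : T x (bb x) = bb x.
    apply/eqP; rewrite -subr_eq0; apply/eqP/nrm_le_eq0 => e e0.
    have [N HN] := Hbb x xs (e / 2) ltac:(lra).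
    have h1 := HN N (leqnn N); have h2 := HN N.+1 (leqnSn N).
    have h3 := TL x (b N x) (bb x) xs; have := bB N x xs; have := bbB x xs => h4 h5.
    have {}h3 := h3 ltac:(lra) ltac:(lra).
    have := nrm_tri (T x (bb x)) (b N.+1 x) (bb x); rewrite nrmC in h1.
    by have : b N.+1 x = T x (b N x) by []; move=> E; rewrite E in h2 *; lra.
  move/eqP: TT; rewrite /T -subr_eq0 addrC addKr mulf_eq0 oppr_eq0 invr_eq0 (negPf c0).
  by move/eqP.
Qed.

Lemma holo_shift (F : C * C -> C) : holomorphic0 F ->
  \forall p \near (0 : C * C), holomorphic0 (fun q : C * C => F (p + q)).
Proof.
move=> /near0CC[d d0 Hd]; apply/near0CC; exists (d / 2); first by rewrite divr_gt0.
move=> x y; rewrite !subr0 => xd yd; apply/near0CC; exists (d / 2); first by rewrite divr_gt0.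
move=> h k; rewrite !subr0 => hd kd.
apply: (@differentiable_comp _ _ _ _ (fun q : C * C => (x, y) + q) F).
  by apply: differentiableD; [exact: differentiable_cst|exact: ex_diff].
by apply: Hd; rewrite subr0 /=; [have := nrmD x h|have := nrmD y k]; lra.
Qed.

Lemma derive_shift2 (F : C * C -> C) (p v q : C * C) :
  'D_v (fun q : C * C => F (p + q)) q = 'D_v F (p + q).
Proof.
have E : (fun q : C * C => F (p + q)) \o shift q = F \o shift (p + q).
  by apply/funext => h /=; rewrite addrCA.
by rewrite /derive E.
Qed.

(** With [F = F (x, 0) + y * G] both mixed derivatives at 0 equal [dx G 0]. *)
Lemma dxdy0 (F : C * C -> C) : holomorphic0 F -> dx (dy F) 0 = dy (dx F) 0.
Proof.
move=> hF; have [G [hG EF EG]] := hadamard hF.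
have dG := holo_dx hG.
have /near0CC[d1 d10 H1] := hG; have /near0CC[d2 d20 H2] := hF.
have E1 : dx (dy F) 0 = dx G 0.
  apply: (has_d_unique (slice_x (nbhs_singleton (holo_dy hF)))).
  have := slice_x (nbhs_singleton hG).
  by move=> H e /H[d d0 Hd]; exists d => // h hd; rewrite -!EG; exact: Hd.
have dA : has_d (fun x => F (x, 0)) 0 (dx F 0) by exact: slice_x (nbhs_singleton hF).
have E2 y : nrm y < Num.min d1 d2 -> dx F (0, y) = dx F 0 + y * dx G (0, y).
  rewrite lt_min => /andP[y1 y2].
  have a1 := has_d_unique (slice_x (H2 0 y _ _)); apply: a1; rewrite ?subrr ?subr0 ?nrm0 //.
  have b1 : has_d (fun t => G (t, y)) 0 (dx G (0, y)).
    by apply: slice_x; apply: H1; rewrite ?subrr ?subr0 ?nrm0.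
  have := has_dD dA (has_dZ y b1).
  by move=> H e /H[d d0 Hd]; exists d => // h hd; rewrite !(EF _ y); exact: Hd.
rewrite E1; apply/esym.
apply: (has_d_unique (slice_y (nbhs_singleton (holo_dx hF)))).
have := has_dM (has_d_id 0) (slice_y (nbhs_singleton dG)).
rewrite mul1r mul0r addr0.
move: (dx F) (dx G) E2 => Fx Gx E2 H e e0; have [d d0 Hd] := H e e0.
exists (Num.min d (Num.min d1 d2)); first by rewrite !lt_min d0 d10.
move=> h; rewrite lt_min => /andP[hd hd12]; have := Hd h hd.
by rewrite add0r !mul0r !subr0 (E2 h) // -[Fx (0, 0)]/(Fx 0) [Fx 0 + _]addrC addrK.
Qed.

Lemma dx_shift (F : C * C -> C) p : dx (fun q : C * C => F (p + q)) = (fun q : C * C => dx F (p + q)).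
Proof. by apply/funext => q; exact: derive_shift2. Qed.

Lemma dy_shift (F : C * C -> C) p : dy (fun q : C * C => F (p + q)) = (fun q : C * C => dy F (p + q)).
Proof. by apply/funext => q; exact: derive_shift2. Qed.

Lemma dx_shift0 (G : C * C -> C) p : dx (fun q : C * C => G (p + q)) 0 = dx G p.
Proof. by rewrite dx_shift addr0. Qed.

Lemma dy_shift0 (G : C * C -> C) p : dy (fun q : C * C => G (p + q)) 0 = dy G p.
Proof. by rewrite dy_shift addr0. Qed.

Lemma dxdy (F : C * C -> C) : holomorphic0 F ->
  germ_eq (dx (dy F)) (dy (dx F)).
Proof.
move=> /holo_shift H0; apply: filterS H0 => p hp.
have E1 := etrans (congr1 (fun G => dx G 0) (dy_shift F p)) (dx_shift0 (dy F) p).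
have E2 := etrans (congr1 (fun G => dy G 0) (dx_shift F p)) (dy_shift0 (dx F) p).
cbv beta in E1, E2; have E3 := etrans (dxdy0 hp) E2.
exact (etrans (esym E1) E3).
Qed.

End Calculus2.

(** * Ramified coverings *)

Section Ramified.
Variable R : realType.
Local Notation C := (Cplx R).
Local Notation nrm := (@nrm R).

Lemma near_and (V : normedModType C) (P Q : V -> Prop) :
  (\forall p \near (0 : V), P p) -> (\forall p \near (0 : V), Q p) ->
  \forall p \near (0 : V), P p /\ Q p.
Proof. exact: filterI. Qed.

Lemma zero_closure (F : C * C -> C) p : differentiable F p ->
  (forall d, 0 < d -> exists x y, [/\ nrm (x - p.1) < d, nrm (y - p.2) < d & F (x, y) = 0]) ->
  F p = 0.
Proof.
move=> dF H; apply: nrm_le_eq0 => e e0; have [d d0 Hd] := nbhs_cont dF e0.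
have [x [y [xd yd F0]]] := H d d0; have := Hd x y xd yd.
by rewrite F0 sub0r nrmN.
Qed.

Lemma small_point (d : R) : 0 < d -> exists2 h : C, h != 0 & nrm h < d.
Proof.
move=> d0; have n : nrm (rc (d / 2)) = d / 2 by rewrite nrm_rc gtr0_norm // divr_gt0.
exists (rc (d / 2)); last by rewrite n; lra.
by rewrite -nrm_gt0 n divr_gt0.
Qed.

Lemma dense_x (F : C * C -> C) : holomorphic0 F ->
  (\forall p \near (0 : C * C), p.1 != 0 -> F p = 0) -> germ_eq F (fun=> 0).
Proof.
move=> hF H; have /near0CC[d d0 Hd] := near_and hF H.
apply/near0CC; exists d => // x y xd yd; have [dF F0] := Hd x y xd yd.
have [x0|/F0//] := eqVneq x 0; apply: (zero_closure dF) => d' d'0.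
have [h h0 hd] := @small_point (Num.min d d') ltac:(by rewrite lt_min d0).
rewrite lt_min in hd; case/andP: hd => hd hd'.
exists h, y; rewrite /= x0 subr0 subrr nrm0; split=> //.
by apply: (proj2 (Hd h y _ yd)) => //; rewrite subr0.
Qed.

Lemma hadamardx (F : C * C -> C) : holomorphic0 F ->
  exists2 G : C * C -> C, holomorphic0 G & forall x y, F (x, y) = F (0, y) + x * G (x, y).
Proof.
move=> hF; have [G [hG EG _]] := hadamard (holo_swap hF).
exists (fun p => G (swapc p)); first exact: holo_swap.
by move=> x y; exact: (EG y x).
Qed.

Lemma holo_scale (c : C) : holomorphic0 (fun p : C * C => (c * p.1, p.2)).
Proof.
apply: holo_pair; last exact: holo_snd.
by apply: holoM; [exact: holo_cst|exact: holo_fst].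
Qed.

Lemma scale0 (c : C) : (fun p : C * C => (c * p.1, p.2)) 0 = 0.
Proof. by rewrite /= mulr0. Qed.

(** Setting [x = 0] gives [Q (0, y) = om ^ i * Q (0, y)], hence [Q (0, y) = 0] for [0 < i < e];
    dividing by [x] lowers the eigenvalue to [om ^ (i - 1)]. *)
Lemma eigen_div e (om : C) i (Q : C * C -> C) : e.-primitive_root om -> (i < e)%N ->
  holomorphic0 Q -> (\forall p \near (0 : C * C), Q (om * p.1, p.2) = om ^+ i * Q p) ->
  exists S : C * C -> C, [/\ holomorphic0 S, germ_eq Q (fun p => p.1 ^+ i * S p) &
    \forall p \near (0 : C * C), S (om * p.1, p.2) = S p].
Proof.
move=> om_p; elim: i Q => [|i IH] Q ie hQ HQ.
  exists Q; split=> //; first by apply: filterE => p; rewrite expr0 mul1r.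
  by apply: filterS HQ => p ->; rewrite expr0 mul1r.
have [G hG EG] := hadamardx hQ.
have om1 : om ^+ i.+1 != 1.
  rewrite -(prim_order_dvd om_p); apply/negP => /dvdn_leq; lia.
have om0 : om != 0 by rewrite (prim_root_eq0 om_p) -lt0n; lia.
have Q0 : \forall p \near (0 : C * C), Q (0, p.2) = 0.
  have h2 : holomorphic0 (fun p : C * C => (0 : C, p.2)).
    by apply: holo_pair; [exact: holo_cst|exact: holo_snd].
  have := near_comp h2 erefl HQ; apply: filterS => p /=; rewrite mulr0 => H.
  apply/eqP; rewrite -(mulrI_eq0 _ (x := 1 - om ^+ i.+1)).
    by rewrite mulrBl mul1r -H subrr.
  by apply: mulfI; rewrite subr_eq0 eq_sym.
have QG : germ_eq Q (fun p => p.1 * G p).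
  by apply: filterS Q0 => -[x y] /= Q0; rewrite EG Q0 add0r.
have HG : \forall p \near (0 : C * C), G (om * p.1, p.2) = om ^+ i * G p.
  have hd : holomorphic0 (fun p : C * C => G (om * p.1, p.2) - om ^+ i * G p).
    apply: holoB; first exact: holo_comp hG (holo_scale om) (scale0 om).
    by apply: holoM => //; exact: holo_cst.
  have := @dense_x _ hd; have N := near_comp (holo_scale om) (scale0 om) QG.
  have {}N : \forall p \near (0 : C * C), p.1 != 0 -> G (om * p.1, p.2) - om ^+ i * G p = 0.
    apply: filterS2 (near_and N QG) HQ => -[x y] /= [E1 E2] E3 x0.
    apply/eqP; rewrite -(mulrI_eq0 _ (x := om * x)).
      by rewrite mulrBr -E1 E3 E2 exprS; apply/eqP; ring.
    by apply: mulfI; rewrite mulf_neq0.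
  by move=> /(_ N); apply: filterS => p /subr0_eq.
have [S [hS ES IS]] := IH G (ltnW ie) hG HG.
exists S; split=> //.
by apply: filterS2 QG ES => p -> ->; rewrite exprS mulrA.
Qed.

(** A pointwise choice of root, with no continuity; [descend] composes it only with a germ invariant
    under the choice. *)
Definition rt e (x : C) : C := e.-root (x : R[i]).

Lemma rtK e x : (0 < e)%N -> rt e x ^+ e = x.
Proof. by move=> e0; exact: rootCK. Qed.

Lemma nrm_rt e x d : (0 < e)%N -> 0 <= d -> nrm x < d ^+ e -> nrm (rt e x) < d.
Proof.
move=> e0 d0; rewrite -{1}(rtK x e0) nrmX ltr_pXn2r // nnegrE ?nrm_ge0 //.
Qed.

Lemma prim_root_exists e : (0 < e)%N -> exists om : C, e.-primitive_root om.
Proof.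
move=> e0; pose p : {poly R[i]} := 'X^e - 1.
have [r Dp] := closed_field_poly_normal p.
move: Dp; rewrite (monicP _) ?monicXnsubC // scale1r => Dp.
have rn1 : all e.-unity_root r by apply/allP => z; rewrite -root_prod_XsubC -Dp.
have sz_r : (e < (size r).+1)%N.
  by rewrite -(size_prod_XsubC r id) -Dp size_XnsubC.
have [|z _ zp] := hasP (cyclic.has_prim_root e0 rn1 _ sz_r); last by exists z.
rewrite -separable.separable_prod_XsubC -Dp cyclotomic.separable_Xn_sub_1 //.
by rewrite pnatr_eq0 -lt0n.
Qed.

Lemma prim_nrm e (om : C) : (0 < e)%N -> e.-primitive_root om -> nrm om = 1.
Proof.
move=> e0 /prim_expr_order h; apply/eqP.
by rewrite -(@pexpr_eq1 _ _ e) ?nrm_ge0 // -nrmX h nrm1.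
Qed.

(* A germ invariant under multiplication of [x] by a primitive [e]-th root of unity
   is a germ in [x ^ e]. *)
Lemma descend e (om : C) (Q : C * C -> C) : (0 < e)%N -> e.-primitive_root om ->
  holomorphic0 Q -> (\forall p \near (0 : C * C), Q (om * p.1, p.2) = Q p) ->
  exists2 q : C * C -> C, holomorphic0 q &
    \forall p \near (0 : C * C), Q p = q (p.1 ^+ e, p.2).
Proof.
move=> e0 om_p hQ HQ.
have om_e := prim_expr_order om_p.
have om0 : om != 0 by rewrite (prim_root_eq0 om_p) -lt0n.
have om1 := prim_nrm e0 om_p.
(* The quotient [S1] has eigenvalue [om ^ -1 = om ^ (e - 1)], so [e - 1] further factors [x] split
   off and [Q = Q (0, y) + x ^ e * S]. *)
have [S1 hS1 ES1] := hadamardx hQ.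
have HS1 : \forall p \near (0 : C * C), S1 (om * p.1, p.2) = om ^+ e.-1 * S1 p.
  have hd : holomorphic0 (fun p : C * C => S1 (om * p.1, p.2) - om ^+ e.-1 * S1 p).
    apply: holoB; first exact: holo_comp hS1 (holo_scale om) (scale0 om).
    by apply: holoM => //; exact: holo_cst.
  have N : \forall p \near (0 : C * C), p.1 != 0 -> S1 (om * p.1, p.2) - om ^+ e.-1 * S1 p = 0.
    apply: filterS HQ => -[x y] /= E x0.
    apply/eqP; rewrite -(mulrI_eq0 _ (x := om * x)); last by apply: mulfI; rewrite mulf_neq0.
    rewrite mulrBr; move: E; rewrite (ES1 x y) (ES1 (om * x) y) => /addrI ->.
    rewrite [om * x * (_ * _)]mulrACA -exprS prednK // om_e mul1r subrr.
    by [].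
  by have := dense_x hd N; apply: filterS => p /subr0_eq.
have [S [hS ES IS]] := eigen_div om_p (i := e.-1) ltac:(lia) hS1 HS1.
have {}ES : \forall p \near (0 : C * C), Q p = Q (0, p.2) + p.1 ^+ e * S p.
  apply: filterS ES => -[x y] /= E; rewrite (ES1 x y) E mulrA -exprS prednK //.
have /near0CC[d d0 Hd] := near_and (near_and hQ hS) (near_and HQ ES).
have invQ x y j : nrm x < d -> nrm y < d -> Q (om ^+ j * x, y) = Q (x, y).
  move=> xd yd; elim: j => [|j IH]; first by rewrite expr0 mul1r.
  have n : nrm (om ^+ j * x) = nrm x by rewrite nrmM nrmX om1 expr1n mul1r.
  have [_ [/= E _]] := Hd (om ^+ j * x) y ltac:(by rewrite subr0 n) ltac:(by rewrite subr0).
  by rewrite exprS -mulrA E.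
pose q (p : C * C) := Q (rt e p.1, p.2).
have qE t y : nrm t < d -> nrm y < d -> q (t ^+ e, y) = Q (t, y).
  move=> td yd; rewrite /q /=; have [t0|t0] := eqVneq t 0.
    rewrite t0 expr0n gtn_eqF //; congr (Q (_, _)).
    by have := rtK 0 e0; move/eqP; rewrite expf_eq0 e0 => /eqP.
  have h : (rt e (t ^+ e) / t) ^+ e = 1.
    by rewrite expr_div_n rtK // divff // expf_neq0.
  have [i E] := prim_rootP om_p h.
  by rewrite -(divfK t0 (rt e _)) E; exact: invQ.
have de0 : 0 < d ^+ e by rewrite exprn_gt0.
exists q; last first.
  apply/near0CC; exists d => // x y; rewrite !subr0 => xd yd.
  by rewrite qE.
apply/near0CC; exists (Num.min d (d ^+ e)); first by rewrite lt_min d0.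
move=> x0 y0; rewrite !subr0 !lt_min => /andP[xd xde] /andP[yd _].
pose t0 := rt e x0; have t0e : t0 ^+ e = x0 by exact: rtK.
have t0d : nrm t0 < d by apply: nrm_rt => //; exact: ltW.
(* Around [x0 = 0] this reads [q (x, y) = Q (0, y) + x * S (rt e x, y)], and continuity of [S] at
   [(0, y0)] gives the differential. *)
have [x00|x00] := eqVneq x0 0.
  have dS0 : differentiable S (0, y0).
    by have [[_]] := Hd 0 y0 ltac:(by rewrite subr0 nrm0) ltac:(by rewrite subr0).
  have dQ0 : differentiable Q (0, y0).
    by have [[]] := Hd 0 y0 ltac:(by rewrite subr0 nrm0) ltac:(by rewrite subr0).
  have [D1 H1] : exists D, has_d (fun y => Q (0, y)) y0 D.
    by exists (dy Q (0, y0)); exact: slice_y.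
  suff : has_d2 q (x0, y0) (S (0, y0), D1) by move=> /has_d2P[].
  move=> ep ep0 /=; have [d1 d10 Hd1] := H1 (ep / 2) ltac:(lra).
  have [d2 d20 Hd2] := nbhs_cont dS0 (e := ep / 2) ltac:(lra).
  exists (Num.min (Num.min (Num.min d1 d2) (d2 ^+ e)) (Num.min (d ^+ e) (d - nrm y0))).
    by rewrite !lt_min d10 d20 de0 exprn_gt0 // subr_gt0.
  move=> h k; rewrite !lt_min => /andP[/andP[/andP[h1 h2] h3] /andP[h4 h5]].
  move=> /andP[/andP[/andP[k1 k2] k3] /andP[k4 k5]].
  rewrite x00 add0r; pose t := rt e h; have te : t ^+ e = h by exact: rtK.
  have td : nrm t < d by apply: nrm_rt => //; exact: ltW.
  have td2 : nrm t < d2 by apply: nrm_rt => //; exact: ltW.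
  have yk : nrm (y0 + k) < d by have := nrmD y0 k; lra.
  have -> : q (h, y0 + k) = Q (t, y0 + k) by rewrite -te qE.
  have -> : q (0, y0) = Q (0, y0).
    by rewrite -qE ?nrm0 // expr0n gtn_eqF.
  have [_ [_ /= ->]] := Hd t (y0 + k) ltac:(by rewrite subr0) ltac:(by rewrite subr0).
  rewrite te.
  set m := Num.max _ _; have hm : nrm h <= m by rewrite le_max lexx.
  have km : nrm k <= m by rewrite le_max lexx orbT.
  have -> : Q (0, y0 + k) + h * S (t, y0 + k) - Q (0, y0) - S (0, y0) * h - D1 * k
    = (Q (0, y0 + k) - Q (0, y0) - D1 * k) + (S (t, y0 + k) - S (0, y0)) * h by ring.
  apply: le_trans (nrmD _ _) _; rewrite nrmM.
  have a1 := Hd1 k k1; have a2 := Hd2 t (y0 + k).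
  rewrite /= subr0 [y0 + k - y0]addrC addKr in a2; have {}a2 := a2 td2 k2.
  have := ler_pM (nrm_ge0 _) (nrm_ge0 _) a2 hm.
  have : ep / 2 * nrm k <= ep / 2 * m by rewrite ler_wpM2l //; lra.
  lra.
(* For [x0 != 0] the implicit function theorem provides a holomorphic root [t0 + b (x - x0)], and
   [q] is [Q] evaluated there. *)
pose F (p : C * C) : C := (t0 + p.2) ^+ e - x0 - p.1.
have t00 : t0 != 0.
  by apply: contraNneq x00 => t00; rewrite -t0e t00 expr0n gtn_eqF.
have hF : holomorphic0 F.
  apply: holoB; last exact: holo_fst.
  apply: holoB; last exact: holo_cst.
  by apply: holoX; apply: holoD; [exact: holo_cst|exact: holo_snd].
have [||b [hb b0 Hb]] := ift hF.
- by rewrite /F /= addr0 t0e subrr subr0.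
- have := slice_y (nbhs_singleton hF).
  have H : has_d (fun t => F (0, t)) 0 (e%:R * t0 ^+ e.-1).
    have d1 : has_d (fun t : C => t0 + t) 0 1.
      have dc : has_d (fun _ : C => t0) 0 0.
        by apply/has_dP; split; [exact: differentiable_cst|exact: derive_cst].
      by have := has_dD dc (has_d_id (0 : C)); rewrite add0r.
    have := has_dX e d1; rewrite addr0 mulr1.
    move=> H ep /H[d' d'0 Hd']; exists d' => // h /Hd'.
    by congr (_ <= _); congr nrm; rewrite /F /=; ring.
  move=> /(has_d_unique H) <-.
  by rewrite mulf_neq0 ?expf_neq0 // pnatr_eq0 -lt0n.
have dQ : differentiable Q (t0, y0).
  by have [[]] := Hd t0 y0 ltac:(by rewrite subr0) ltac:(by rewrite subr0).
have dg : differentiable (fun p : C * C => (t0 + b (p.1 - x0), p.2)) (x0, y0).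
  apply: differentiable_pair; last by have /has_d2P[] := has_d2_snd (x0, y0).
  apply: differentiableD; first exact: differentiable_cst.
  apply: (@differentiable_comp _ _ _ _ (fun p : C * C => p.1 - x0) b).
    apply: differentiableB; last exact: differentiable_cst.
    by have /has_d2P[] := has_d2_fst (x0, y0).
  by rewrite /= subrr; exact: (nbhs_singleton hb).
have dQg : differentiable (fun p : C * C => Q (t0 + b (p.1 - x0), p.2)) (x0, y0).
  apply: (@differentiable_comp _ _ _ _ (fun p : C * C => (t0 + b (p.1 - x0), p.2)) Q (x0, y0) dg).
  have E : t0 + b (x0 - x0) = t0 by rewrite subrr b0 addr0.
  by rewrite [(x0, y0).1]/= [(x0, y0).2]/= E; exact: dQ.
apply: (proj1 (differentiable_near _ dQg)).
have /near0C[d1 d10 Hd1] := Hb.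
apply/near0CC; exists (Num.min (Num.min d1 (d ^+ e - nrm x0)) (d - nrm y0)).
  by rewrite !lt_min d10 !subr_gt0 xde.
move=> x y; rewrite !lt_min /= => /andP[/andP[h1 h2] _] /andP[_ h3].
have := Hd1 (x - x0); rewrite subr0 => /(_ h1); rewrite /F /=.
set t := t0 + _ => E; have te : t ^+ e = x.
  by apply/subr0_eq; rewrite -E; ring.
have td : nrm t < d.
  rewrite -(ltr_pXn2r e0) ?nnegrE ?nrm_ge0 ?ltW // -nrmX te.
  by have := nrmD (x - x0) x0; rewrite subrK; lra.
rewrite -qE // ?te //; have := nrmD (y - y0) y0; rewrite subrK; lra.
Qed.

End Ramified.

Lemma near_forall (K : numFieldType) (V : normedModType K) (I : finType) (P : I -> V -> Prop) :
  (forall i, \forall p \near (0 : V), P i p) -> \forall p \near (0 : V), forall i, P i p.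
Proof. exact: (@filter_forall V I P (nbhs (0 : V)) _). Qed.

(** * Germs as a free module over a ramified covering *)

Section Decomposition.
Variable R : realType.
Local Notation C := (Cplx R).
Local Notation nrm := (@nrm R).
Variables (e : nat) (om : C).
Hypothesis (e0 : (0 < e)%N) (om_p : e.-primitive_root om).

Let om_neq0 : om != 0.
Proof. by rewrite (prim_root_eq0 om_p) -lt0n. Qed.

Lemma root_orthogonality (i k : 'I_e) :
  \sum_(j < e) (om ^+ j) ^+ i * (om^-1 ^+ j) ^+ k = if i == k then e%:R else 0.
Proof.
have -> : \sum_(j < e) (om ^+ j) ^+ i * (om^-1 ^+ j) ^+ k =
    \sum_(j < e) (om ^+ i / om ^+ k) ^+ j.
  by apply: eq_bigr => j _; rewrite exprMn !exprVn -!exprM (mulnC j i) (mulnC j k).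
case: eqP => [->|/eqP ik].
  rewrite (eq_bigr (fun=> 1)); last by move=> j _; rewrite (divff (expf_neq0 k om_neq0)) expr1n.
  by rewrite sumr_const card_ord.
set z := _ / _; have z1 : z - 1 != 0.
  rewrite subr_eq0; apply: contra ik => /eqP zE.
  have : om ^+ i == om ^+ k by rewrite -[om ^+ i](divfK (expf_neq0 k om_neq0)) -/z zE mul1r.
  by rewrite (eq_prim_root_expr om_p) !modn_small.
apply: (mulfI z1); rewrite -subrX1 mulr0 /z expr_div_n -!exprM ![(_ * e)%N]mulnC !exprM.
by rewrite (prim_expr_order om_p) !expr1n divr1 subrr.
Qed.

Lemma sum_cyclic_shift (g : nat -> C) : g e = g 0%N -> \sum_(j < e) g j.+1 = \sum_(j < e) g j.
Proof.
case: (e) e0 => // e' _ ge.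
by rewrite big_ord_recr /= ge big_ord_recl /= addrC.
Qed.

(** The discrete Fourier transform splits the germ into eigencomponents of [x -> om * x]; the [i]-th
    is [x ^ i] times an invariant germ, which descends to [x ^ e]. *)
Lemma ramified_decomposition (Q : C * C -> C) : holomorphic0 Q ->
  exists q : 'I_e -> C * C -> C, (forall i, holomorphic0 (q i)) /\
    germ_eq Q (fun p => \sum_(i < e) p.1 ^+ i * q i (p.1 ^+ e, p.2)).
Proof.
move=> hQ.
pose Qi (i : 'I_e) p := e%:R^-1 * \sum_(j < e) (om^-1 ^+ i) ^+ j * Q (om ^+ j * p.1, p.2).
have hQi i : holomorphic0 (Qi i).
  apply: holoM; first exact: holo_cst.
  apply: holo_sum => j; apply: holoM; first exact: holo_cst.
  exact: holo_comp hQ (holo_scale (om ^+ j)) (scale0 _).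
have EQi i p : Qi i (om * p.1, p.2) = om ^+ i * Qi i p.
  rewrite /Qi mulrCA; congr (_ * _); rewrite mulr_sumr /=.
  rewrite -[in RHS](@sum_cyclic_shift (fun j => om ^+ i * ((om^-1 ^+ i) ^+ j * Q (om ^+ j * p.1, p.2)))).
    apply: eq_bigr => j _; rewrite [RHS]mulrA (exprS (om^-1 ^+ i)) [om ^+ i * (_ * _)]mulrA.
    by rewrite -exprMn divff // expr1n mul1r exprSr mulrA.
  rewrite (prim_expr_order om_p) !expr0 -exprM mulnC exprM exprVn.
  by rewrite (prim_expr_order om_p) invr1 expr1n.
have SQi p : Q p = \sum_(i < e) Qi i p.
  rewrite /Qi -mulr_sumr exchange_big /=.
  rewrite (eq_bigr (fun j : 'I_e => (if Ordinal e0 == j then e%:R else 0) * Q (om ^+ j * p.1, p.2))).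
    rewrite (bigD1 (Ordinal e0)) // eqxx big1 => [|j /negPf]; last by rewrite eq_sym => ->; rewrite mul0r.
    by rewrite [X in _ * X]addr0 mulrA mulVf ?pnatr_eq0 -?lt0n // expr0 !mul1r -surjective_pairing.
  move=> j _; rewrite -mulr_suml; congr (_ * _); rewrite -root_orthogonality.
  by apply: eq_bigr => k _; rewrite expr0 mul1r -!exprM mulnC.
have H i : exists q : C * C -> C, holomorphic0 q /\
    germ_eq (Qi i) (fun p => p.1 ^+ i * q (p.1 ^+ e, p.2)).
  have [S [hS ES IS]] := eigen_div om_p (ltn_ord i) (hQi i) (filterE _ (EQi i)).
  have [q hq Eqq] := descend e0 om_p hS IS; exists q; split=> //.
  by apply: filterS2 ES Eqq => p -> ->.
have [q Hq] := choice H; exists q; split=> [i|]; first by have [] := Hq i.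
have : \forall p \near (0 : C * C), forall i, Qi i p = p.1 ^+ i * q i (p.1 ^+ e, p.2).
  by apply: near_forall => i; have [] := Hq i.
by apply: filterS => p E; rewrite SQi; apply: eq_bigr => i _.
Qed.

(** Over a point [x != 0] the relation holds at all [e] roots [om ^ j * t]; Fourier inversion
    isolates each [q k (x, y)], and [dense_x] supplies [x = 0]. *)
Lemma ramified_unique (q : 'I_e -> C * C -> C) : (forall i, holomorphic0 (q i)) ->
  (\forall p \near (0 : C * C), \sum_(i < e) p.1 ^+ i * q i (p.1 ^+ e, p.2) = 0) ->
  forall i, germ_eq (q i) (fun=> 0).
Proof.
move=> hq /near0CC[d d0 Hd] k; apply: dense_x => //.
apply/near0CC; exists (Num.min d (d ^+ e)); first by rewrite lt_min d0 exprn_gt0.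
move=> x y; rewrite !subr0 !lt_min => /andP[_ xd] /andP[yd _] /= x0.
pose t := rt e x; have te : t ^+ e = x by exact: rtK.
have td : nrm t < d by apply: nrm_rt => //; exact: ltW.
have t0 : t != 0 by apply: contraNneq x0 => t0; rewrite -te t0 expr0n gtn_eqF.
have Hj (j : 'I_e) : \sum_(i < e) (om ^+ j) ^+ i * (t ^+ i * q i (x, y)) = 0.
  have n : nrm (om ^+ j * t) < d by rewrite nrmM nrmX (prim_nrm e0 om_p) expr1n mul1r.
  rewrite -[RHS](Hd (om ^+ j * t) y ltac:(by rewrite subr0) ltac:(by rewrite subr0)) /=.
  have E : (om ^+ j * t) ^+ e = x.
    by rewrite exprMn te -exprM mulnC exprM (prim_expr_order om_p) expr1n mul1r.
  by apply: eq_bigr => i _; rewrite E exprMn mulrA.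
have : \sum_(j < e) (om^-1 ^+ j) ^+ k * \sum_(i < e) (om ^+ j) ^+ i * (t ^+ i * q i (x, y)) = 0.
  by rewrite big1 // => j _; rewrite Hj mulr0.
under eq_bigr => j _ do rewrite mulr_sumr.
rewrite exchange_big /=.
rewrite (eq_bigr (fun i : 'I_e => (if i == k then e%:R else 0) * (t ^+ i * q i (x, y)))); last first.
  move=> i _; rewrite -root_orthogonality mulr_suml; apply: eq_bigr => j _.
  by rewrite mulrCA mulrA.
rewrite (bigD1 k) // eqxx big1 => [|i /negPf->]; last by rewrite mul0r.
rewrite [X in X = _]addr0 => /eqP; rewrite !mulf_eq0 pnatr_eq0 (gtn_eqF e0) (negPf (expf_neq0 _ t0)) /=.
by move/eqP.
Qed.

End Decomposition.

(** * Dimensions of quotients *)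

Section Dimension.
Variable R : realType.
Local Notation C := (Cplx R).

(** Dimensions need only linear subspaces; closure under germ equality makes them subspaces of germs
    rather than of representatives. *)
Definition submod (V : normedModType C) (I : set (V -> C)) : Prop :=
  [/\ I (fun=> 0), forall u v, germ_eq u v -> I u -> I v &
      forall (a : C) u v, I u -> I v -> I (fun z => a * u z + v z)].

(** Arbitrary finite index types allow bases indexed by sums ([dim_exact]) and products
    ([mult_ram]). *)
Definition indep (V : normedModType C) (I : set (V -> C)) (T : finType) (h : T -> V -> C) :=
  (forall i, holomorphic0 (h i)) /\
  forall c : T -> C, I (fun z => \sum_i c i * h i z) -> forall i, c i = 0.

Definition spans (V : normedModType C) (I : set (V -> C)) (T : finType) (h : T -> V -> C) :=
  forall u : V -> C, holomorphic0 u ->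
    exists c : T -> C, I (fun z => u z - \sum_i c i * h i z).

Section OneSpace.
Variables (V : normedModType C) (I : set (V -> C)).

Lemma submod_sum (sI : submod I) (T : finType) (c : T -> C) (u : T -> V -> C) :
  (forall i, I (u i)) -> I (fun z => \sum_i c i * u i z).
Proof.
have [I0 Ie Il] := sI; move=> Iu; rewrite /index_enum; elim: (Finite.enum T) => [|i r IH].
  by apply: Ie I0; apply: filterE => z; rewrite big_nil.
by apply: Ie (Il (c i) _ _ (Iu i) IH); apply: filterE => z; rewrite big_cons.
Qed.

Lemma indep_ord (T : finType) (h : T -> V -> C) : submod I -> indep I h ->
  indep I (fun i : 'I_#|T| => h (enum_val i)).
Proof.
move=> [_ Ie _] [hh H]; split=> // c Hc i.
rewrite -(enum_valK i); apply: (H (fun t => c (enum_rank t))).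
apply: Ie Hc; apply: filterE => z; rewrite [RHS](reindex (@enum_val T T)) /=.
  by apply: eq_bigr => j _; rewrite enum_valK.
by exists enum_rank => j _; rewrite ?enum_valK ?enum_rankK.
Qed.

Lemma dim_ge (T : finType) (h : T -> V -> C) : submod I -> indep I h ->
  ((#|T|%:R)%:E <= dim_quotient I)%E.
Proof.
move=> sI /(indep_ord sI)[hh H]; apply: ereal_sup_ubound; exists #|T| => //.
by exists (fun i => h (enum_val i)).
Qed.

Lemma dim_ge0 : (0 <= dim_quotient I)%E.
Proof.
apply: ereal_sup_ubound; exists 0%N => //; exists (fun i _ => 0) => [[]//|c _ []//].
Qed.

Lemma dim_le (x : \bar R) : (forall n (h : 'I_n -> V -> C), indep I h -> ((n%:R)%:E <= x)%E) ->
  (dim_quotient I <= x)%E.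
Proof.
move=> H; apply: ge_ereal_sup => _ [n [h hh Hh] <-].
by apply: (H n h).
Qed.

(** Steinitz by linear algebra: modulo [I] the germs [g j] have coordinate rows of length [#|T|];
    more rows than that have a nonzero left kernel vector, which is a relation between the [g j]. *)
Lemma exchange (T : finType) (h : T -> V -> C) m (g : 'I_m -> V -> C) :
  submod I -> spans I h -> indep I g -> (m <= #|T|)%N.
Proof.
move=> sI sp [hg ig]; have [I0 Ie Il] := sI; rewrite leqNgt; apply/negP => lt.
have [a Ha] := choice (fun j => sp (g j) (hg j)).
pose A : 'M[C]_(m, #|T|) := \matrix_(j, k) a j (enum_val k).
have kn0 : kermx A != 0.
  rewrite -mxrank_eq0 mxrank_ker -lt0n subn_gt0.
  exact: leq_ltn_trans (rank_leq_col A) lt.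
have [i ri] : exists i, row i (kermx A) != 0.
  apply/existsP; rewrite -negb_forall; apply: contra kn0 => /forallP H.
  by apply/eqP/row_matrixP => i; rewrite row0; apply/eqP; exact: H.
pose v := row i (kermx A).
have vA : v *m A = 0 by apply: sub_kermxP; exact: row_sub.
have : I (fun z => \sum_j v 0 j * g j z).
  apply: Ie (submod_sum sI (fun j => v 0 j) Ha); apply: filterE => z.
  under eq_bigr => j _ do rewrite mulrBr.
  rewrite sumrB [X in _ - X](_ : _ = 0) ?subr0 //.
  under eq_bigr => j _ do rewrite mulr_sumr.
  rewrite exchange_big /= big1 // => t _.
  under eq_bigr => j _ do rewrite mulrA.
  rewrite -mulr_suml; have := congr1 (fun M : 'rV_#|T| => M 0 (enum_rank t)) vA.
  rewrite !mxE => E; rewrite (eq_bigr (fun j => v 0 j * A j (enum_rank t))) ?E ?mul0r //.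
  by move=> j _; rewrite [A _ _]mxE enum_rankK.
move=> /ig v0; move: ri; apply/negP; rewrite negbK; apply/eqP/rowP => j.
by rewrite [RHS]mxE; exact: v0.
Qed.

Lemma basis_dim (T : finType) (h : T -> V -> C) : submod I -> indep I h -> spans I h ->
  dim_quotient I = (#|T|%:R)%:E.
Proof.
move=> sI ih sp; apply/eqP; rewrite eq_le (dim_ge sI ih) andbT.
apply: dim_le => n g ig; rewrite lee_fin ler_nat; exact: exchange sI sp ig.
Qed.

Lemma dim_case : submod I ->
  (exists n (h : 'I_n -> V -> C), indep I h /\ spans I h) \/
  (forall n, exists h : 'I_n -> V -> C, indep I h).
Proof.
move=> sI; have [I0 Ie Il] := sI.
have [|nb] := pselect (exists n (h : 'I_n -> V -> C), indep I h /\ spans I h); first by left.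
right; elim=> [|n [h ih]].
  by exists (fun i _ => 0); split=> [[]//|c _ []//].
have [u hu Hu] : exists2 u, holomorphic0 u & forall c : 'I_n -> C, ~ I (fun z => u z - \sum_i c i * h i z).
  apply: contrapT => H; apply: nb; exists n, h; split=> // u hu.
  by apply: contrapT => H'; apply: H; exists u => // c Hc; apply: H'; exists c.
have [hh Hh] := ih.
pose g (i : 'I_n.+1) := if unlift ord0 i is Some j then h j else u.
exists g; split=> [i|c Hc].
  by rewrite /g; case: unliftP.
have E z : \sum_i c i * g i z = c ord0 * u z + \sum_i c (lift ord0 i) * h i z.
  rewrite big_ord_recl /g unlift_none; congr (_ + _).
  by apply: eq_bigr => j _; rewrite liftK.
have c0 : c ord0 = 0.
  apply: contrapT => /eqP c0; apply: (Hu (fun i => - (c (lift ord0 i) / c ord0))).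
  apply: Ie (Il (c ord0)^-1 _ _ Hc I0); apply: filterE => z.
  rewrite E addr0 mulrDr mulKf // -sumrN; congr (_ + _); rewrite mulr_sumr.
  by apply: eq_bigr => j _; rewrite mulNr opprK mulrA [_^-1 * _]mulrC.
have cl : forall j, c (lift ord0 j) = 0.
  apply: Hh; apply: Ie Hc; apply: filterE => z; by rewrite E c0 mul0r add0r.
by move=> i; case: (unliftP ord0 i) => [j ->|->].
Qed.

Lemma dim_infty : submod I -> (forall n, exists h : 'I_n -> V -> C, indep I h) ->
  dim_quotient I = +oo%E.
Proof.
move=> sI H; apply/eqyP => r r0.
have [h ih] := H (Num.bound r); apply: le_trans (dim_ge sI ih).
by rewrite card_ord lee_fin ltW // archi_boundP // ltW.
Qed.

End OneSpace.

Lemma dim_mono (V W : normedModType C) (I : set (V -> C)) (J : set (W -> C)) :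
  submod J ->
  (forall n (h : 'I_n -> V -> C), indep I h -> exists g : 'I_n -> W -> C, indep J g) ->
  (dim_quotient I <= dim_quotient J)%E.
Proof.
move=> sJ H; apply: dim_le => n h /H[g /(dim_ge sJ)].
by rewrite card_ord.
Qed.

Lemma dim_ext (V : normedModType C) (I J : set (V -> C)) : submod I -> submod J ->
  (forall u, holomorphic0 u -> I u <-> J u) -> dim_quotient I = dim_quotient J.
Proof.
move=> sI sJ H; apply/eqP; rewrite eq_le; apply/andP.
have hs n (h : 'I_n -> V -> C) c : (forall i, holomorphic0 (h i)) ->
    holomorphic0 (fun z => \sum_i c i * h i z).
  by move=> hh; apply: holo_sum => i; apply: holoM => //; exact: holo_cst.
by split; apply: dim_mono => // n h [hh Hh]; exists h; split=> // c /H Hc; apply: Hh; apply: Hc; exact: hs.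
Qed.

(** Composition with [d] induces a map of quotients; the last two conditions are its injectivity,
    with well-definedness, and its surjectivity. *)
Lemma dim_pullback (V W : normedModType C) (I : set (V -> C)) (J : set (W -> C)) (d : W -> V) :
  submod I -> submod J -> holomorphic0 d -> d 0 = 0 ->
  (forall u, holomorphic0 u -> I u <-> J (fun z => u (d z))) ->
  (forall w, holomorphic0 w -> exists2 u, holomorphic0 u & J (fun z => w z - u (d z))) ->
  dim_quotient I = dim_quotient J.
Proof.
move=> sI sJ hd d0 H1 H2; apply/eqP; rewrite eq_le; apply/andP.
have hs n (h : 'I_n -> V -> C) c : (forall i, holomorphic0 (h i)) ->
    holomorphic0 (fun z => \sum_i c i * h i z).
  by move=> hh; apply: holo_sum => i; apply: holoM => //; exact: holo_cst.
have [J0 Je Jl] := sJ.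
split; apply: dim_mono => // n h [hh Hh].
  exists (fun i z => h i (d z)); split=> [i|c Hc]; first exact: holo_comp.
  by apply: Hh; apply/H1; [exact: hs|exact: Hc].
have Hu i : exists u, holomorphic0 u /\ J (fun z => h i z - u (d z)).
  by have [u hu Hu] := H2 _ (hh i); exists u.
have [g Hg] := choice Hu.
exists g; split=> [i|c Hc]; first by have [] := Hg i.
apply: Hh; have {}Hc : J (fun z => \sum_i c i * g i (d z)).
  by apply/(H1 (fun z => \sum_i c i * g i z)) => //; apply: hs => i; have [] := Hg i.
have S := submod_sum sJ c (fun i => proj2 (Hg i)).
apply: Je (Jl 1 _ _ S Hc); apply: filterE => z.
by rewrite mul1r -big_split /=; apply: eq_bigr => i _; rewrite -mulrDr subrK.
Qed.

(* Additivity of dimensions along 0 -> O/K -> O/I -> O/J -> 0, the first map being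
   multiplication by [f]. *)
Lemma dim_exact (V : normedModType C) (I J K : set (V -> C)) (f : V -> C) :
  submod I -> submod J -> submod K -> holomorphic0 f ->
  (forall u, I u -> J u) ->
  (forall v, holomorphic0 v -> J (fun z => f z * v z)) ->
  (forall v, holomorphic0 v -> I (fun z => f z * v z) <-> K v) ->
  (forall u, holomorphic0 u -> J u -> exists2 v, holomorphic0 v & I (fun z => u z - f z * v z)) ->
  dim_quotient I = (dim_quotient J + dim_quotient K)%E.
Proof.
move=> sI sJ sK hf IJ Jf IK IJf.
have hs (T : finType) (h : T -> V -> C) c : (forall i, holomorphic0 (h i)) ->
    holomorphic0 (fun z => \sum_i c i * h i z).
  by move=> hh; apply: holo_sum => i; apply: holoM => //; exact: holo_cst.
have [_ Ie Il] := sI; have [_ Je Jl] := sJ; have [_ Ke Kl] := sK.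
have leJ : (dim_quotient J <= dim_quotient I)%E.
  by apply: dim_mono => // n h [hh Hh]; exists h; split=> // c /IJ; exact: Hh.
have mulE (T : finType) (c : T -> C) (h : T -> V -> C) z :
    f z * (\sum_i c i * h i z) = \sum_i c i * (f z * h i z).
  by rewrite mulr_sumr; apply: eq_bigr => i _; rewrite mulrCA.
have leK : (dim_quotient K <= dim_quotient I)%E.
  apply: dim_mono => // n h [hh Hh]; exists (fun i z => f z * h i z).
  split=> [i|c Hc]; first exact: holoM.
  apply: Hh; apply/IK; first exact: hs.
  by apply: Ie Hc; apply: filterE => z; rewrite mulE.
have [[m [h [ih sh]]]|iJ] := dim_case sJ; last first.
  have E := dim_infty sJ iJ; rewrite E in leJ *.
  move: leJ; rewrite leye_eq => /eqP->; rewrite addye //.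
  by rewrite gt_eqF // (lt_le_trans _ (dim_ge0 K)).
have [[k [g [ig sg]]]|iK] := dim_case sK; last first.
  have E := dim_infty sK iK; rewrite E in leK *.
  move: leK; rewrite leye_eq => /eqP->; rewrite addey //.
  by rewrite gt_eqF // (lt_le_trans _ (dim_ge0 J)).
rewrite (basis_dim sJ ih sh) (basis_dim sK ig sg).
pose b (t : 'I_m + 'I_k) := match t with inl i => h i | inr j => fun z => f z * g j z end.
have bE c z : \sum_t c t * b t z =
   \sum_i c (inl i) * h i z + f z * \sum_j c (inr j) * g j z.
  by rewrite big_sumType /= mulE.
have [hh Hh] := ih; have [hg Hg] := ig.
rewrite (@basis_dim V I ('I_m + 'I_k)%type b) //.
- by rewrite card_sum !card_ord natrD EFinD.
- split=> [[i|j]|c Hc] /=; [exact: hh|exact: holoM|].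
  have cl : forall i, c (inl i) = 0.
    apply: (Hh (fun i => c (inl i))).
    have /(Jf _) JF : holomorphic0 (fun z => \sum_j c (inr j) * g j z) by exact: hs.
    apply: Je (Jl (-1) _ _ JF (IJ _ Hc)); apply: filterE => z.
    by rewrite bE mulN1r addrC addrK.
  have cr : forall j, c (inr j) = 0.
    apply: (Hg (fun j => c (inr j))); apply/IK; first exact: hs.
    apply: Ie Hc; apply: filterE => z; rewrite bE big1 ?add0r // => i _.
    by rewrite cl mul0r.
  by case.
- move=> u hu; have [c Hc] := sh u hu.
  have hu' : holomorphic0 (fun z => u z - \sum_i c i * h i z).
    by apply: holoB => //; exact: hs.
  have [v hv Hv] := IJf _ hu' Hc; have [d Hd] := sg v hv.
  exists (fun t => match t with inl i => c i | inr j => d j end).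
  have hv' : holomorphic0 (fun z => v z - \sum_i d i * g i z).
    by apply: holoB => //; exact: hs.
  have Hd' := proj2 (IK _ hv') Hd.
  apply: Ie (Il 1 _ _ Hv Hd'); apply: filterE => z.
  by rewrite bE; ring.
Qed.

Lemma submod_ideal1 (V : normedModType C) (f : V -> C) : submod (ideal1 f).
Proof.
split.
- by exists (fun=> 0); [exact: holo_cst|apply: filterE => z; rewrite mul0r].
- move=> u v uv [a ha E]; exists a => //.
  by apply: filterS2 uv E => z <-.
- move=> c u v [a ha Ea] [b hb Eb]; exists (fun z => c * a z + b z).
    by apply: holoD => //; apply: holoM => //; exact: holo_cst.
  by apply: filterS2 Ea Eb => z -> ->; rewrite mulrDl mulrA.
Qed.

Lemma submod_ideal2 (V : normedModType C) (f g : V -> C) : submod (ideal2 f g).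
Proof.
split.
- exists (fun=> 0), (fun=> 0); split; [exact: holo_cst|exact: holo_cst|].
  by apply: filterE => z; rewrite !mul0r addr0.
- move=> u v uv [a [b [ha hb E]]]; exists a, b; split => //.
  by apply: filterS2 uv E => z <-.
- move=> c u v [a [b [ha hb Ea]]] [a' [b' [ha' hb' Eb]]].
  exists (fun z => c * a z + a' z), (fun z => c * b z + b' z); split.
  + by apply: holoD => //; apply: holoM => //; exact: holo_cst.
  + by apply: holoD => //; apply: holoM => //; exact: holo_cst.
  + by apply: filterS2 Ea Eb => z -> ->; ring.
Qed.

End Dimension.

(** * Orders and intersection numbers *)

Section Order.
Variable R : realType.
Local Notation ord0 := (@Defs.ord0 R).
Local Notation C := (Cplx R).
Local Notation nrm := (@nrm R).

Lemma germ_sym (V : normedModType C) (f g : V -> C) : germ_eq f g -> germ_eq g f.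
Proof. by apply: filterS. Qed.

Lemma germ_trans (V : normedModType C) (f g h : V -> C) :
  germ_eq f g -> germ_eq g h -> germ_eq f h.
Proof. by apply: filterS2 => z ->. Qed.

Lemma germ_refl (V : normedModType C) (f g : V -> C) : f =1 g -> germ_eq f g.
Proof. by move=> fg; apply: filterE. Qed.

Lemma near_neq0 (V : normedModType C) (u : V -> C) : holomorphic0 u -> u 0 != 0 ->
  \forall z \near (0 : V), u z != 0.
Proof.
move=> /holo_cont cu u0.
have H : \forall w \near u 0, w != 0.
  apply/near0C; exists (nrm (u 0)); first by rewrite nrm_gt0.
  move=> w wu; apply/eqP => w0; move: wu; rewrite w0 sub0r nrmN ltxx.
  by [].
exact: cu H.
Qed.

Lemma holoV (V : normedModType C) (u : V -> C) : holomorphic0 u -> u 0 != 0 ->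
  holomorphic0 (fun z => (u z)^-1).
Proof. by move=> hu /(near_neq0 hu); apply: filterS2 hu => z du u0; exact: differentiableV. Qed.

Lemma dense1 (f : C -> C) : holomorphic0 f -> (\forall z \near (0 : C), z != 0 -> f z = 0) ->
  germ_eq f (fun=> 0).
Proof.
move=> hf H; have h1 : holomorphic0 (fun p : C * C => f p.1) := holo_comp hf (@holo_fst R) erefl.
have := dense_x h1 (near_comp (@holo_fst R) erefl H).
exact: near_comp (@holo_inl R) erefl.
Qed.

Lemma dim_full (V : normedModType C) (I : set (V -> C)) : submod I ->
  (forall u, holomorphic0 u -> I u) -> dim_quotient I = 0%E.
Proof.
move=> sI H; rewrite (@basis_dim R V I void (fun v => match v with end)) //.
- by rewrite card_void.
- move=> u hu; exists (fun=> 0); have [_ Ie _] := sI.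
  by apply: Ie (H u hu); apply: filterE => z; rewrite big1 ?subr0 // => i; case: i.
Qed.

Lemma dim_subset (V : normedModType C) (I J : set (V -> C)) : submod I ->
  (forall u, I u -> J u) -> (dim_quotient J <= dim_quotient I)%E.
Proof.
by move=> sI IJ; apply: dim_mono => // n h [hh Hh]; exists h; split=> // c /IJ; exact: Hh.
Qed.

Lemma ideal1_ext (V : normedModType C) (f g u : V -> C) : germ_eq f g ->
  ideal1 f u -> ideal1 g u.
Proof. by move=> fg [a ha E]; exists a => //; apply: filterS2 fg E => z ->. Qed.

Lemma dim1_ext (V : normedModType C) (f g : V -> C) : germ_eq f g ->
  dim_quotient (ideal1 f) = dim_quotient (ideal1 g).
Proof.
move=> fg; apply: dim_ext; [exact: submod_ideal1|exact: submod_ideal1|].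
by move=> u _; split; apply: ideal1_ext => //; exact: germ_sym.
Qed.

Lemma ord_ext (f g : C -> C) : germ_eq f g -> ord0 f = ord0 g.
Proof. exact: dim1_ext. Qed.

Lemma ord_unit (u : C -> C) : holomorphic0 u -> u 0 != 0 -> ord0 u = 0%E.
Proof.
move=> hu u0; apply: dim_full; first exact: submod_ideal1.
move=> v hv; exists (fun z => v z / u z); first by apply: holoM => //; exact: holoV.
by apply: filterS (near_neq0 hu u0) => z uz; rewrite divfK.
Qed.

Lemma ord_one : ord0 (fun=> 1) = 0%E.
Proof. by apply: ord_unit; [exact: holo_cst|exact: oner_neq0]. Qed.

Lemma ord_var : ord0 (fun z : C => z) = 1%:E.
Proof.
have S (c : unit -> C) : \sum_i c i * 1 = c tt.
  by rewrite (bigD1 tt) //= big1 ?addr0 ?mulr1 // => -[].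
rewrite /Defs.ord0 (@basis_dim R _ _ unit (fun _ _ => 1)).
- by rewrite card_unit.
- exact: submod_ideal1.
- split=> [_|c [a _ /nbhs_singleton]]; first exact: holo_cst.
  by rewrite mulr0 S => c0 [].
- move=> u hu; have [g hg E] := hadamard1 hu; exists (fun=> u 0); exists g => //.
  by apply: filterE => z; rewrite S {1}E addrC addKr mulrC.
Qed.

(* [f] is not a zero divisor in the ring of germs. *)
Definition nzd (V : normedModType C) (f : V -> C) :=
  forall w : V -> C, holomorphic0 w -> germ_eq (fun z => f z * w z) (fun=> 0) ->
    germ_eq w (fun=> 0).

Lemma ord_mul_nzd (f g : C -> C) : holomorphic0 f -> holomorphic0 g -> nzd f ->
  ord0 (fun z => f z * g z) = (ord0 f + ord0 g)%E.
Proof.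
move=> hf hg nf; apply: (@dim_exact R _ _ _ _ f); try exact: submod_ideal1; try done.
- move=> u [a ha E]; exists (fun z => a z * g z); first exact: holoM.
  by apply: filterS E => z ->; rewrite mulrAC mulrA.
- by move=> v hv; exists v => //; apply: filterE => z; rewrite mulrC.
- move=> v hv; split=> [[a ha E]|[a ha E]]; exists a => //.
    have := nf (fun z => v z - a z * g z); have hd : holomorphic0 (fun z => v z - a z * g z).
      by apply: holoB => //; exact: holoM.
    move=> /(_ hd) H; have {}H := H ltac:(apply: filterS E => z E; rewrite mulrBr E; ring).
    by apply: filterS H => z /subr0_eq.
  by apply: filterS E => z ->; ring.
- move=> u hu [a ha E]; exists a => //; exists (fun=> 0); first exact: holo_cst.
  by apply: filterS E => z ->; ring.
Qed.

Lemma nzd_pow k : nzd (fun z : C => z ^+ k).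
Proof.
move=> w hw H; apply: dense1 => //; apply: filterS H => z E z0.
by move/eqP: E; rewrite mulf_eq0 (negPf (expf_neq0 k z0)) => /eqP.
Qed.

Lemma holo_pow k : holomorphic0 (fun z : C => z ^+ k).
Proof. by apply: holoX; exact: holo_id. Qed.

Lemma ord_pow k : ord0 (fun z : C => z ^+ k) = (k%:R)%:E.
Proof.
elim: k => [|k IH].
  by rewrite (ord_ext (g := fun=> 1)) ?ord_one //; apply: germ_refl.
rewrite (ord_ext (g := fun z => z ^+ 1 * z ^+ k)); last first.
  by apply: germ_refl => z; rewrite exprS expr1.
rewrite ord_mul_nzd ?IH; try exact: holo_pow; last exact: nzd_pow.
by rewrite (ord_ext (g := fun z => z)) ?ord_var -?EFinD ?nat1r //; apply: germ_refl => z.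
Qed.

Lemma ord_form (f : C -> C) k : ordform f k -> ord0 f = (k%:R)%:E.
Proof.
move=> [u [hu u0 E]]; rewrite (ord_ext E) ord_mul_nzd ?ord_pow ?ord_unit ?adde0 //.
  exact: holo_pow.
exact: nzd_pow.
Qed.

Lemma ord_zero (f : C -> C) : germ_eq f (fun=> 0) -> ord0 f = +oo%E.
Proof.
move=> /ord_ext->; apply/eqyP => r r0.
apply: le_trans (_ : (((Num.bound r)%:R)%:E <= _)%E).
  by rewrite lee_fin ltW // archi_boundP // ltW.
rewrite -ord_pow; apply: dim_subset; first exact: submod_ideal1.
move=> u [a ha E]; exists (fun=> 0); first exact: holo_cst.
by apply: filterS E => z ->; rewrite mulr0 mul0r.
Qed.

Lemma ordP (f : C -> C) : holomorphic0 f ->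
  (exists k, ordform f k /\ ord0 f = (k%:R)%:E) \/ (germ_eq f (fun=> 0) /\ ord0 f = +oo%E).
Proof.
move=> hf; have [f0|[k fk]] := order_dichotomy hf; [right|left].
  by split=> //; exact: ord_zero.
by exists k; split=> //; exact: ord_form.
Qed.

Lemma ord_ge0 (f : C -> C) : (0 <= ord0 f)%E.
Proof. exact: dim_ge0. Qed.

Lemma ordform_mul (f g : C -> C) k l : ordform f k -> ordform g l ->
  ordform (fun z => f z * g z) (k + l).
Proof.
move=> [u [hu u0 E]] [v [hv v0 E']]; exists (fun z => u z * v z); split.
- exact: holoM.
- by rewrite mulf_neq0.
- by apply: filterS2 E E' => z -> ->; rewrite exprD mulrACA.
Qed.

Lemma ordM (f g : C -> C) : holomorphic0 f -> holomorphic0 g ->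
  ord0 (fun z => f z * g z) = (ord0 f + ord0 g)%E.
Proof.
move=> hf hg; have [[k [fk ->]]|[f0 ->]] := ordP hf.
  have [[l [gl ->]]|[g0 ->]] := ordP hg.
    by rewrite (ord_form (ordform_mul fk gl)) natrD EFinD.
  by rewrite ord_zero ?addey //; apply: filterS g0 => z ->; rewrite mulr0.
rewrite ord_zero ?addye //; last by apply: filterS f0 => z ->; rewrite mul0r.
by rewrite gt_eqF // (lt_le_trans _ (ord_ge0 g)).
Qed.

Lemma ordX (f : C -> C) n : holomorphic0 f ->
  ord0 (fun z => f z ^+ n) = ((n%:R)%:E * ord0 f)%E.
Proof.
move=> hf; elim: n => [|n IH].
  by rewrite mul0e (ord_ext (g := fun=> 1)) ?ord_one //; apply: germ_refl.
rewrite (ord_ext (g := fun z => f z * f z ^+ n)); last by apply: germ_refl => z; rewrite exprS.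
rewrite ordM ?IH //; last exact: holoX.
by rewrite -nat1r EFinD ge0_muleDl ?mul1e // lee_fin.
Qed.

Lemma ordform0 (f : C -> C) k : ordform f k -> f 0 = 0 -> (0 < k)%N.
Proof.
move=> [u [hu u0 /nbhs_singleton E]] f0; case: k E => // .
by rewrite f0 expr0 mul1r => E; rewrite -E eqxx in u0.
Qed.

Lemma ord_comp (f t : C -> C) N : holomorphic0 f -> holomorphic0 t -> ordform t N -> (0 < N)%N ->
  ord0 (fun z => f (t z)) = ((N%:R)%:E * ord0 f)%E.
Proof.
move=> hf ht tN N0; have t0 : t 0 = 0.
  by have [v [_ _ /nbhs_singleton->]] := tN; rewrite expr0n gtn_eqF // mul0r.
have [[k [[u [hu u0 E]] ->]]|[f0 ->]] := ordP hf; last first.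
  rewrite ord_zero; last exact: near_comp ht t0 f0.
  by rewrite gt0_muley // lte_fin ltr0n.
have [v [hv v0 Ev]] := tN.
rewrite (ord_form (k := (N * k)%N)); first by rewrite natrM EFinM.
exists (fun z => v z ^+ k * u (t z)); split.
- by apply: holoM; [exact: holoX|exact: holo_comp].
- by rewrite mulf_neq0 ?expf_neq0 // t0.
- apply: filterS2 (near_comp ht t0 E) Ev => z Ez vz.
  by rewrite Ez; move: (u (t z)) => w; rewrite vz exprMn -exprM mulrA.
Qed.

Lemma derive1_germ (f g : C -> C) : germ_eq f g -> holomorphic0 f ->
  germ_eq (f^`()%classic : C -> C) (g^`()%classic : C -> C).
Proof.
move=> /nbhs_interior fg hf; apply: filterS2 fg hf => z fg df.
have [dg dE] := differentiable_near fg df.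
rewrite (has_d_derive1 (has_dP2 df erefl)) (has_d_derive1 (has_dP2 dg erefl)).
exact: (esym (congr1 (fun l : C -> C => l 1) dE)).
Qed.

Lemma ordform_derive (f : C -> C) k : holomorphic0 f -> ordform f k.+1 ->
  ordform (f^`()%classic : C -> C) k.
Proof.
move=> hf [u [hu u0 E]]; have hu' := holo_derive1 hu.
exists (fun z => k.+1%:R * u z + z * (u^`()%classic : C -> C) z); split.
- apply: holoD; apply: holoM => //; [exact: holo_cst|exact: holo_id].
- by rewrite mul0r addr0 mulf_neq0 // pnatr_eq0.
- apply: filterS2 (derive1_germ E hf) (holo_has_d hu) => z -> du.
  rewrite (has_d_derive1 (has_dM (has_dX k.+1 (has_d_id z)) du)) /= exprS; ring.
Qed.

Lemma ord_derive (f : C -> C) : holomorphic0 f -> f 0 = 0 ->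
  ord0 f = (1 + ord0 (f^`()%classic : C -> C))%E.
Proof.
move=> hf f0; have [[[|k] [fk ->]]|[fz ->]] := ordP hf.
- by have := ordform0 fk f0.
- by rewrite (ord_form (ordform_derive hf fk)) -EFinD nat1r.
- rewrite ord_zero ?addey //.
  have := derive1_germ fz hf; apply: filterS => z ->.
  apply: has_d_derive1; apply/has_dP; split; [exact: differentiable_cst|exact: derive_cst].
Qed.

End Order.

(** * Intersection numbers *)

Section Intersection.
Variable R : realType.
Local Notation ord0 := (@Defs.ord0 R).
Local Notation C := (Cplx R).
Local Notation nrm := (@nrm R).
Local Notation mult := (@intersection_number R).

Lemma mult_sub (f g f' g' : C * C -> C) :
  (forall u, holomorphic0 u -> ideal2 f g u <-> ideal2 f' g' u) -> mult f g = mult f' g'.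
Proof. by move=> H; apply: dim_ext H; exact: submod_ideal2. Qed.

Lemma mult_sym (f g : C * C -> C) : mult f g = mult g f.
Proof.
apply: mult_sub => u _; split=> -[a [b [ha hb E]]]; exists b, a; split=> //;
by apply: filterS E => z ->; rewrite addrC.
Qed.

Lemma mult_ext (f g f' g' : C * C -> C) : germ_eq f f' -> germ_eq g g' ->
  mult f g = mult f' g'.
Proof.
move=> ff gg; apply: mult_sub => u _; split=> -[a [b [ha hb E]]]; exists a, b; split=> //.
  by apply: filterS2 (near_and ff gg) E => z [<- <-].
by apply: filterS2 (near_and ff gg) E => z [-> ->].
Qed.

Lemma mult_unitl (v f g : C * C -> C) : holomorphic0 v -> v 0 != 0 ->
  mult (fun p => v p * f p) g = mult f g.
Proof.
move=> hv v0; apply: mult_sub => u _; split=> -[a [b [ha hb E]]].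
  exists (fun p => a p * v p), b; split=> //; first exact: holoM.
  by apply: filterS E => p ->; rewrite mulrA.
exists (fun p => a p / v p), b; split=> //; first by apply: holoM => //; exact: holoV.
by apply: filterS2 (near_neq0 hv v0) E => p vp ->; congr (_ + _); field.
Qed.

Lemma mult_ge0 (f g : C * C -> C) : (0 <= mult f g)%E.
Proof. exact: dim_ge0. Qed.

Lemma mult_auto (s s' : C * C -> C * C) (f g : C * C -> C) :
  holomorphic0 s -> s 0 = 0 -> holomorphic0 s' -> s' 0 = 0 ->
  (\forall p \near (0 : C * C), s (s' p) = p) -> (\forall p \near (0 : C * C), s' (s p) = p) ->
  mult (fun p => f (s p)) (fun p => g (s p)) = mult f g.
Proof.
move=> hs s0 hs' s0' ss' s's; apply/esym.
apply: (@dim_pullback R _ _ (ideal2 f g) _ s) => //; try exact: submod_ideal2.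
- move=> u hu; split=> -[a [b [ha hb E]]].
    exists (fun p => a (s p)), (fun p => b (s p)); split; try exact: holo_comp.
    exact: near_comp hs s0 E.
  exists (fun p => a (s' p)), (fun p => b (s' p)); split; try exact: holo_comp.
  by apply: filterS2 ss' (near_comp hs' s0' E) => p ->.
- move=> w hw; exists (fun p => w (s' p)); first exact: holo_comp.
  have [I0 Ie _] := @submod_ideal2 R _ (fun p => f (s p)) (fun p => g (s p)).
  by apply: Ie I0; apply: filterS s's => p ->; rewrite subrr.
Qed.

(* [d] parametrises the curve germ of [f] and the pullback along [d] identifies
   the local ring of [f] with a subring of the local ring of the line. *)
Definition branch (f : C * C -> C) (d : C -> C * C) : Prop :=
  [/\ holomorphic0 f /\ holomorphic0 d, d 0 = 0, germ_eq (fun t => f (d t)) (fun=> 0), nzd f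
    & forall v : C * C -> C, holomorphic0 v -> germ_eq (fun t => v (d t)) (fun=> 0) -> ideal1 f v].

(** The exact sequence for multiplication by [f]. If [h] has finite order along the branch it is a
    nonzerodivisor modulo [f], since germs vanishing on the branch are multiples of [f]; otherwise
    both sides are infinite. *)
Lemma branch_mulM (f g h : C * C -> C) (d : C -> C * C) : branch f d -> holomorphic0 g -> holomorphic0 h ->
  mult f h = ord0 (fun t => h (d t)) ->
  mult (fun p => f p * g p) h = (mult f h + mult g h)%E.
Proof.
move=> [[hf hd] d0 fd0 nf bf] hg hh E.
have hhd : holomorphic0 (fun t => h (d t)) by exact: holo_comp.
have sub u : ideal2 (fun p => f p * g p) h u -> ideal2 f h u.
  move=> [a [b [ha hb Eu]]]; exists (fun p => a p * g p), b; split => //; first exact: holoM.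
  by apply: filterS Eu => p ->; ring.
have [[k [[v [hv v0 hk]] _]]|[h0 hoo]] := ordP hhd; last first.
  have : (mult f h <= mult (fun p => f p * g p)%R h)%E.
    by apply: dim_subset => //; exact: submod_ideal2.
  rewrite E hoo leye_eq => /eqP->; rewrite addye //.
  by rewrite gt_eqF // (lt_le_trans _ (mult_ge0 g h)).
apply: (@dim_exact R _ _ _ _ f); try exact: submod_ideal2; try done.
- move=> w hw; exists w, (fun=> 0); split=> //; first exact: holo_cst.
  by apply: filterE => p; ring.
- move=> w hw; split=> -[a [b [ha hb Ew]]].
    (* Restricting [f * w = a * f * g + b * h] to the branch kills the terms with [f], so [b]
       vanishes along it and is divisible by [f]. *)
    have bd0 : germ_eq (fun t => b (d t)) (fun=> 0).
      have hbd : holomorphic0 (fun t => b (d t)) by exact: holo_comp.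
      apply: dense1 => //.
      have H := near_comp hd d0 Ew; apply: filterS2 (near_and H hk) (near_and fd0 (near_neq0 hv v0)).
      move=> t [Ht ht] [ft vt] t0; move/eqP: Ht; rewrite ft mul0r !mul0r mulr0 add0r eq_sym mulf_eq0.
      by rewrite ht mulf_eq0 (negPf vt) (negPf (expf_neq0 k t0)) !orbF => /eqP.
    have [b' hb' Eb] := bf b hb bd0.
    exists a, b'; split=> //.
    have := nf (fun p => w p - (a p * g p + b' p * h p)).
    have hq : holomorphic0 (fun p => w p - (a p * g p + b' p * h p)).
      by apply: holoB => //; apply: holoD; exact: holoM.
    move=> /(_ hq) H; have {}H := H ltac:(apply: filterS2 Ew Eb => p e1 e2; rewrite mulrBr e1 e2; ring).
    by apply: filterS H => p /subr0_eq.
  exists a, (fun p => f p * b p); split=> //; first exact: holoM.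
  by apply: filterS Ew => p ->; ring.
- move=> u hu [a [b [ha hb Eu]]]; exists a => //.
  exists (fun=> 0), b; split=> //; first exact: holo_cst.
  by apply: filterS Eu => p ->; ring.
Qed.

(** When every germ in the parameter is a pullback, as on a smooth branch, the local ring of [f] is
    that of the line. *)
Lemma branch_mult (f h : C * C -> C) (d : C -> C * C) : branch f d -> holomorphic0 h ->
  (forall w : C -> C, holomorphic0 w -> exists2 u : C * C -> C, holomorphic0 u &
     germ_eq w (fun t => u (d t))) ->
  mult f h = ord0 (fun t => h (d t)).
Proof.
move=> [[hf hd] d0 fd0 nf bf] hh sur.
apply: (@dim_pullback R _ _ (ideal2 f h) (ideal1 (fun t => h (d t))) d) => //.
- exact: submod_ideal2.
- exact: submod_ideal1.
- move=> u hu; split=> [[a [b [ha hb Eu]]]|[a ha Eu]].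
    exists (fun t => b (d t)); first exact: holo_comp.
    apply: filterS2 (near_comp hd d0 Eu) fd0 => t -> ->; ring.
  have [b hb Eb] := sur a ha.
  have hq : holomorphic0 (fun p => u p - b p * h p) by apply: holoB => //; exact: holoM.
  have [|c hc Ec] := bf _ hq.
    by apply: filterS2 Eu Eb => t -> ->; rewrite subrr.
  exists c, b; split=> //; apply: filterS Ec => p <-; ring.
- move=> w hw; have [u hu E] := sur w hw; exists u => //.
  have [I0 Ie _] := @submod_ideal1 R _ (fun t => h (d t)).
  by apply: Ie I0; apply: filterS E => t ->; rewrite subrr.
Qed.

Definition graph_map (a : C -> C) (t : C) : C * C := (t, a t).

Lemma holo_graph (a : C -> C) : holomorphic0 a -> holomorphic0 (graph_map a).
Proof. by move=> ha; apply: holo_pair => //; exact: holo_id. Qed.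

Lemma holo_shear (a : C -> C) : holomorphic0 a -> holomorphic0 (fun p : C * C => (p.1, p.2 + a p.1)).
Proof.
move=> ha; apply: holo_pair; first exact: holo_fst.
by apply: holoD; [exact: holo_snd|exact: holo_comp ha (@holo_fst R) erefl].
Qed.

Lemma holo_lin (a : C -> C) : holomorphic0 a -> holomorphic0 (fun p : C * C => p.2 - a p.1).
Proof.
by move=> ha; apply: holoB; [exact: holo_snd|exact: holo_comp ha (@holo_fst R) erefl].
Qed.

(** A shear moves the graph to the axis [y = 0], where Hadamard division applies. The equation is a
    nonzerodivisor since points of the graph are limits of points off it. *)
Lemma branch_graph (a : C -> C) : holomorphic0 a -> a 0 = 0 ->
  branch (fun p => p.2 - a p.1) (graph_map a).
Proof.
move=> ha a0; split=> [|||w hw H|v hv H].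
- by split; [exact: holo_lin|exact: holo_graph].
- by rewrite /graph_map a0.
- by apply: germ_refl => t; rewrite /= subrr.
- have /near0CC[d d0 Hd] := near_and hw H.
  apply/near0CC; exists d => // x y; rewrite !subr0 => xd yd.
  have [dw] := Hd x y ltac:(by rewrite subr0) ltac:(by rewrite subr0).
  move/eqP; rewrite mulf_eq0 subr_eq0 /= => /orP[/eqP ya|/eqP//].
  apply: (zero_closure dw) => d' d'0.
  have [h h0 hd] := @small_point R (Num.min d' (d - nrm y)) ltac:(by rewrite lt_min d'0 subr_gt0).
  move: hd; rewrite lt_min => /andP[hd1 hd2].
  exists x, (y + h); rewrite subrr nrm0 [y + h - _]addrC addKr; split=> //.
  have [_] := Hd x (y + h) ltac:(by rewrite subr0) ltac:(rewrite subr0; have := nrmD y h; lra).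
  by move/eqP; rewrite mulf_eq0 /= ya [a x + h]addrC addrK (negPf h0) => /eqP.
- have hs := holo_shear ha.
  have s0 : (fun p : C * C => (p.1, p.2 + a p.1)) 0 = 0 by rewrite /= a0 addr0.
  have hV := holo_comp hv hs s0.
  have [G [hG EG _]] := hadamard hV.
  have hs' := holo_shear (holoN ha).
  have s0' : (fun p : C * C => (p.1, p.2 + - a p.1)) 0 = 0 by rewrite /= a0 subr0.
  exists (fun p => G (p.1, p.2 + - a p.1)); first exact: holo_comp hG hs' s0'.
  apply: filterS (near_comp (@holo_fst R) erefl H) => -[x y] /= Hx.
  have := EG x (y - a x); rewrite /= subrK add0r => ->.
  by move: Hx; rewrite /graph_map /= => ->; rewrite add0r mulrC.
Qed.

Lemma mult_graph (a : C -> C) (h : C * C -> C) : holomorphic0 a -> a 0 = 0 -> holomorphic0 h ->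
  mult (fun p => p.2 - a p.1) h = ord0 (fun t => h (t, a t)).
Proof.
move=> ha a0 hh; apply: (branch_mult (branch_graph ha a0)) => // w hw.
exists (fun p => w p.1); last exact: germ_refl.
exact: holo_comp hw (@holo_fst R) erefl.
Qed.

Lemma branch_axis : branch (fun p : C * C => p.1) (fun t => (0, t)).
Proof.
split=> [|||w hw H|v hv H].
- by split; [exact: holo_fst|exact: holo_inr].
- by [].
- exact: germ_refl.
- apply: dense_x => //; apply: filterS H => p E p0.
  by move/eqP: E; rewrite mulf_eq0 (negPf p0) => /eqP.
- have [G hG EG] := hadamardx hv; exists G => //.
  apply: filterS (near_comp (@holo_snd R) erefl H) => -[x y] /= Hy.
  by rewrite EG Hy add0r mulrC.
Qed.

Lemma mult_axis (h : C * C -> C) : holomorphic0 h ->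
  mult (fun p : C * C => p.1) h = ord0 (fun t => h (0, t)).
Proof.
move=> hh; apply: (branch_mult branch_axis) => // w hw.
exists (fun p => w p.2); last exact: germ_refl.
exact: holo_comp hw (@holo_snd R) erefl.
Qed.

Definition ram (e : nat) (p : C * C) : C * C := (p.1 ^+ e, p.2).

Lemma holo_ram e : holomorphic0 (ram e).
Proof. by apply: holo_pair; [apply: holoX; exact: holo_fst|exact: holo_snd]. Qed.

Lemma ram0 e : (0 < e)%N -> ram e 0 = 0.
Proof. by move=> e0; rewrite /ram /= expr0n gtn_eqF. Qed.

(** Germs form a free module with basis [x ^ i], [i < e], over germs in [x ^ e] and [y]; so a basis
    [g] of the quotient downstairs gives the basis [x ^ i * g j (x ^ e, y)] upstairs. *)
Lemma mult_ram e (f h : C * C -> C) : (0 < e)%N -> holomorphic0 f -> holomorphic0 h ->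
  mult (fun p => f (ram e p)) (fun p => h (ram e p)) = ((e%:R)%:E * mult f h)%E.
Proof.
move=> e0 hf hh; have [om om_p] := @prim_root_exists R e e0.
have hr u : holomorphic0 u -> holomorphic0 (fun p => u (ram e p)).
  by move=> hu; exact: holo_comp hu (holo_ram e) (ram0 e0).
have sI := @submod_ideal2 R _ f h.
have sJ := @submod_ideal2 R _ (fun p => f (ram e p)) (fun p => h (ram e p)).
pose b m (g : 'I_m -> C * C -> C) (t : 'I_e * 'I_m) p := p.1 ^+ t.1 * g t.2 (ram e p).
have bE m (g : 'I_m -> C * C -> C) c p :
    \sum_t c t * b m g t p = \sum_(i < e) p.1 ^+ i * \sum_j c (i, j) * g j (ram e p).
  rewrite (eq_bigr (fun t : 'I_e * 'I_m => c (t.1, t.2) * (p.1 ^+ t.1 * g t.2 (ram e p)))); last by case.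
  rewrite -(pair_bigA _ (fun i j => c (i, j) * (p.1 ^+ i * g j (ram e p)))) /=.
  by apply: eq_bigr => i _; rewrite mulr_sumr; apply: eq_bigr => j _; rewrite mulrCA.
have hb m (g : 'I_m -> C * C -> C) t : (forall i, holomorphic0 (g i)) -> holomorphic0 (b m g t).
  by move=> hg; apply: holoM; [apply: holoX; exact: holo_fst|exact: hr].
have hs m (g : 'I_m -> C * C -> C) c : (forall i, holomorphic0 (g i)) ->
    holomorphic0 (fun z => \sum_i c i * g i z).
  by move=> hg; apply: holo_sum => i; apply: holoM => //; exact: holo_cst.
have ib m (g : 'I_m -> C * C -> C) : indep (ideal2 f h) g ->
    indep (ideal2 (fun p => f (ram e p)) (fun p => h (ram e p))) (b m g).
  move=> [hg ig]; split=> [t|c [A [B [hA hB E]]]]; first exact: hb.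
  have [a [ha Ea]] := ramified_decomposition e0 om_p hA.
  have [a' [ha' Ea']] := ramified_decomposition e0 om_p hB.
  have hq i : holomorphic0 (fun p => \sum_j c (i, j) * g j p - (a i p * f p + a' i p * h p)).
    by apply: holoB; [exact: hs|apply: holoD; exact: holoM].
  have := ramified_unique e0 om_p hq => H.
  have {}H : forall i, germ_eq (fun p => \sum_j c (i, j) * g j p - (a i p * f p + a' i p * h p)) (fun=> 0).
    apply: H; apply: filterS2 (near_and Ea Ea') E => p [E1 E2] E3.
    under eq_bigr => i _ do rewrite mulrBr mulrDr.
    rewrite sumrB -bE E3 E1 E2 big_split /= !mulr_suml; apply/eqP; rewrite subr_eq0; apply/eqP.
    by congr (_ + _); apply: eq_bigr => i _; rewrite mulrA.
  case=> i j; apply: (ig (fun j => c (i, j))); exists (a i), (a' i); split=> //.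
  by apply: filterS (H i) => p /subr0_eq.
have [[m [g [ig sg]]]|inf] := dim_case sI; last first.
  rewrite /intersection_number (dim_infty sI inf) gt0_muley ?lte_fin ?ltr0n //.
  apply/eqyP => r r0; have [g ig] := inf (Num.bound r).
  apply: le_trans (dim_ge sJ (ib _ _ ig)); rewrite lee_fin ltW //.
  rewrite (lt_le_trans (archi_boundP (ltW r0))) // ler_nat card_prod !card_ord.
  by rewrite leq_pmull.
rewrite /intersection_number (basis_dim sI ig sg) (basis_dim sJ (ib _ _ ig)).
  by rewrite card_prod !card_ord -EFinM natrM.
move=> u hu; have [q [hq Eq_u]] := ramified_decomposition e0 om_p hu.
have [c Hc] := choice (fun i => sg (q i) (hq i)).
exists (fun t => c t.1 t.2).
have [A HA] := choice Hc; have [B HB] := choice HA.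
have [_ Je _] := sJ.
exists (fun p => \sum_(i < e) p.1 ^+ i * A i (ram e p)), (fun p => \sum_(i < e) p.1 ^+ i * B i (ram e p)).
split.
- apply: holo_sum => i; apply: holoM; first by apply: holoX; exact: holo_fst.
  by apply: hr; have [] := HB i.
- apply: holo_sum => i; apply: holoM; first by apply: holoX; exact: holo_fst.
  by apply: hr; have [] := HB i.
have HE : \forall p \near (0 : C * C), forall i, q i (ram e p) - \sum_j c i j * g j (ram e p)
     = A i (ram e p) * f (ram e p) + B i (ram e p) * h (ram e p).
  apply: near_forall => i; have [_ _ E] := HB i.
  exact: near_comp (holo_ram e) (ram0 e0) E.
apply: filterS2 Eq_u HE => p E1 E2.
rewrite bE E1 -sumrB !mulr_suml -big_split /=; apply: eq_bigr => i _.
by rewrite -mulrBr E2; ring.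
Qed.

End Intersection.

(** * Irreducible branches *)

Section Branches.
Variable R : realType.
Local Notation ord0 := (@Defs.ord0 R).
Local Notation C := (Cplx R).
Local Notation mult := (@intersection_number R).

Lemma has_d_ext (f g : C -> C) z l : f =1 g -> has_d f z l -> has_d g z l.
Proof. by move=> fg H e /H[d d0 Hd]; exists d => // h hd; rewrite -!fg; exact: Hd. Qed.

Lemma has_d_cst (c z : C) : has_d (fun _ : C => c) z 0.
Proof. by apply/has_dP; split; [exact: differentiable_cst|exact: derive_cst]. Qed.

Lemma dy_slice0 (F : C * C -> C) l : holomorphic0 F -> has_d (fun t => F (0, t)) 0 l -> dy F 0 = l.
Proof. by move=> hF H; apply: (has_d_unique (slice_y (nbhs_singleton hF)) H). Qed.

Lemma holo_root e (u : C -> C) : (0 < e)%N -> holomorphic0 u -> u 0 != 0 ->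
  exists v : C -> C, [/\ holomorphic0 v, v 0 != 0 & germ_eq (fun t => v t ^+ e) u].
Proof.
move=> e0 hu u0; pose c := rt e (u 0); have ce : c ^+ e = u 0 by exact: rtK.
have c0 : c != 0 by apply: contraNneq u0 => c0; rewrite -ce c0 expr0n gtn_eqF.
pose F (p : C * C) : C := (c + p.2) ^+ e - u p.1.
have hF : holomorphic0 F.
  apply: holoB; last exact: holo_comp hu (@holo_fst R) erefl.
  by apply: holoX; apply: holoD; [exact: holo_cst|exact: holo_snd].
have [||b [hb b0 Hb]] := ift hF.
- by rewrite /F /= addr0 ce subrr.
- rewrite (@dy_slice0 _ (e%:R * c ^+ e.-1)) //.
    by rewrite mulf_neq0 ?expf_neq0 // pnatr_eq0 -lt0n.
  have h1 := has_dX e (has_dD (has_d_cst c 0) (has_d_id (0 : C))).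
  have := has_dD h1 (has_d_cst (- u 0) 0).
  by rewrite !addr0 add0r mulr1; apply: has_d_ext.
exists (fun t => c + b t); split.
- by apply: holoD => //; exact: holo_cst.
- by rewrite b0 addr0.
- by apply: filterS Hb => t /subr0_eq.
Qed.

(** Inverts [z * v z]. With [v ^ e] the unit factor of a coordinate [x = t ^ e * u t], the new
    parameter [s = t * v t] satisfies [x = s ^ e]. *)
Lemma holo_inverse (v : C -> C) : holomorphic0 v -> v 0 != 0 ->
  exists t : C -> C, [/\ holomorphic0 t, t 0 = 0, ordform t 1 & germ_eq (fun s => t s * v (t s)) (fun s => s)].
Proof.
move=> hv v0; pose F (p : C * C) : C := p.2 * v p.2 - p.1.
have hF : holomorphic0 F.
  apply: holoB; last exact: holo_fst.
  by apply: holoM; [exact: holo_snd|exact: holo_comp hv (@holo_snd R) erefl].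
have [||t [ht t0 Ht]] := ift hF.
- by rewrite /F /= mul0r subrr.
- rewrite (@dy_slice0 _ (v 0)) //.
  have h1 := has_dM (has_d_id (0 : C)) (nbhs_singleton (holo_has_d hv)).
  have := has_dD h1 (has_d_cst 0 0).
  by rewrite mul1r mul0r !addr0; apply: has_d_ext => z; rewrite /F /= subr0 addr0.
have Et : germ_eq (fun s => t s * v (t s)) (fun s => s).
  by apply: filterS Ht => s /subr0_eq.
exists t; split=> //.
have [g hg Eg] := hadamard1 ht.
have hd : holomorphic0 (fun s => g s * v (t s) - 1).
  by apply: holoB; [apply: holoM => //; exact: holo_comp|exact: holo_cst].
have D : germ_eq (fun s => g s * v (t s) - 1) (fun=> 0).
  apply: dense1 => //; apply: filterS Et => s Es s0.
  apply: (mulfI s0); rewrite mulr0 mulrBr mulr1 mulrA.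
  have -> : s * g s = t s by rewrite Eg t0 add0r.
  by rewrite Es subrr.
exists g; split=> //.
  have := nbhs_singleton D; rewrite t0 => E; apply: contraTneq (oner_neq0 C) => g0.
  by move: E; rewrite g0 mul0r sub0r => /eqP; rewrite oppr_eq0 negbK.
by apply: germ_refl => s; rewrite Eg t0 add0r expr1.
Qed.

Lemma nzd_mul (V : normedModType C) (f g : V -> C) : holomorphic0 g -> nzd f -> nzd g ->
  nzd (fun z => f z * g z).
Proof.
move=> hg nf ng w hw H; apply: ng => //; apply: nf; first exact: holoM.
by apply: filterS H => z; rewrite mulrA.
Qed.

Lemma mult_one (h : C * C -> C) : mult (fun=> 1) h = 0%E.
Proof.
apply: dim_full; first exact: submod_ideal2.
move=> u hu; exists u, (fun=> 0); split=> //; first exact: holo_cst.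
by apply: filterE => p; rewrite mulr1 mul0r addr0.
Qed.

Section Graphs.
Variable a : nat -> C -> C.
Hypothesis ha : forall j, holomorphic0 (a j).
Hypothesis a0 : forall j, a j 0 = 0.

Definition graphs k (p : C * C) : C := \prod_(j < k) (p.2 - a j p.1).

Lemma graphsS k p : graphs k.+1 p = (p.2 - a k p.1) * graphs k p.
Proof. by rewrite /graphs big_ord_recr /= mulrC. Qed.

Lemma holo_graphs k : holomorphic0 (graphs k).
Proof. by apply: holo_prod => j; exact: holo_lin. Qed.

Lemma nzd_graphs k : nzd (graphs k).
Proof.
elim: k => [|k IH].
  by move=> w hw; apply: filterS => p; rewrite /graphs big_ord0 mul1r.
have [_ _ _ nl _] := branch_graph (ha k) (a0 k).
move=> w hw H; apply: (nzd_mul (holo_graphs k) nl IH) => //.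
by apply: filterS H => p; rewrite graphsS.
Qed.

Lemma mult_graphs k (h : C * C -> C) : holomorphic0 h ->
  mult (graphs k) h = (\sum_(j < k) ord0 (fun t => h (t, a j t)))%E.
Proof.
move=> hh; elim: k => [|k IH].
  rewrite big_ord0 -(mult_one h); apply: mult_ext; apply: germ_refl => // p.
  by rewrite /graphs big_ord0.
rewrite big_ord_recr /= -IH addeC -mult_graph //.
rewrite -(branch_mulM (branch_graph (ha k) (a0 k)) (holo_graphs k) hh); last exact: mult_graph.
by apply: mult_ext; apply: germ_refl => // p; rewrite graphsS.
Qed.

(** The graphs are divided out one at a time: on the next graph the earlier factors do not vanish
    off 0, so the current quotient must vanish there. *)
Lemma graphs_div k (v : C * C -> C) : holomorphic0 v ->
  (forall j, germ_eq (fun s => v (s, a j s)) (fun=> 0)) ->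
  (forall i j, (i < j < k)%N -> \forall s \near (0 : C), s != 0 -> a j s != a i s) ->
  exists2 w : C * C -> C, holomorphic0 w & germ_eq v (fun p => w p * graphs k p).
Proof.
move=> hv Hv; elim: k => [|k IH] Hd.
  by exists v => //; apply: germ_refl => p; rewrite /graphs big_ord0 mulr1.
have [|w hw E] := IH.
  by move=> i j /andP[ij jk]; apply: Hd; rewrite ij ltnW.
have [_ g0 _ _ bg] := branch_graph (ha k) (a0 k); have hg := holo_graph (ha k).
have wk0 : germ_eq (fun s => w (s, a k s)) (fun=> 0).
  apply: dense1; first exact: holo_comp hw hg g0.
  have N : \forall s \near (0 : C), forall i : 'I_k, s != 0 -> a k s != a i s.
    by apply: near_forall => i; apply: Hd; rewrite ltn_ord ltnS leqnn.
  apply: filterS2 (near_and (near_comp hg g0 E) (Hv k)) N => s [+ Hs] Ns s0.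
  rewrite /graph_map Hs => /esym/eqP; rewrite mulf_eq0 => /orP[/eqP//|].
  suff /negPf-> : graphs k (s, a k s) != 0 by [].
  by apply/prodf_neq0 => i _ /=; rewrite subr_eq0; exact: Ns.
have [q hq Ew] := bg w hw wk0; exists q => //.
by apply: filterS2 E Ew => p -> ->; rewrite graphsS mulrA.
Qed.

End Graphs.

Lemma ram_onto e (F : C * C -> C) : (0 < e)%N ->
  (\forall p \near (0 : C * C), F (ram e p) = 0) -> germ_eq F (fun=> 0).
Proof.
move=> e0 /near0CC[d d0 Hd]; apply/near0CC; exists (Num.min d (d ^+ e)).
  by rewrite lt_min d0 exprn_gt0.
move=> x y; rewrite !subr0 !lt_min => /andP[_ xd] /andP[yd _].
have td := nrm_rt e0 (ltW d0) xd.
have := Hd (rt e x) y ltac:(by rewrite subr0) ltac:(by rewrite subr0).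
by rewrite /ram /= rtK.
Qed.

Lemma mule_cancel (x y : \bar R) e : (0 < e)%N ->
  (((e%:R)%:E * x)%E = ((e%:R)%:E * y)%E) -> x = y.
Proof.
move=> e0; have h : (0 < e%:R :> R) by rewrite ltr0n.
case: x => [x| |]; case: y => [y| |] //; rewrite ?gt0_muley ?gt0_muleNy ?lte_fin //.
by move=> [] /(mulfI (lt0r_neq0 h)) ->.
Qed.

Lemma sum_ereal_const (x : \bar R) e : (0 <= x)%E -> (\sum_(j < e) x)%E = ((e%:R)%:E * x)%E.
Proof.
move=> x0; elim: e => [|e IH]; first by rewrite big_ord0 mul0e.
by rewrite big_ord_recr /= IH -natr1 EFinD ge0_muleDl ?mul1e // lee_fin.
Qed.

Lemma prod_cyclic_shift e (g : nat -> C) : g e = g 0%N ->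
  \prod_(j < e) g j.+1 = \prod_(j < e) g j.
Proof.
case: e => [|e] ge; first by rewrite !big_ord0.
by rewrite big_ord_recr /= ge big_ord_recl /= mulrC.
Qed.

Definition injective0 (g : C -> C * C) : Prop :=
  exists2 U : C -> Prop, (\forall t \near (0 : C), U t) &
    forall s t, U s -> U t -> g s = g t -> s = t.

Section Power.
Variables (e : nat) (a : C -> C).
Hypotheses (e0 : (0 < e)%N) (ha : holomorphic0 a) (a0 : a 0 = 0).
Hypothesis inj : injective0 (fun s : C => (s ^+ e, a s)).

(* The product of the conjugates [y - a (om ^ j * s)] descends along [x = s ^ e] to
   a germ [P (x, y)] dividing every germ that vanishes on the branch; as [f] is
   irreducible it is a unit times [P]. *)
Lemma power_branch (f : C * C -> C) : germ_irreducible f ->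
  germ_eq (fun s : C => f (s ^+ e, a s)) (fun=> 0) ->
  branch f (fun s : C => (s ^+ e, a s)) /\
  forall h : C * C -> C, holomorphic0 h -> mult f h = ord0 (fun s : C => h (s ^+ e, a s)).
Proof.
move=> [hf fn0 fnu firr] fd0; have [om om_p] := @prim_root_exists R e e0.
have om_neq0 : om != 0 by rewrite (prim_root_eq0 om_p) -lt0n.
have om_e := prim_expr_order om_p.
have om1 := prim_nrm e0 om_p.
pose d (s : C) : C * C := (s ^+ e, a s).
have hd : holomorphic0 d by apply: holo_pair => //; exact: holo_pow.
have d0 : d 0 = 0 by rewrite /d expr0n gtn_eqF // a0.
have hrot j : holomorphic0 (fun s : C => om ^+ j * s).
  by apply: holoM; [exact: holo_cst|exact: holo_id].
have rot0 j : om ^+ j * 0 = 0 by rewrite mulr0.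
pose A j (s : C) := a (om ^+ j * s).
have hA j : holomorphic0 (A j) by exact: holo_comp ha (hrot j) (rot0 j).
have A0 j : A j 0 = 0 by rewrite /A mulr0.
have dA j s : d (om ^+ j * s) = (s ^+ e, A j s).
  by rewrite /d exprMn -exprM mulnC exprM om_e expr1n mul1r.
(* Two conjugates agreeing at [s != 0] would give the same point of the parametrisation at
   [om ^ i * s] and [om ^ j * s]. *)
have distinct i j : (i < j < e)%N -> \forall s \near (0 : C), s != 0 -> A j s != A i s.
  move=> /andP[ij je]; have [U nU Uinj] := inj.
  apply: filterS2 (near_comp (hrot i) (rot0 i) nU) (near_comp (hrot j) (rot0 j) nU) => s Ui Uj s0.
  apply/eqP => Aij; have := Uinj _ _ Uj Ui; rewrite -[in X in X -> _]/(d _) -[in X in _ = X -> _]/(d _) !dA Aij.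
  move=> /(_ erefl) /(mulIf s0)/eqP; rewrite (eq_prim_root_expr om_p) !modn_small //; last exact: ltn_trans je.
  by rewrite gtn_eqF.
pose Pi := graphs A e.
have hPi : holomorphic0 Pi by exact: holo_graphs.
have nPi : nzd Pi by exact: nzd_graphs.
have PiE p : Pi (om * p.1, p.2) = Pi p.
  rewrite /Pi /graphs /= -[RHS](@prod_cyclic_shift e (fun j => p.2 - A j p.1)) /=.
    by apply: eq_bigr => j _; rewrite /A mulrA -exprSr.
  by rewrite /A om_e expr0.
have [P hP EP] := descend e0 om_p hPi (filterE _ PiE).
have hr (u : C * C -> C) : holomorphic0 u -> holomorphic0 (fun p => u (ram e p)) :=
  fun hu => holo_comp hu (@holo_ram R e) (@ram0 R e e0).
(* Upstairs [v] vanishes on all conjugate graphs, hence is divisible by [Pi]; the quotient inherits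
   the invariance of both and descends. *)
have factor (v : C * C -> C) : holomorphic0 v -> germ_eq (fun s => v (d s)) (fun=> 0) ->
    exists2 w : C * C -> C, holomorphic0 w & germ_eq v (fun p => w p * P p).
  move=> hv vd0.
  have [j|W hW EW] := @graphs_div A hA A0 e _ (hr _ hv) _ distinct.
    have := near_comp (hrot j) (rot0 j) vd0; apply: filterS => s; rewrite dA.
    by rewrite /ram.
  have IW : \forall p \near (0 : C * C), W (om * p.1, p.2) = W p.
    have hq : holomorphic0 (fun p : C * C => W (om * p.1, p.2) - W p).
      by apply: holoB => //; exact: holo_comp hW (holo_scale om) (scale0 om).
    have := nPi _ hq => H; have {}H := H _.
    have : germ_eq (fun p : C * C => W (om * p.1, p.2) - W p) (fun=> 0).
      apply: H; have := near_comp (holo_scale om) (scale0 om) EW.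
      apply: filterS2 EW => p; rewrite -/Pi => E1 E2.
      have Er : ram e (om * p.1, p.2) = ram e p by rewrite /ram /= exprMn om_e mul1r.
      by rewrite Er PiE E1 in E2; rewrite mulrC mulrBl E2 subrr.
    by apply: filterS => p /subr0_eq.
  have [w hw Ew] := descend e0 om_p hW IW; exists w => //.
  have : germ_eq (fun p => v p - w p * P p) (fun=> 0).
    apply: (ram_onto e0); apply: filterS2 (near_and EW EP) Ew => p [-> E1] E2.
    by rewrite -[ram e p]/(p.1 ^+ e, p.2) -E1 -E2 subrr.
  by apply: filterS => p /subr0_eq.
have P0 : P 0 = 0.
  have := nbhs_singleton EP; rewrite /= expr0n gtn_eqF // => <-.
  rewrite /Pi /graphs (bigD1 (Ordinal e0)) //= A0 subrr mul0r.
  by [].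
have [w hw Ew] := factor f hf fd0.
(* As [P] vanishes at 0 it is no unit, so irreducibility makes the cofactor [w] a unit. *)
have w0 : w 0 != 0.
  have [[g hg E]|[g hg E]] := firr _ _ hw hP Ew.
    by apply/eqP => w0; have /eqP := nbhs_singleton E; rewrite w0 mul0r eq_sym oner_eq0.
  by have /eqP := nbhs_singleton E; rewrite P0 mul0r eq_sym oner_eq0.
have br : branch f d.
  split=> //.
    move=> u hu H; apply: (ram_onto e0).
    have := nPi _ (hr _ hu); apply.
    have := near_comp (@holo_ram R e) (@ram0 R e e0) (near_and (near_and H Ew) (near_neq0 hw w0)).
    apply: filterS2 EP => p Ep [[E1 E2] E3]; move: E1; rewrite E2 => /eqP.
    rewrite !mulf_eq0 (negPf E3) /= => E; apply/eqP; rewrite mulf_eq0 Ep.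
    by rewrite -[(p.1 ^+ e, p.2)]/(ram e p).
  move=> v hv vd0; have [w' hw' Ew'] := factor v hv vd0.
  exists (fun p => w' p / w p); first by apply: holoM => //; exact: holoV.
  apply: filterS2 (near_and Ew Ew') (near_neq0 hw w0) => p [-> ->] wp0.
  by field.
(* Upstairs [f] is a unit times [Pi], and each of the [e] conjugate graphs contributes the same
   order, since rotations preserve orders; the factor [e] then cancels. *)
split=> // h hh; apply: (mule_cancel e0).
rewrite -(mult_ram e0 hf hh).
have -> : mult (fun p => f (ram e p)) (fun p => h (ram e p)) = mult Pi (fun p => h (ram e p)).
  rewrite -[RHS](@mult_unitl R (fun p => w (ram e p))) ?ram0 //; last exact: hr.
  apply: mult_ext; last exact: germ_refl.
  apply: filterS2 (near_comp (@holo_ram R e) (@ram0 R e e0) Ew) EP => p -> ->.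
  by [].
rewrite (mult_graphs hA A0 e (hr _ hh)) -sum_ereal_const ?ord_ge0 //.
apply: eq_bigr => j _; rewrite -/d.
transitivity (ord0 (fun s => (fun s => h (d s)) (om ^+ j * s))).
  by apply: ord_ext; apply: germ_refl => s; rewrite dA.
rewrite (@ord_comp R (fun s => h (d s)) _ 1%N) ?mul1e //; first exact: holo_comp.
exists (fun=> om ^+ j); split; [exact: holo_cst|by rewrite expf_neq0|].
by apply: germ_refl => s; rewrite expr1 mulrC.
Qed.

End Power.

End Branches.

(** * Parametrised irreducible germs *)

Section Irreducible.
Variable R : realType.
Local Notation ord0 := (@Defs.ord0 R).
Local Notation C := (Cplx R).
Local Notation mult := (@intersection_number R).

Lemma injective0_nonzero (g : C -> C * C) : injective0 g ->
  germ_eq (fun t => (g t).1) (fun=> 0) -> germ_eq (fun t => (g t).2) (fun=> 0) -> False.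
Proof.
move=> [U nU Uinj] xz yz.
have /near0C[d d0 Hd] := near_and (near_and xz yz) nU.
have [h h0 hd] := small_point d0.
have [[x1 y1] Uh] := Hd h ltac:(by rewrite subr0).
have [[x0 y0] U0] := Hd 0 ltac:(by rewrite subrr nrm0).
move/eqP: h0; apply; apply: Uinj => //.
by rewrite [g h]surjective_pairing x1 y1 [g 0]surjective_pairing x0 y0.
Qed.

(** Reduction to [power_branch]: near 0 the first coordinate is [t ^ e * v t ^ e] with [v] a unit;
    the parameter [s = t * v t] turns [g] into [(s ^ e, a s)] and leaves orders unchanged. *)
Lemma irr_branch_x (f : C * C -> C) (g : C -> C * C) : germ_irreducible f ->
  holomorphic0 g -> g 0 = 0 -> injective0 g -> germ_eq (fun t => f (g t)) (fun=> 0) ->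
  ~ germ_eq (fun t => (g t).1) (fun=> 0) ->
  branch f g /\ forall h : C * C -> C, holomorphic0 h -> mult f h = ord0 (fun t => h (g t)).
Proof.
move=> firr hg g0 ginj fg0 xn0.
have hx : holomorphic0 (fun t => (g t).1) by exact: holo_comp (@holo_fst R) hg g0.
have hy : holomorphic0 (fun t => (g t).2) by exact: holo_comp (@holo_snd R) hg g0.
have [//|[e xe]] := order_dichotomy hx.
have e0 : (0 < e)%N by apply: ordform0 xe _; rewrite g0.
have [u [hu u0 Eu]] := xe.
have [v [hv v0 Ev]] := holo_root e0 hu u0.
have [t [ht t0 t1 Et]] := holo_inverse hv v0.
pose a s := (g (t s)).2.
have ha : holomorphic0 a by exact: holo_comp hy ht t0.
have a0 : a 0 = 0 by rewrite /a t0 g0.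
have Eg : \forall s \near (0 : C), g (t s) = (s ^+ e, a s).
  apply: filterS2 (near_and (near_comp ht t0 Eu) (near_comp ht t0 Ev)) Et => s [E1 E2] E3.
  by rewrite /a [LHS]surjective_pairing; congr (_, _); rewrite E1 -E2 -exprMn E3.
have inj : injective0 (fun s : C => (s ^+ e, a s)).
  have [U nU Uinj] := ginj.
  exists (fun s => [/\ U (t s), t s * v (t s) = s & g (t s) = (s ^+ e, a s)]).
    by apply: filterS2 (near_and (near_comp ht t0 nU) Et) Eg => s [].
  move=> s s' [Us Es Gs] [Us' Es' Gs'] E.
  have tt : t s = t s' by apply: Uinj => //; rewrite Gs Gs'.
  by rewrite -Es tt Es'.
have fd0 : germ_eq (fun s : C => f (s ^+ e, a s)) (fun=> 0).
  by apply: filterS2 (near_comp ht t0 fg0) Eg => s + E; rewrite E.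
have [[[hf hd] d0 _ nf bf] H] := power_branch e0 ha a0 inj firr fd0.
split.
  split=> // w hw wg0; apply: bf => //.
  by apply: filterS2 (near_comp ht t0 wg0) Eg => s + E; rewrite E.
move=> h hh; rewrite H //.
rewrite -[RHS]mul1e -(@ord_comp R (fun s => h (g s)) t 1%N) //; last exact: holo_comp.
by apply: ord_ext; apply: filterS Eg => s ->.
Qed.

Lemma irr_swap (f : C * C -> C) : germ_irreducible f -> germ_irreducible (fun p => f (swapc p)).
Proof.
have hs := @holo_swapc R; have s0 : swapc (0 : C * C) = 0 by [].
have sE (F G : C * C -> C) : germ_eq (fun p => F (swapc p)) G -> germ_eq F (fun p => G (swapc p)).
  by move=> /(near_comp hs s0); apply: filterS => p; rewrite swapcK.
have unit_swap (F : C * C -> C) : germ_unit (fun p => F (swapc p)) -> germ_unit F.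
  move=> [g hg E]; exists (fun p => g (swapc p)); first exact: holo_comp.
  by have := near_comp hs s0 E; apply: filterS => p; rewrite swapcK.
move=> [hf fn0 fnu firr]; split.
- exact: holo_comp.
- by move=> /sE.
- by move=> /unit_swap.
- move=> g h hg hh /sE E.
  have [U|U] := firr _ _ (holo_comp hg hs s0) (holo_comp hh hs s0) E; [left|right]; exact: unit_swap.
Qed.

(** A branch with [x = 0] identically is treated by exchanging the coordinates; injectivity forbids
    both to vanish. *)
Lemma irr_branch (f : C * C -> C) (g : C -> C * C) : germ_irreducible f ->
  holomorphic0 g -> g 0 = 0 -> injective0 g -> germ_eq (fun t => f (g t)) (fun=> 0) ->
  branch f g /\ forall h : C * C -> C, holomorphic0 h -> mult f h = ord0 (fun t => h (g t)).
Proof.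
move=> firr hg g0 ginj fg0.
have [xz|] := pselect (germ_eq (fun t => (g t).1) (fun=> 0)); last exact: irr_branch_x.
have hs := @holo_swapc R; have s0 : swapc (0 : C * C) = 0 by [].
pose g' t := swapc (g t).
have yn0 : ~ germ_eq (fun t => (g' t).1) (fun=> 0).
  move=> yz; apply: injective0_nonzero ginj xz _.
  by apply: filterS yz => t.
have [||||||[[hf' _] _ _ nf' bf'] H] := @irr_branch_x (fun p => f (swapc p)) g'.
- exact: irr_swap.
- exact: holo_comp.
- by rewrite /g' g0.
- have [U nU Uinj] := ginj; exists U => // s t Us Ut E; apply: Uinj => //.
  by rewrite -[g s]swapcK -[g t]swapcK -/(g' s) E.
- by apply: filterS fg0 => t; rewrite /g' swapcK.
- exact: yn0.
have [hf fn0 fnu _] := firr.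
split.
  split=> //.
    move=> w hw E; have := nf' _ (holo_comp hw hs s0) (near_comp hs s0 E).
    by move=> /(near_comp hs s0); apply: filterS => p; rewrite swapcK.
  move=> v hv vg; have [|a ha E] := bf' _ (holo_comp hv hs s0).
    by apply: filterS vg => t; rewrite /g' swapcK.
  exists (fun p => a (swapc p)); first exact: holo_comp.
  by have := near_comp hs s0 E; apply: filterS => p; rewrite swapcK.
move=> h hh.
have := H _ (holo_comp hh hs s0).
rewrite (@mult_auto R (@swapc R) (@swapc R)) //; try (by apply: filterE => p; rewrite swapcK).
by move=> ->; apply: ord_ext; apply: germ_refl => t; rewrite /g' swapcK.
Qed.

Lemma param_facts (f : C * C -> C) (g : C -> C * C) : parametrisation g f ->
  [/\ holomorphic0 g, g 0 = 0, injective0 g & germ_eq (fun t => f (g t)) (fun=> 0)].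
Proof.
move=> [hg g0 [U nU [Uinj _ HU]]]; split=> //; first by exists U.
have := near_comp hg g0 (HU U nU ltac:(by [])).
by apply: filterS2 nU => t Ut [E _]; apply: E; exists t.
Qed.

End Irreducible.

(** * Puiseux roots *)

Section Puiseux.
Variable R : realType.
Local Notation C := (Cplx R).

Lemma taylor_y r (F : C * C -> C) : holomorphic0 F ->
  exists (c : nat -> C -> C) (K : C * C -> C),
    [/\ forall i, holomorphic0 (c i), holomorphic0 K,
        forall x y, F (x, y) = \sum_(i < r) c i x * y ^+ i + y ^+ r * K (x, y),
        forall x, (0 < r)%N -> c 0%N x = F (x, 0)
      & forall x, (1 < r)%N -> c 1%N x = dy F (x, 0)].
Proof.
elim: r F => [|r IH] F hF.
  exists (fun _ _ => 0), F; split=> //; first by move=> i; exact: holo_cst.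
  by move=> x y; rewrite big_ord0 add0r expr0 mul1r.
have [G [hG EG G0]] := hadamard hF.
have [c [K [hc hK E c0 _]]] := IH G hG.
exists (fun i => if i is j.+1 then c j else fun x => F (x, 0)), K; split=> //.
- by case=> [|i] //; exact: holo_comp hF (@holo_inl R) erefl.
- move=> x y; rewrite EG E big_ord_recl /= expr0 mulr1 -addrA; congr (_ + _).
  rewrite mulrDr mulr_sumr exprS mulrA; congr (_ + _).
  by apply: eq_bigr => i _; rewrite exprS mulrCA.
- by move=> x r1; rewrite c0 // G0.
Qed.

Lemma small_poly r (c : nat -> C) (w : C -> C) : holomorphic0 w ->
  germ_eq (fun y : C => \sum_(i < r) c i * y ^+ i) (fun y : C => y ^+ r * w y) ->
  forall i, (i < r)%N -> c i = 0.
Proof.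
move=> hw; elim: r c => // r IH c H.
have c0 : c 0%N = 0.
  have := nbhs_singleton H; rewrite big_ord_recl expr0 mulr1 big1 ?addr0.
    by rewrite exprS !mul0r.
  by move=> i _; rewrite exprS mul0r mulr0.
case=> // i ir; apply: (IH (fun i => c i.+1)) => //.
have hd : holomorphic0 (fun y : C => \sum_(i < r) c i.+1 * y ^+ i - y ^+ r * w y).
  apply: holoB; last by apply: holoM => //; exact: holo_pow.
  by apply: holo_sum => j; apply: holoM; [exact: holo_cst|exact: holo_pow].
have : germ_eq (fun y : C => \sum_(i < r) c i.+1 * y ^+ i - y ^+ r * w y) (fun=> 0).
  apply: dense1 => //; apply: filterS H => y E y0.
  apply: (mulfI y0); rewrite mulr0 mulrBr mulrA -exprS -E big_ord_recl c0 mul0r add0r mulr_sumr.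
  by apply/eqP; rewrite subr_eq0; apply/eqP; apply: eq_bigr => j _; rewrite /= exprS mulrCA.
by apply: filterS => y /subr0_eq.
Qed.

Lemma holo_poly (p : {poly C}) (a : C) : holomorphic0 (fun z : C => p.[a + z]).
Proof.
apply: holo_eq (_ : holomorphic0 (fun z : C => \sum_(i < size p) p`_i * (a + z) ^+ i)).
  by apply: filterE => z; rewrite horner_coef.
apply: holo_sum => i; apply: holoM; first exact: holo_cst.
by apply: holoX; apply: holoD; [exact: holo_cst|exact: holo_id].
Qed.

(** A root [a] of full multiplicity [r] would make [p] a constant multiple of [('X - a) ^ r], whose
    coefficient of degree 1 vanishes only for [a = 0] when [1 < r]; then [p] would be a monomial,
    against the nonzero lower coefficient. *)
Lemma root_multiplicity (p : {poly C}) r : (1 < r)%N -> size p = r.+1 -> p`_1 = 0 ->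
  (exists2 i, (i < r)%N & p`_i != 0) ->
  exists a m (q : {poly C}), [/\ (0 < m)%N, (m < r)%N, q.[a] != 0 & p = q * ('X - a%:P) ^+ m].
Proof.
move=> r1 sp p1 [i ir pi].
have p0 : p != 0 by rewrite -size_poly_eq0 sp.
have [a ra] : exists a : C, root p a.
  by apply/(@closed_rootP R[i]); rewrite sp; case: (r) r1.
have [m [q nq E]] := multiplicity_XsubC p a; rewrite p0 /= in nq.
exists a, m, q; rewrite -rootE nq E; split=> //.
  by rewrite lt0n; apply: contraTneq ra => m0; rewrite E m0 expr0 mulr1.
have q0 : q != 0 by apply: contraNneq nq => ->; rewrite root0.
have sE : size p = (size q + m)%N.
  by rewrite E size_Mmonic ?monic_exp ?monicXsubC // size_exp_XsubC addnS.
have sq : (0 < size q)%N by rewrite lt0n size_poly_eq0.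
have : (m <= r)%N by rewrite sp in sE; lia.
rewrite leq_eqVlt => /orP[/eqP mr|//]; exfalso.
have sq1 : size q = 1%N by rewrite sp mr in sE; lia.
have [k k0 qk] : exists2 k, k != 0 & q = k%:P by apply/size_poly1P; rewrite sq1.
have a0 : a = 0.
  have : p^`().[0] = 0 by rewrite horner_coef0 coef_deriv p1 mul0rn.
  rewrite E qk mul_polyC derivZ hornerZ deriv_exp derivXsubC mul1r hornerMn horner_exp hornerXsubC sub0r.
  rewrite mr; move/eqP; rewrite mulf_eq0 (negPf k0) -mulr_natr mulf_eq0 pnatr_eq0.
  by rewrite (gtn_eqF (ltnW r1)) orbF expf_eq0 oppr_eq0 => /andP[_ /eqP].
move: pi; rewrite E qk a0 subr0 mul_polyC coefZ coefXn mr (ltn_eqF ir) mulr0.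
by rewrite eqxx.
Qed.

End Puiseux.

Section Roots.
Variable R : realType.
Local Notation C := (Cplx R).

(** A Puiseux root [y = b (x ^ (1 / N))], written without fractional powers. *)
Definition has_root (F : C * C -> C) := exists (N : nat) (b : C -> C),
  [/\ (0 < N)%N, holomorphic0 b, b 0 = 0 & germ_eq (fun t : C => F (t ^+ N, b t)) (fun=> 0)].

Lemma dy_subst (F : C * C -> C) (a b : C -> C) : holomorphic0 F ->
  holomorphic0 a -> holomorphic0 b -> a 0 = 0 -> b 0 = 0 ->
  germ_eq (dy (fun p : C * C => F (a p.1, b p.1 + p.2)))
          (fun p => dy F (a p.1, b p.1 + p.2)).
Proof.
move=> hF ha hb a0 b0.
have hT : holomorphic0 (fun p : C * C => (a p.1, b p.1 + p.2)).
  apply: holo_pair; first exact: holo_comp ha (@holo_fst R) erefl.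
  by apply: holoD; [exact: holo_comp hb (@holo_fst R) erefl|exact: holo_snd].
have T0 : (fun p : C * C => (a p.1, b p.1 + p.2)) 0 = 0 by rewrite /= a0 b0 addr0.
have hFT := holo_comp hF hT T0.
apply: filterS2 (near_comp hT T0 hF) hFT => -[x y] /= dF dFT.
have /= h1 := slice_y dFT.
have h2 := @chain2 R F (fun=> a x) (fun s => b x + s) y _ _ dF (has_d_cst (a x) y)
   (has_dD (has_d_cst (b x) y) (has_d_id y)).
rewrite (has_d_unique h1 h2); move: (dx F _) (dy F _) => A B.
by rewrite mulr0 !add0r mulr1.
Qed.

Lemma ordform_dy (F : C * C -> C) r : holomorphic0 F ->
  ordform (fun y : C => F (0, y)) r.+1 -> ordform (fun y : C => dy F (0, y)) r.
Proof.
move=> hF Fr; have hs : holomorphic0 (fun y : C => F (0, y)) by exact: holo_comp hF (@holo_inr R) erefl.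
have [u [hu u0 E]] := ordform_derive hs Fr.
have dn : \forall y \near (0 : C), differentiable F (0, y) by exact: near_comp (@holo_inr R) erefl hF.
exists u; split; [exact: hu|exact: u0|].
have := near_and E dn; apply: filterS => y [Ey dF].
have h := has_d_derive1 (slice_y dF).
exact: etrans (esym h) Ey.
Qed.

(* One step of the Newton polygon: the slope [p / L] is chosen so that
   [F (s ^ L, s ^ p * y) = s ^ (p * r) * F' (s, y)] with [F'] holomorphic. Since
   [dy F (x, 0)] vanishes, the initial polynomial [F' (0, y)] has no term of degree
   1 and is not a power of [y], so all its roots have multiplicity less than [r]. *)
Lemma puiseux_step r (F : C * C -> C) : (1 < r)%N -> holomorphic0 F ->
  ordform (fun y : C => F (0, y)) r -> germ_eq (fun x : C => dy F (x, 0)) (fun=> 0) ->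
  (forall m (G : C * C -> C), (0 < m < r)%N -> holomorphic0 G ->
     ordform (fun y : C => G (0, y)) m -> has_root G) ->
  has_root F.
Proof.
move=> r1 hF [u [hu u0 Fu]] F1 IH; have r0 := ltnW r1.
have [c [K [hc hK E c0 c1]]] := taylor_y r hF.
have hK0 : holomorphic0 (fun y => K (0, y)) by exact: holo_comp hK (@holo_inr R) erefl.
have ci0 i : (i < r)%N -> c i 0 = 0.
  apply: (@small_poly R r (fun i => c i 0) (fun y => u y - K (0, y))); first exact: holoB.
  apply: filterS Fu => y; rewrite E => H.
  by rewrite mulrBr -H addrK.
have K00 : K (0, 0) = u 0.
  have : germ_eq (fun y => K (0, y) - u y) (fun=> 0).
    apply: (@nzd_pow R r); first exact: holoB.
    apply: filterS Fu => y; rewrite E big1 => [|i _]; last by rewrite ci0 ?mul0r.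
    by rewrite add0r mulrBr => ->; rewrite subrr.
  by move=> /nbhs_singleton /subr0_eq.
have [Zall|/existsNP[j0 /not_implyP[j0r Zj0]]] :=
    pselect (forall i, (i < r)%N -> germ_eq (c i) (fun=> 0)).
  exists 1%N, (fun=> 0); split=> //; first exact: holo_cst.
  by apply: filterS (Zall 0%N r0) => x H; rewrite expr1 -c0.
have /choice[k Hk] : forall i, exists k, germ_eq (c i) (fun=> 0) \/ ordform (c i) k.
  by move=> i; have [H|[k H]] := order_dichotomy (hc i); [exists 0%N; left|exists k; right].
(* Every [r - i] with [i < r] divides [r!], so all slopes [k i / (r - i)] become integers [M i]
   after the substitution [x = s ^ L]. *)
pose L := r`!; have L0 : (0 < L)%N by exact: fact_gt0.
pose M i := (k i * (L %/ (r - i)))%N.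
pose Z i := `[< germ_eq (c i) (fun=> 0) >].
have ME i : (i < r)%N -> (M i * (r - i) = k i * L)%N.
  move=> ir; rewrite /M -mulnA divnK //.
  by apply: dvdn_fact; rewrite subn_gt0 ir leq_subr.
have Zj : ~~ Z (Ordinal j0r) by apply/negP => /asboolP.
(* The index [i1] attains the smallest slope: [p] is then admissible for all coefficients, and
   [G i1] keeps a nonzero value at 0. *)
case: (@arg_minnP _ (Ordinal j0r) (fun i : 'I_r => ~~ Z i) (fun i : 'I_r => M i) Zj) => i1 /= Zi1 Mmin.
have kform i : ~~ Z i -> ordform (c i) (k i) by move=> /asboolP; case: (Hk i).
pose p := M i1; have p0 : (0 < p)%N.
  have : (0 < k i1)%N by apply: ordform0 (kform _ Zi1) (ci0 _ (ltn_ord i1)).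
  move=> k0; have := ME i1 (ltn_ord i1); rewrite -/p; move: (ltn_ord i1) k0 L0.
  by case: p => // _ k0 L0 /esym/eqP; rewrite mul0n muln_eq0 !gtn_eqF.
have /choice[G HG] : forall i, exists G : C -> C, [/\ holomorphic0 G,
    (i < r)%N -> \forall s \near (0 : C), c i (s ^+ L) = s ^+ (p * (r - i)) * G s,
    Z i -> G 0 = 0 & i = i1 -> G 0 != 0].
  move=> i; have hL := @holo_pow R L; have sL : (0 : C) ^+ L = 0 by rewrite expr0n gtn_eqF.
  have [Zi|Zi] := boolP (Z i).
    exists (fun=> 0); split=> //; first exact: holo_cst.
      by move=> _; apply: filterS (near_comp hL sL (asboolW Zi)) => s ->; rewrite mulr0.
    by move=> ii; move: Zi; rewrite ii (negPf Zi1).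
  have [v [hv v0 Ev]] := kform i Zi.
  exists (fun s => s ^+ (k i * L - p * (r - i)) * v (s ^+ L)); split=> //.
  - by apply: holoM; [exact: holo_pow|exact: holo_comp hv hL sL].
  - move=> ir; have le : (p * (r - i) <= k i * L)%N.
      by rewrite -ME // leq_mul2r; apply/orP; right; exact: (Mmin (Ordinal ir)).
    apply: filterS (near_comp hL sL Ev) => s ->.
    by rewrite mulrA -exprD subnKC // -exprM mulnC.
  - by move=> ->; rewrite /p ME // subnn expr0 mul1r sL.
have hG i : holomorphic0 (G i) by case: (HG i).
(* The initial polynomial [F' (0, y)] before the shift by its root [al]; its degree is exactly [r]
   since [u 0 != 0]. *)
pose P : {poly C} := \poly_(i < r.+1) (if (i < r)%N then G i 0 else u 0).
have sP : size P = r.+1 by apply: size_poly_eq; rewrite ltnn.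
have [||al [m [q [m0 mr qa PE]]]] := root_multiplicity r1 sP.
- rewrite coef_poly r1 ltnS (ltnW r1); have [_ _ + _] := HG 1%N; apply; apply/asboolP.
  by apply: filterS F1 => x H; rewrite c1.
- exists i1 => //; rewrite coef_poly ltn_ord (ltn_trans (ltn_ord i1)) //.
  by have [_ _ _ ->] := HG i1.
pose F' (w : C * C) : C := \sum_(i < r) G i w.1 * (al + w.2) ^+ i +
   (al + w.2) ^+ r * K (w.1 ^+ L, w.1 ^+ p * (al + w.2)).
have hal : holomorphic0 (fun w : C * C => al + w.2) by apply: holoD; [exact: holo_cst|exact: holo_snd].
have [||N [b [N0 hb b0 Hb]]] := IH m F' ltac:(by rewrite m0 mr).
- apply: holoD.
    apply: holo_sum => i; apply: holoM; last exact: holoX.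
    exact: holo_comp (hG i) (@holo_fst R) erefl.
  apply: holoM; first exact: holoX.
  apply: (@holo_comp _ _ _ _ K (fun w : C * C => (w.1 ^+ L, w.1 ^+ p * (al + w.2)))) => //.
    apply: holo_pair; first by apply: holoX; exact: holo_fst.
    by apply: holoM => //; apply: holoX; exact: holo_fst.
  by rewrite /= !expr0n !gtn_eqF // mul0r.
- exists (fun z => q.[al + z]); split.
  + exact: holo_poly.
  + by rewrite addr0.
  + apply: filterE => z; rewrite /F' /= !expr0n !gtn_eqF // mul0r K00.
    have -> : z ^+ m * q.[al + z] = P.[al + z].
      by rewrite PE hornerM horner_exp hornerXsubC addrAC subrr add0r mulrC.
    rewrite horner_poly big_ord_recr /= ltnn [X in _ = _ + X]mulrC; congr (_ + _).
    by apply: eq_bigr => i _; rewrite ltn_ord.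
exists (N * L)%N, (fun t => t ^+ (N * p) * (al + b t)); split.
- by rewrite muln_gt0 N0.
- by apply: holoM; [exact: holo_pow|apply: holoD => //; exact: holo_cst].
- by rewrite expr0n gtn_eqF ?mul0r // muln_gt0 N0.
clearbody p L; have nG : \forall s \near (0 : C), forall i : 'I_r, c i (s ^+ L) = s ^+ (p * (r - i)) * G i s.
  by apply: near_forall => i; have [_ + _ _] := HG i; apply.
have hN := @holo_pow R N; have N00 : (0 : C) ^+ N = 0 by rewrite expr0n gtn_eqF.
apply: filterS2 Hb (near_comp hN N00 nG) => t Ht nGt.
rewrite (exprM t N p) (exprM t N L) E; move: Ht; rewrite /F' /=; move: (t ^+ N) (b t) nGt => s z nGs Hz.
suff -> : forall X, \sum_(i < r) c i (s ^+ L) * (s ^+ p * (al + z)) ^+ i + (s ^+ p * (al + z)) ^+ r * X =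
    s ^+ (p * r) * (\sum_(i < r) G i s * (al + z) ^+ i + (al + z) ^+ r * X) by rewrite Hz mulr0.
move=> X; rewrite [RHS]mulrDr mulr_sumr [in RHS]mulrA exprMn -exprM; congr (_ + _).
apply: eq_bigr => i _; have -> : s ^+ (p * r) = s ^+ (p * (r - i)) * s ^+ (p * i).
  by rewrite -exprD -mulnDr subnK // ltnW.
rewrite nGs exprMn -exprM; move: (s ^+ (p * (r - i))) (G i s) (s ^+ (p * i)) ((al + z) ^+ i) => A B D T.
by rewrite -!mulrA [B * _]mulrCA.
Qed.

(** Induction on the order [r] in [y]. [dy F] has order [r - 1], hence a Puiseux root if [1 < r];
    moving it to [y = 0] makes the coefficient of [y] vanish, as [puiseux_step] requires. For
    [r = 1] the implicit function theorem suffices. *)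
Lemma puiseux_root r (F : C * C -> C) : (0 < r)%N -> holomorphic0 F ->
  ordform (fun y : C => F (0, y)) r -> has_root F.
Proof.
elim/ltn_ind: r F => -[|[|r]] // IH F _ hF Fr.
  have [u [hu u0 E]] := ordform_dy hF Fr.
  have F0 : F 0 = 0.
    by have [w [_ _ /nbhs_singleton]] := Fr; rewrite expr1 mul0r.
  have [|b [hb b0 Hb]] := ift hF F0.
    by have := nbhs_singleton E; rewrite expr0 mul1r => H; rewrite -H in u0.
  by exists 1%N, b; split=> //; apply: filterS Hb => x; rewrite expr1.
have [//||||N1 [b1 [N10 hb1 b10 Hb1]]] := IH r.+1 _ (dy F) => //.
- exact: holo_dy.
- exact: ordform_dy.
have hN1 := @holo_pow R N1; have N100 : (0 : C) ^+ N1 = 0 by rewrite expr0n gtn_eqF.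
pose F1 (p : C * C) := F (p.1 ^+ N1, b1 p.1 + p.2).
have hT : holomorphic0 (fun p : C * C => (p.1 ^+ N1, b1 p.1 + p.2)).
  apply: holo_pair; first by apply: holoX; exact: holo_fst.
  by apply: holoD; [exact: holo_comp hb1 (@holo_fst R) erefl|exact: holo_snd].
have T0 : (fun p : C * C => (p.1 ^+ N1, b1 p.1 + p.2)) 0 = 0 by rewrite /= N100 b10 addr0.
have [||||N [b [N0 hb b0 Hb]]] := @puiseux_step r.+2 F1 ltac:(by []).
- exact: holo_comp hF hT T0.
- have [u [hu u0 E]] := Fr; exists u; split=> //.
  by apply: filterS E => y <-; rewrite /F1 /= N100 b10 add0r.
- have := near_comp (@holo_inl R) erefl (dy_subst hF hN1 hb1 N100 b10).
  by apply: filterS2 Hb1 => x H -> /=; rewrite addr0.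
- by move=> m G /andP[m0 mr] hG; exact: IH.
have hN := @holo_pow R N; have N00 : (0 : C) ^+ N = 0 by rewrite expr0n gtn_eqF.
exists (N * N1)%N, (fun t => b1 (t ^+ N) + b t); split.
- by rewrite muln_gt0 N0.
- by apply: holoD => //; exact: holo_comp hb1 hN N00.
- by rewrite N00 b10 b0 addr0.
- by apply: filterS Hb => t; rewrite /F1 /= exprM.
Qed.

End Roots.

(** * Polar curves *)

Section Polar.
Variable R : realType.
Local Notation C := (Cplx R).
Local Notation mult := (@intersection_number R).

Lemma dx_comp (F A B : C * C -> C) x y a b :
  differentiable F (A (x, y), B (x, y)) -> differentiable (fun p : C * C => F (A p, B p)) (x, y) ->
  has_d (fun s => A (s, y)) x a -> has_d (fun s => B (s, y)) x b ->
  dx (fun p : C * C => F (A p, B p)) (x, y) = dx F (A (x, y), B (x, y)) * a + dy F (A (x, y), B (x, y)) * b.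
Proof.
move=> dF dFT hA hB; have h1 := slice_x dFT.
exact: (has_d_unique h1 (@chain2 R F (fun s => A (s, y)) (fun s => B (s, y)) x a b dF hA hB)).
Qed.

Lemma dy_comp (F A B : C * C -> C) x y a b :
  differentiable F (A (x, y), B (x, y)) -> differentiable (fun p : C * C => F (A p, B p)) (x, y) ->
  has_d (fun s => A (x, s)) y a -> has_d (fun s => B (x, s)) y b ->
  dy (fun p : C * C => F (A p, B p)) (x, y) = dx F (A (x, y), B (x, y)) * a + dy F (A (x, y), B (x, y)) * b.
Proof.
move=> dF dFT hA hB; have h1 := slice_y dFT.
exact: (has_d_unique h1 (@chain2 R F (fun s => A (x, s)) (fun s => B (x, s)) y a b dF hA hB)).
Qed.

(** The field [x * d / dx] is merely rescaled by [e] when [x] is replaced by [x ^ e], so the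
    statement of [polar_eq] is stable under ramification. *)
Lemma dx_ram e (F : C * C -> C) : (0 < e)%N -> holomorphic0 F ->
  germ_eq (fun p : C * C => p.1 * dx (fun q : C * C => F (ram e q)) p) (fun p : C * C => e%:R * ((ram e p).1 * dx F (ram e p))).
Proof.
move=> e0 hF; have hr := @holo_ram R e; have r0 := @ram0 R e e0.
have hFr := holo_comp hF hr r0.
apply: filterS2 (near_comp hr r0 hF) hFr => -[x y] dF dFr.
have h1 : has_d (fun s : C => s ^+ e) x (e%:R * x ^+ e.-1 * 1) by exact: has_dX (has_d_id x).
have E := @dx_comp F (fun p : C * C => p.1 ^+ e) (fun p : C * C => p.2) x y _ _ dF dFr h1 (has_d_cst y x).
have -> : dx (fun q : C * C => F (ram e q)) (x, y) = dx F (ram e (x, y)) * (e%:R * x ^+ e.-1 * 1) +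
    dy F (ram e (x, y)) * 0 by exact: E.
move: (dx F _) (dy F _) => X Y /=; rewrite mulr0 addr0 mulr1.
by rewrite -(prednK e0) /= exprS; ring.
Qed.

Lemma dy_ram e (F : C * C -> C) : (0 < e)%N -> holomorphic0 F ->
  germ_eq (dy (fun q : C * C => F (ram e q))) (fun p : C * C => dy F (ram e p)).
Proof.
move=> e0 hF; have hr := @holo_ram R e; have r0 := @ram0 R e e0.
have hFr := holo_comp hF hr r0.
apply: filterS2 (near_comp hr r0 hF) hFr => -[x y] dF dFr.
have E := @dy_comp F (fun p : C * C => p.1 ^+ e) (fun p : C * C => p.2) x y _ _ dF dFr (has_d_cst (x ^+ e) y) (has_d_id y).
have -> : dy (fun q : C * C => F (ram e q)) (x, y) = dx F (ram e (x, y)) * 0 +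
    dy F (ram e (x, y)) * 1 by exact: E.
by move: (dx F _) (dy F _) => X Y /=; rewrite mulr0 add0r mulr1.
Qed.

Lemma mult_unit (f g : C * C -> C) : holomorphic0 g -> g 0 != 0 -> mult f g = 0%E.
Proof.
move=> hg g0; rewrite mult_sym -(mult_one f) -(mult_unitl (fun=> 1) f hg g0).
by apply: mult_ext; apply: filterE => p //; rewrite mulr1.
Qed.

(* Along a Puiseux branch [y = b x] of [G] the derivative of [F (x, b x)] is
   [dx F (x, b x)], so that [F] and [x * dx F] vanish there to the same order. *)
Lemma polar_eq r (F G : C * C -> C) : holomorphic0 F -> holomorphic0 G -> F 0 = 0 ->
  ideal1 G (dy F) -> ordform (fun y : C => G (0, y)) r ->
  mult F G = mult (fun p : C * C => p.1 * dx F p) G.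
Proof.
(* The induction runs over a divisor [G] of [dy F]: removing one root from [G] lowers its order in
   [y] and keeps divisibility. *)
elim: r F G => [|r IH] F G hF hG F0 [A hA EA] Gr.
  have [u [_ u0 /nbhs_singleton E]] := Gr.
  have G0 : G 0 != 0 by rewrite expr0 mul1r in E; rewrite -E in u0.
  by rewrite !mult_unit.
have [N [b [N0 hb b0 Gb]]] := puiseux_root (ltn0Sn r) hG Gr.
have hr := @holo_ram R N; have r0 := @ram0 R N N0.
pose F1 p := F (ram N p); pose G1 p := G (ram N p).
have r0' : F1 0 = 0 by exact: etrans (congr1 F r0) F0.
have hF1 : holomorphic0 F1 by exact: holo_comp hF hr r0.
have hG1 : holomorphic0 G1 by exact: holo_comp hG hr r0.
have bg := branch_graph hb b0; have [[hl hd] d0 _ _ bdiv] := bg.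
have [H hH EH] := bdiv G1 hG1 Gb.
have hxF : holomorphic0 (fun p : C * C => p.1 * dx F1 p).
  by apply: holoM; [exact: holo_fst|exact: holo_dx].
have EdF : germ_eq (dy F1) (fun p : C * C => A (ram N p) * (p.2 - b p.1) * H p).
  apply: filterS2 (near_and (dy_ram N0 hF) (near_comp hr r0 EA)) EH => p [E1 E2] E3.
  by rewrite E1 E2 -mulrA [X in _ = _ * X]mulrC -E3.
have E1 : mult F1 H = mult (fun p : C * C => p.1 * dx F1 p) H.
  apply: IH => //.
    exists (fun p : C * C => A (ram N p) * (p.2 - b p.1)) => //.
    by apply: holoM => //; exact: holo_comp hA hr r0.
  have [u [hu u0 E]] := Gr; exists u; split=> //.
  have hH0 : holomorphic0 (fun y : C => H (0, y)) by exact: holo_comp hH (@holo_inr R) erefl.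
  have : germ_eq (fun y : C => H (0, y) - y ^+ r * u y) (fun=> 0).
    apply: (@nzd_pow R 1); first by apply: holoB => //; apply: holoM => //; exact: holo_pow.
    apply: filterS2 E (near_comp (@holo_inr R) erefl EH) => y Ey.
    rewrite /G1 /ram /= expr0n gtn_eqF // Ey b0 subr0 expr1 => Hy.
    by rewrite mulrBr mulrA -exprS Hy mulrC subrr.
  by apply: filterS => y /subr0_eq.
have E2 : mult (fun p : C * C => p.2 - b p.1) F1 = mult (fun p : C * C => p.2 - b p.1) (fun p : C * C => p.1 * dx F1 p).
  have hp : holomorphic0 (fun t : C => F1 (t, b t)) by exact: holo_comp hF1 hd d0.
  have Dp : germ_eq ((fun t : C => F1 (t, b t))^`()%classic : C -> C) (fun t : C => dx F1 (t, b t)).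
    have := near_and (near_comp hd d0 (near_and hF1 EdF)) (holo_has_d hb).
    apply: filterS => t [[dF E] db].
    have := has_d_derive1 (@chain2 R F1 (fun s => s) b t 1 _ dF (has_d_id t) db).
    have {}E : dy F1 (t, b t) = 0 by rewrite [LHS]E /graph_map /= subrr mulr0 mul0r.
    move=> ->; rewrite E; move: (dx F1 _) => X; by rewrite mul0r addr0 mulr1.
  rewrite (mult_graph hb b0 hF1) (mult_graph hb b0 hxF) ord_derive //; last by rewrite b0 [LHS]r0'.
  rewrite (ord_ext Dp) (@ordM R (fun t : C => t)) ?ord_var //; first exact: holo_id.
  exact: holo_comp (holo_dx hF1) hd d0.
have E3 : mult F1 G1 = mult (fun p : C * C => p.1 * dx F1 p) G1.
  have HE (K : C * C -> C) : holomorphic0 K -> mult K G1 = (mult (fun p : C * C => p.2 - b p.1)%R K + mult K H)%E.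
    move=> hK; rewrite mult_sym (@mult_ext R G1 K (fun p : C * C => (p.2 - b p.1) * H p) K).
    - by rewrite (branch_mulM bg) ?mult_graph // [mult H _]mult_sym.
    - by apply: filterS EH => p ->; rewrite mulrC.
    - exact: filterE.
  by rewrite !HE // E1 E2.
have hxF0 : holomorphic0 (fun p : C * C => p.1 * dx F p).
  by apply: holoM; [exact: holo_fst|exact: holo_dx].
have M1 := mult_ram N0 hF hG; have M2 := mult_ram N0 hxF0 hG.
have hN : holomorphic0 (fun _ : C * C => N%:R : C) by exact: holo_cst.
have N00 : (N%:R : C) != 0 by rewrite pnatr_eq0 -lt0n.
have M3 := mult_unitl (fun p : C * C => (ram N p).1 * dx F (ram N p)) G1 hN N00.
have M4 := mult_ext (dx_ram N0 hF) (@germ_refl R _ G1 G1 (fun=> erefl)).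
apply: (mule_cancel N0); exact: etrans (esym M1) (etrans E3 (etrans M4 (etrans M3 M2))).
Qed.

(** [polar_eq] with [G = dy f] replaces [f] by [x * dx f]. The factor [x] contributes the order [d]
    of [dy f (0, y)], one less than that of [f (0, y)], and [dx f] contributes the Milnor number. *)
Lemma teissier (f : C * C -> C) d : holomorphic0 f -> f 0 = 0 ->
  ordform (fun y : C => f (0, y)) d.+1 -> mult f (dy f) = (milnor f + d%:R%:E)%E.
Proof.
move=> hf f0 fd; have hy := holo_dy hf; have hx := holo_dx hf; have fd' := ordform_dy hf fd.
rewrite (polar_eq hf hy f0 _ fd'); last first.
  exists (fun=> 1); first exact: holo_cst.
  by apply: filterE => p; rewrite mul1r.
by rewrite (branch_mulM (@branch_axis R)) ?mult_axis // (ord_form fd') addeC.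
Qed.

End Polar.

(** * Contact along a branch *)

(* The hypotheses are the first three derivatives of [f (x t, y t) = 0]. The first
   one says that [X * grad f] is [w] times the vector [(y1, - x1)]. *)
Lemma contact_identity (K : comNzRingType) (c a b A B D P Q S T x1 x2 x3 y1 y2 y3 : K) :
  let X := x1 + c * y1 in let w := c * a - b in
  let i := b ^+ 2 * A - 2%:R * a * b * B + a ^+ 2 * D in
  let v := (a ^+ 2 + b ^+ 2) *
     (a ^+ 3 * T - 3%:R * a ^+ 2 * b * S + 3%:R * a * b ^+ 2 * Q - b ^+ 3 * P)
     - 3%:R * ((a ^+ 2 - b ^+ 2) * B - a * b * (A - D)) * i in
  let j := x1 * y2 - x2 * y1 in
  a * x1 + b * y1 = 0 ->
  (A * x1 + B * y1) * x1 + a * x2 + ((B * x1 + D * y1) * y1 + b * y2) = 0 ->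
  P * x1 ^+ 3 + 3%:R * Q * x1 ^+ 2 * y1 + 3%:R * S * x1 * y1 ^+ 2 + T * y1 ^+ 3
    + 3%:R * (A * x1 * x2 + B * (x1 * y2 + x2 * y1) + D * y1 * y2) + a * x3 + b * y3 = 0 ->
  X ^+ 3 * i = w ^+ 3 * j /\
  X ^+ 6 * v = w ^+ 6 * ((x1 ^+ 2 + y1 ^+ 2) * (x1 * y3 - x3 * y1)
     + 3%:R * (x1 * x2 + y1 * y2) * (x2 * y1 - x1 * y2)).
Proof.
move=> X w i v j e0 e1 e2.
have Xa : X * a = y1 * w.
  have -> : X * a = y1 * w + (a * x1 + b * y1) by rewrite /X /w; ring.
  by rewrite e0 addr0.
have Xb : X * b = - (x1 * w).
  have -> : X * b = - (x1 * w) + c * (a * x1 + b * y1) by rewrite /X /w; ring.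
  by rewrite e0 mulr0 addr0.
(* [A], [B], [D] are the second and [P], [Q], [S], [T] the third partial derivatives of [f]; [q] is
   the Hessian form on the velocity, which the second relation computes. *)
pose q := A * x1 ^+ 2 + 2%:R * B * x1 * y1 + D * y1 ^+ 2.
have Xq : X * q = w * j.
  have -> : X * q = X * ((A * x1 + B * y1) * x1 + a * x2 + ((B * x1 + D * y1) * y1 + b * y2))
     - (X * a) * x2 - (X * b) * y2 by rewrite /q; ring.
  by rewrite e1 Xa Xb /j; ring.
have Xi : X ^+ 2 * i = w ^+ 2 * q.
  have -> : X ^+ 2 * i = (X * b) ^+ 2 * A - 2%:R * (X * a) * (X * b) * B + (X * a) ^+ 2 * D.
    by rewrite /i; ring.
  by rewrite Xa Xb /q; ring.
have Xi3 : X ^+ 3 * i = w ^+ 3 * j.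
  have -> : X ^+ 3 * i = X * (X ^+ 2 * i) by ring.
  by rewrite Xi mulrCA Xq; ring.
split=> //.
pose E := A * x1 * x2 + B * (x1 * y2 + x2 * y1) + D * y1 * y2.
pose k := x1 ^+ 2 + y1 ^+ 2.
(* Since [(X * a, X * b) = w * (y1, - x1)], the cubic form in the gradient becomes the cubic form on
   the velocity, which the third relation expresses through lower derivatives of [f]. *)
have Xc : X ^+ 3 * (a ^+ 3 * T - 3%:R * a ^+ 2 * b * S + 3%:R * a * b ^+ 2 * Q - b ^+ 3 * P) =
   w ^+ 3 * - (3%:R * E + a * x3 + b * y3).
  have -> : X ^+ 3 * (a ^+ 3 * T - 3%:R * a ^+ 2 * b * S + 3%:R * a * b ^+ 2 * Q - b ^+ 3 * P) =
    (X * a) ^+ 3 * T - 3%:R * (X * a) ^+ 2 * (X * b) * S + 3%:R * (X * a) * (X * b) ^+ 2 * Q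
    - (X * b) ^+ 3 * P by ring.
  rewrite Xa Xb -[RHS]addr0 -(mulr0 (w ^+ 3)) -e2 /E; ring.
have Xv : X ^+ 6 * v = w ^+ 2 * k * X * (X ^+ 3 * (a ^+ 3 * T - 3%:R * a ^+ 2 * b * S
     + 3%:R * a * b ^+ 2 * Q - b ^+ 3 * P))
   - 3%:R * w ^+ 2 * ((y1 ^+ 2 - x1 ^+ 2) * B + x1 * y1 * (A - D)) * X * (X ^+ 3 * i).
  have -> : X ^+ 6 * v = ((X * a) ^+ 2 + (X * b) ^+ 2) * X * (X ^+ 3 * (a ^+ 3 * T
     - 3%:R * a ^+ 2 * b * S + 3%:R * a * b ^+ 2 * Q - b ^+ 3 * P))
   - 3%:R * (((X * a) ^+ 2 - (X * b) ^+ 2) * B - (X * a) * (X * b) * (A - D)) * X * (X ^+ 3 * i).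
    by rewrite /v; ring.
  by rewrite Xa Xb /k; ring.
rewrite Xv Xc Xi3.
have -> : w ^+ 2 * k * X * (w ^+ 3 * - (3%:R * E + a * x3 + b * y3))
   - 3%:R * w ^+ 2 * ((y1 ^+ 2 - x1 ^+ 2) * B + x1 * y1 * (A - D)) * X * (w ^+ 3 * j) =
   - w ^+ 5 * k * (X * a * x3 + X * b * y3) - 3%:R * w ^+ 5 * (x1 * x2 + y1 * y2) * (X * q).
  by rewrite /k /E /j /q; ring.
by rewrite Xa Xb Xq /k /j; ring.
Qed.

Section Contact.
Variable R : realType.
Local Notation C := (Cplx R).

Lemma dy_germ (F G : C * C -> C) : germ_eq F G -> holomorphic0 F -> germ_eq (dy F) (dy G).
Proof.
move=> /nbhs_interior FG hF; apply: filterS2 FG hF => p FG dF.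
have [dG dE] := differentiable_near FG dF.
have E1 := deriveE ((0, 1) : C * C) dF; have E2 := deriveE ((0, 1) : C * C) dG.
exact: etrans E1 (etrans (esym (congr1 (fun l : C * C -> C => l ((0, 1) : C * C)) dE)) (esym E2)).
Qed.

Lemma germ0_has_d (f f' : C -> C) : germ_eq f (fun=> 0) -> holomorphic0 f ->
  (\forall t \near (0 : C), has_d f t (f' t)) -> germ_eq f' (fun=> 0).
Proof.
move=> fz hf df; have := near_and (derive1_germ fz hf) df.
apply: filterS => t [E H]; rewrite -(has_d_derive1 H) E.
exact: has_d_derive1 (has_d_cst 0 t).
Qed.

(** The partial derivatives of [f] along the branch are abstracted to one-variable functions;
    symmetry of mixed derivatives is encoded by the reuse of [B], [Q] and [S]. *)
Lemma contact_relations (a b A B D P Q S T x1 x2 x3 y1 y2 y3 : C -> C) :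
  holomorphic0 a -> holomorphic0 b -> holomorphic0 A -> holomorphic0 B -> holomorphic0 D ->
  holomorphic0 x1 -> holomorphic0 x2 -> holomorphic0 y1 -> holomorphic0 y2 ->
  (\forall t \near (0 : C), [/\
     [/\ has_d a t (A t * x1 t + B t * y1 t) & has_d b t (B t * x1 t + D t * y1 t)],
     [/\ has_d A t (P t * x1 t + Q t * y1 t), has_d B t (Q t * x1 t + S t * y1 t)
       & has_d D t (S t * x1 t + T t * y1 t)]
   & [/\ has_d x1 t (x2 t), has_d x2 t (x3 t), has_d y1 t (y2 t) & has_d y2 t (y3 t)]]) ->
  germ_eq (fun t => a t * x1 t + b t * y1 t) (fun=> 0) ->
  \forall t \near (0 : C),
   [/\ a t * x1 t + b t * y1 t = 0,
  (A t * x1 t + B t * y1 t) * x1 t + a t * x2 t + ((B t * x1 t + D t * y1 t) * y1 t + b t * y2 t) = 0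
  & P t * x1 t ^+ 3 + 3%:R * Q t * x1 t ^+ 2 * y1 t + 3%:R * S t * x1 t * y1 t ^+ 2 + T t * y1 t ^+ 3
    + 3%:R * (A t * x1 t * x2 t + B t * (x1 t * y2 t + x2 t * y1 t) + D t * y1 t * y2 t)
    + a t * x3 t + b t * y3 t = 0].
Proof.
move=> ha hb hA hB hD hx1 hx2 hy1 hy2 H e0.
have E1 : germ_eq (fun t => (A t * x1 t + B t * y1 t) * x1 t + a t * x2 t
     + ((B t * x1 t + D t * y1 t) * y1 t + b t * y2 t)) (fun=> 0).
  apply: germ0_has_d e0 _ _; first by apply: holoD; exact: holoM.
  apply: filterS H => t [[da db] _ [dx1 _ dy1 _]].
  exact: has_dD (has_dM da dx1) (has_dM db dy1).
have E2 : germ_eq (fun t =>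
   ((P t * x1 t + Q t * y1 t) * x1 t + A t * x2 t + ((Q t * x1 t + S t * y1 t) * y1 t + B t * y2 t)) * x1 t
   + (A t * x1 t + B t * y1 t) * x2 t + ((A t * x1 t + B t * y1 t) * x2 t + a t * x3 t)
   + (((Q t * x1 t + S t * y1 t) * x1 t + B t * x2 t + ((S t * x1 t + T t * y1 t) * y1 t + D t * y2 t)) * y1 t
   + (B t * x1 t + D t * y1 t) * y2 t + ((B t * x1 t + D t * y1 t) * y2 t + b t * y3 t))) (fun=> 0).
  apply: germ0_has_d E1 _ _; first by do !(exact: holoM || apply: holoD || apply: holoM).
  apply: filterS H => t [[da db] [dA dB dD] [dx1 dx2 dy1 dy2]].
  apply: has_dD; apply: has_dD; apply: has_dM => //; apply: has_dD; exact: has_dM.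
have := near_and e0 (near_and E1 E2); apply: filterS => t [E0 [{}E1 {}E2]]; split=> //.
by rewrite -[RHS]E2; ring.
Qed.

End Contact.

(** * Orders along the branches *)

Section BranchOrders.
Variable R : realType.
Local Notation ord0 := (@Defs.ord0 R).
Local Notation C := (Cplx R).
Local Notation mult := (@intersection_number R).

Lemma holo_i_curve (f : C * C -> C) : holomorphic0 f -> holomorphic0 (i_curve f).
Proof.
move=> hf; have hx := holo_dx hf; have hy := holo_dy hf.
have hxx := holo_dx hx; have hxy := holo_dy hx; have hyy := holo_dy hy.
have hc (k : nat) : holomorphic0 (fun _ : C * C => k%:R : C) by exact: holo_cst.
apply: holoD; last by apply: holoM => //; exact: holoX.
apply: holoB; first by apply: holoM => //; exact: holoX.
by do !apply: holoM => //.
Qed.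

Lemma holo_v_curve (f : C * C -> C) : holomorphic0 f -> holomorphic0 (v_curve f).
Proof.
move=> hf; have hx := holo_dx hf; have hy := holo_dy hf.
have hxx := holo_dx hx; have hxy := holo_dy hx; have hyy := holo_dy hy.
have hxxx := holo_dx hxx; have hxxy := holo_dy hxx; have hxyy := holo_dy hxy; have hyyy := holo_dy hyy.
have hi := holo_i_curve hf.
have hc (k : nat) : holomorphic0 (fun _ : C * C => k%:R : C) by exact: holo_cst.
have hX n (F : C * C -> C) : holomorphic0 F -> holomorphic0 (fun p => F p ^+ n) by exact: holoX.
apply: holoB.
  apply: holoM; first by apply: holoD; exact: hX.
  apply: holoB; last by apply: holoM => //; exact: hX.
  apply: holoD; last by do !apply: holoM => //; exact: hX.
  apply: holoB; first by apply: holoM => //; exact: hX.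
  by do !apply: holoM => //; exact: hX.
apply: holoM => //; apply: holoM => //; apply: holoB.
  by apply: holoM => //; apply: holoB; exact: hX.
by apply: holoM; [exact: holoM|exact: holoB].
Qed.

Lemma ord_power_relation k (X u w v : C -> C) :
  holomorphic0 X -> holomorphic0 u -> holomorphic0 w -> holomorphic0 v ->
  germ_eq (fun t => X t ^+ k * u t) (fun t => w t ^+ k * v t) ->
  (k%:R%:E * ord0 X + ord0 u = k%:R%:E * ord0 w + ord0 v)%E.
Proof.
move=> hX hu hw hv E.
have E1 := ordM (holoX k hX) hu; have E2 := ordM (holoX k hw) hv.
by rewrite -(ordX k hX) -(ordX k hw) -E1 -E2; exact: ord_ext.
Qed.

Section Branch.
Variables (f : C * C -> C) (g : C -> C * C).
Hypotheses (hf : holomorphic0 f) (hg : holomorphic0 g) (g0 : g 0 = 0).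
Hypothesis fg0 : germ_eq (fun t => f (g t)) (fun=> 0).
Let x (t : C) : C := (g t).1.
Let y (t : C) : C := (g t).2.
Let x1 : C -> C := (x^`(1))%classic.
Let x2 : C -> C := (x^`(2))%classic.
Let x3 : C -> C := (x^`(3))%classic.
Let y1 : C -> C := (y^`(1))%classic.
Let y2 : C -> C := (y^`(2))%classic.
Let y3 : C -> C := (y^`(3))%classic.

Let hx : holomorphic0 x. Proof. exact: holo_comp (@holo_fst R) hg g0. Qed.
Let hy : holomorphic0 y. Proof. exact: holo_comp (@holo_snd R) hg g0. Qed.
Let hx1 : holomorphic0 x1. Proof. exact: holo_derive1 hx. Qed.
Let hy1 : holomorphic0 y1. Proof. exact: holo_derive1 hy. Qed.
Let hx2 : holomorphic0 x2. Proof. exact: holo_derive1 hx1. Qed.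
Let hy2 : holomorphic0 y2. Proof. exact: holo_derive1 hy1. Qed.
Let hx3 : holomorphic0 x3. Proof. exact: holo_derive1 hx2. Qed.
Let hy3 : holomorphic0 y3. Proof. exact: holo_derive1 hy2. Qed.

Let gE t : g t = (x t, y t). Proof. exact: surjective_pairing. Qed.

Let along (F : C * C -> C) : holomorphic0 F -> \forall t \near (0 : C),
  has_d (fun s => F (x s, y s)) t (dx F (x t, y t) * x1 t + dy F (x t, y t) * y1 t).
Proof.
move=> hF; have := near_and (near_comp hg g0 hF) (near_and (holo_has_d hx) (holo_has_d hy)).
apply: filterS => t [dF [Dx Dy]]; rewrite gE in dF.
exact: (@chain2 R F x y t _ _ dF Dx Dy).
Qed.

Let holo_along (F : C * C -> C) : holomorphic0 F -> holomorphic0 (fun t => F (x t, y t)).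
Proof.
move=> hF; have := holo_comp hF hg g0; apply: holo_eq.
by apply: filterE => t; rewrite gE.
Qed.

Let along_eq (F G : C * C -> C) : germ_eq F G ->
  \forall t \near (0 : C), F (x t, y t) = G (x t, y t).
Proof. by move=> E; have := near_comp hg g0 E; apply: filterS => t; rewrite gE. Qed.

Lemma contact_along c : \forall t \near (0 : C),
  (x1 t + c * y1 t) ^+ 3 * i_curve f (g t) = (c * dx f (g t) - dy f (g t)) ^+ 3 * i_param g t /\
  (x1 t + c * y1 t) ^+ 6 * v_curve f (g t) = (c * dx f (g t) - dy f (g t)) ^+ 6 * v_param g t.
Proof.
have ha := holo_dx hf; have hb := holo_dy hf.
have hA := holo_dx ha; have hB := holo_dy ha; have hD := holo_dy hb.
pose at_ (F : C * C -> C) (t : C) : C := F (x t, y t).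
have e0 : germ_eq (fun t => at_ (dx f) t * x1 t + at_ (dy f) t * y1 t) (fun=> 0).
  apply: germ0_has_d _ (holo_along hf) (along hf).
  by apply: filterS fg0 => t; rewrite gE.
(* The chain rule yields some mixed derivatives in the other order; symmetry rewrites them in the
   order used by [i_curve] and [v_curve]. *)
have Eyx := along_eq (dxdy hf).
have Eyxx := along_eq (dxdy ha).
have Eyyx : \forall t \near (0 : C), dx (dy (dy f)) (x t, y t) = dy (dy (dx f)) (x t, y t).
  apply: along_eq; apply: germ_trans (dxdy hb) _.
  exact: dy_germ (dxdy hf) (holo_dx hb).
have rel := @contact_relations R (at_ (dx f)) (at_ (dy f)) (at_ (dx (dx f))) (at_ (dy (dx f)))
  (at_ (dy (dy f))) (at_ (dx (dx (dx f)))) (at_ (dy (dx (dx f)))) (at_ (dy (dy (dx f))))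
  (at_ (dy (dy (dy f)))) x1 x2 x3 y1 y2 y3 (holo_along ha) (holo_along hb) (holo_along hA)
  (holo_along hB) (holo_along hD) hx1 hx2 hy1 hy2.
have repl (h : C -> C) t (u v w z : C) : u = v -> has_d h t (u * w + z) -> has_d h t (v * w + z).
  by move=> ->.
apply: filterS (rel _ e0).
  move=> t [e0t e1t e2t]; rewrite gE; exact: (contact_identity c e0t e1t e2t).
have := near_and (near_and (along ha) (along hb)) (near_and (near_and (along hA)
  (near_and (along hB) (along hD))) (near_and (near_and (holo_has_d hx1) (holo_has_d hx2))
  (near_and (holo_has_d hy1) (holo_has_d hy2)))).
have := near_and Eyx (near_and Eyxx Eyyx).
apply: filterS2 => t [F1 [F2 F3]] [[da db] [[dA [dB dD]] [[dx1 dx2] [dy1 dy2]]]].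
split; [split; [exact: da|exact: repl F1 db]|split; [exact: dA|exact: repl F2 dB|exact: repl F3 dD]|].
by split; [exact: dx1|exact: dx2|exact: dy1|exact: dy2].
Qed.

(** Orders may be infinite, so the relations are kept as sums rather than differences. *)
Lemma contact_orders c :
  let o := ord0 (fun t => x1 t + c * y1 t) in
  let w := ord0 (fun t => c * dx f (g t) - dy f (g t)) in
  [/\ ord0 (fun t => (g t).1 + c * (g t).2) = (1 + o)%E,
      (3%:R%:E * o + ord0 (fun t => i_curve f (g t)) = 3%:R%:E * w + I_param g)%E
    & (6%:R%:E * o + ord0 (fun t => v_curve f (g t)) = 6%:R%:E * w + V_param g)%E].
Proof.
move=> o w; have hc : holomorphic0 (fun _ : C => c) by exact: holo_cst.
have hX : holomorphic0 (fun t => x t + c * y t) by apply: holoD => //; exact: holoM.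
have hX1 : holomorphic0 (fun t => x1 t + c * y1 t) by apply: holoD => //; exact: holoM.
have hw : holomorphic0 (fun t => c * dx f (g t) - dy f (g t)).
  apply: holoB; last exact: holo_comp (holo_dy hf) hg g0.
  by apply: holoM hc _; exact: holo_comp (holo_dx hf) hg g0.
have hi : holomorphic0 (fun t => i_curve f (g t)) by exact: holo_comp (holo_i_curve hf) hg g0.
have hv : holomorphic0 (fun t => v_curve f (g t)) by exact: holo_comp (holo_v_curve hf) hg g0.
have hip : holomorphic0 (i_param g) := holoB (holoM hx1 hy2) (holoM hx2 hy1).
have h3 : holomorphic0 (fun _ : C => 3%:R : C) by exact: holo_cst.
have hvp : holomorphic0 (v_param g) := holoD
  (holoM (holoD (holoX 2 hx1) (holoX 2 hy1)) (holoB (holoM hx1 hy3) (holoM hx3 hy1)))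
  (holoM (holoM h3 (holoD (holoM hx1 hx2) (holoM hy1 hy2))) (holoB (holoM hx2 hy1) (holoM hx1 hy2))).
have cc := contact_along c; split.
- rewrite ord_derive //; last by rewrite g0 /= mulr0 addr0.
  congr (1 + _)%E; apply: ord_ext.
  have := near_and (holo_has_d hx) (holo_has_d hy); apply: filterS => t [dX dY].
  have := has_d_derive1 (has_dD dX (has_dM (has_d_cst c t) dY)).
  by rewrite mul0r add0r.
- apply: (ord_power_relation hX1 hi hw hip); apply: filterS cc => t [E _]; exact: E.
- apply: (ord_power_relation hX1 hv hw hvp); apply: filterS cc => t [_ E]; exact: E.
Qed.

End Branch.

(** Pigeonhole over the [n + 1] slopes from 0 to [n]: two slopes bad for the same branch would make
    both of its coordinates vanish. *)
Lemma generic_direction n (x y : 'I_n -> C -> C) :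
  (forall i, ~ (germ_eq (x i) (fun=> 0) /\ germ_eq (y i) (fun=> 0))) ->
  exists c : C, forall i, ~ germ_eq (fun t => x i t + c * y i t) (fun=> 0).
Proof.
move=> H; apply: contrapT => nc.
have /choice[bad Hbad] : forall j : 'I_n.+1, exists i, germ_eq (fun t => x i t + (j : nat)%:R * y i t) (fun=> 0).
  move=> j; apply: contrapT => /forallNP nj; apply: nc; exists (j : nat)%:R => i; exact: nj.
suff /leq_card : injective bad by rewrite !card_ord ltnn.
move=> j k jk; apply: contrapT => /eqP njk; apply: (H (bad j)).
have njk' : (j : nat)%:R - (k : nat)%:R != 0 :> C by rewrite subr_eq0 eqr_nat.
have E := near_and (Hbad j) (Hbad k); rewrite -jk in E.
have yz : germ_eq (y (bad j)) (fun=> 0).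
  apply: filterS E => t [E1 E2]; apply: (mulfI njk'); rewrite mulr0.
  rewrite -(subrr (0 : C)) -{1}E1 -E2; ring.
split=> //; apply: filterS2 E yz => t [/= E1 _] E2.
by rewrite E2 mulr0 addr0 in E1.
Qed.

Lemma mult_prod (I : Type) (r : seq I) (fs : I -> C * C -> C) (gs : I -> C -> C * C) (h : C * C -> C) :
  (forall i, branch (fs i) (gs i)) -> holomorphic0 h ->
  (forall i, mult (fs i) h = ord0 (fun t => h (gs i t))) ->
  mult (fun p => \prod_(i <- r) fs i p) h = (\sum_(i <- r) ord0 (fun t => h (gs i t)))%E.
Proof.
move=> bf hh mf; elim: r => [|i r IH].
  rewrite big_nil -(mult_one h); congr (mult _ h); apply/funext => p; exact: big_nil.
rewrite big_cons -IH -mf -(branch_mulM (bf i)) //.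
  congr (mult _ h); apply/funext => p; exact: big_cons.
by apply: holo_prod => j; case: (bf j) => -[].
Qed.

(** Subtracts the finite total [a] of the orders of [X']. In the application [d + 1 = a + n] is the
    intersection number of [f] with [x + c * y], so [d - a] becomes [n - 1]; the other quantities
    may be infinite. *)
Lemma cancel_orders (m u v : \bar R) (a n d k : nat) : (0 < k)%N -> (d.+1 = a + n)%N ->
  (0 <= m)%E -> (0 <= u)%E -> (0 <= v)%E ->
  (k%:R%:E * a%:R%:E + u = k%:R%:E * (m + d%:R%:E) + v)%E ->
  (u = v + k%:R%:E * (m + (n%:R - 1)%:E))%E.
Proof.
move=> k0 da.
have kr : (0 < k%:R :> R) by rewrite ltr0n.
have dn : d%:R = a%:R + n%:R - 1 :> R.
  by rewrite -natrD -da -natr1 addrK.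
case: m u v => [m||] [u||] [v||] //= _ _ _; rewrite ?(gt0_muley, lte_fin) //=.
move=> [E]; congr (_%:E); rewrite dn in E; lra.
Qed.

End BranchOrders.

(** * The contact formulas *)

Section Formula.
Variable R : realType.
Local Notation ord0 := (@Defs.ord0 R).
Local Notation C := (Cplx R).
Local Notation mult := (@intersection_number R).

Section Shear.
Variable c : C.

(** An involution under which [x + c * y] pulls back to [x], while [dy] of [f \o S] is the pullback
    of [c * dx f - dy f]; Teissier's lemma for [f \o S] thus becomes [generic_polar]. *)
Let S (p : C * C) : C * C := (p.1 + c * p.2, - p.2).

Let S0 : S 0 = 0. Proof. by rewrite /S /= mulr0 addr0 oppr0. Qed.

Let SK p : S (S p) = p.
Proof. by case: p => x y; rewrite /S /= mulrN addrK opprK. Qed.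

Let hS : holomorphic0 S.
Proof.
apply: holo_pair; last by apply: holoN; exact: holo_snd.
by apply: holoD; [exact: holo_fst|apply: holoM; [exact: holo_cst|exact: holo_snd]].
Qed.

Let mult_S (f h : C * C -> C) : mult (fun p => f (S p)) (fun p => h (S p)) = mult f h.
Proof. by apply: (@mult_auto R S S) => //; apply: filterE. Qed.

Lemma generic_polar (f : C * C -> C) d : holomorphic0 f -> f 0 = 0 ->
  mult f (fun p => p.1 + c * p.2) = (d.+1%:R)%:E ->
  mult f (fun p => c * dx f p - dy f p) = (milnor f + d%:R%:E)%E.
Proof.
move=> hf f0 fd; pose F p := f (S p).
have hF : holomorphic0 F by exact: holo_comp hf hS S0.
have F0 : F 0 = 0 by exact: etrans (congr1 f S0) f0.
have ordF : ordform (fun y : C => F (0, y)) d.+1.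
  have hF0 : holomorphic0 (fun y : C => F (0, y)) by exact: holo_comp hF (@holo_inr R) erefl.
  have E : ord0 (fun y : C => F (0, y)) = (d.+1%:R)%:E.
    rewrite -mult_axis // mult_sym -fd -[RHS]mult_S; apply: mult_ext; first exact: (@germ_refl R _ F F (fun=> erefl)).
    by apply: filterE => p; rewrite /S /= mulrN addrK.
  have [[k [Hk Ek]]|[_ Ek]] := ordP hF0; rewrite Ek in E => //.
  by case: E => /eqP; rewrite eqr_nat => /eqP <-.
have near_S : \forall p \near (0 : C * C), differentiable F p /\ differentiable f (S p).
  exact: near_and hF (near_comp hS S0 hf).
have Ex : germ_eq (dx F) (fun p => dx f (S p)).
  apply: filterS near_S => -[x y] [dF df].
  have h1 : has_d (fun s : C => s + c * y) x (1 + 0) by exact: has_dD (has_d_id x) (has_d_cst _ x).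
  have E := @dx_comp R f (fun p => p.1 + c * p.2) (fun p => - p.2) x y _ _ df dF h1 (has_d_cst _ x).
  rewrite [LHS]E /S; move: (dx f _) (dy f _) => X Y; by rewrite mulr0 !addr0 mulr1.
have Ey : germ_eq (dy F) (fun p => c * dx f (S p) - dy f (S p)).
  apply: filterS near_S => -[x y] [dF df].
  have h1 : has_d (fun s : C => x + c * s) y (0 + (0 * y + c * 1)).
    exact: has_dD (has_d_cst x y) (has_dM (has_d_cst c y) (has_d_id y)).
  have h2 : has_d (fun s : C => - s) y (-1).
    have := has_dM (has_d_cst (-1) y) (has_d_id y).
    rewrite mul0r add0r mulr1; apply: has_d_ext => s; exact: mulN1r.
  have E := @dy_comp R f (fun p => p.1 + c * p.2) (fun p => - p.2) x y _ _ df dF h1 h2.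
  rewrite [LHS]E /S; move: (dx f _) (dy f _) => X Y; ring.
have T := teissier hF F0 ordF.
have M1 := mult_ext (@germ_refl R _ F F (fun=> erefl)) Ey.
have M2 := mult_ext Ex Ey.
have M3 := mult_S f (fun p => c * dx f p - dy f p).
have M4 := mult_S (dx f) (fun p => c * dx f p - dy f p).
(* The ideals agree, because [c * dx f - dy f] and [- dy f] differ by a multiple of [dx f]. *)
have M5 : mult (dx f) (fun p => c * dx f p - dy f p) = milnor f.
  have to1 (A B X Y : C) : A * X + B * (c * X - Y) = (A + c * B) * X + - B * Y by ring.
  have to2 (A B X Y : C) : A * X + B * Y = (A + c * B) * X + - B * (c * X - Y) by ring.
  apply: mult_sub => u _; split=> -[a [b [ha hb E]]].
    exists (fun p => a p + c * b p), (fun p => - b p); split.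
    - exact: holoD ha (holoM (holo_cst _ c) hb).
    - exact: holoN.
    - apply: germ_trans E _; apply: germ_refl => p; exact: to1.
  exists (fun p => a p + c * b p), (fun p => - b p); split.
  - exact: holoD ha (holoM (holo_cst _ c) hb).
  - exact: holoN.
  - apply: germ_trans E _; apply: germ_refl => p; exact: to2.
have M6 : milnor F = milnor f := etrans M2 (etrans M4 M5).
by rewrite M6 in T; exact: etrans (esym M3) (etrans (esym M1) T).
Qed.

End Shear.

Lemma contact_formula n (f : C * C -> C) (fs : 'I_n -> C * C -> C) (gs : 'I_n -> C -> C * C) :
  (0 < n)%N -> holomorphic0 f -> f 0 = 0 -> germ_eq f (fun p => \prod_(i < n) fs i p) ->
  (forall i, germ_irreducible (fs i)) -> (forall i, parametrisation (gs i) (fs i)) ->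
  (I_curve f = \sum_(i < n) I_param (gs i) + 3%:R%:E * (milnor f + (n%:R - 1)%:E))%E /\
  (V_curve f = \sum_(i < n) V_param (gs i) + 6%:R%:E * (milnor f + (n%:R - 1)%:E))%E.
Proof.
move=> n0 hf f0 fE firr par.
have pf i := param_facts (par i).
have hgs i : holomorphic0 (gs i) by case: (pf i).
have gs0 i : gs i 0 = 0 by case: (pf i).
have ib i : branch (fs i) (gs i) /\ forall h : C * C -> C, holomorphic0 h ->
    mult (fs i) h = ord0 (fun t => h (gs i t)).
  by case: (pf i) => hg g0 gi fg; exact: irr_branch.
have bf i := (ib i).1; have mf i := (ib i).2.
have fg i : germ_eq (fun t => f (gs i t)) (fun=> 0).
  have [_ _ _ fi0] := pf i.
  apply: filterS2 (near_comp (hgs i) (gs0 i) fE) fi0 => t -> Ez.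
  by rewrite (bigD1 i) //= Ez mul0r.
have multE (h : C * C -> C) : holomorphic0 h ->
    mult f h = (\sum_(i < n) ord0 (fun t => h (gs i t)))%E.
  move=> hh; rewrite -(mult_prod _ bf hh (fun i => mf i h hh)).
  exact: mult_ext fE (@germ_refl R _ h h (fun=> erefl)).
have [|c Hc] := @generic_direction R n (fun i t => (gs i t).1) (fun i t => (gs i t).2).
  move=> i [xz yz]; have [_ _ gi _] := pf i; exact: injective0_nonzero gi xz yz.
pose o i := ord0 (fun t => ((fun t => (gs i t).1)^`(1)%classic : C -> C) t
   + c * ((fun t => (gs i t).2)^`(1)%classic : C -> C) t).
pose w i := ord0 (fun t => c * dx f (gs i t) - dy f (gs i t)).
have co i := contact_orders hf (hgs i) (gs0 i) (fg i) c.
(* Finite because [c] is generic: [x + c * y] has a finite positive order on the branch, one more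
   than [o i]. *)
have /choice[a Ha] : forall i, exists k : nat, o i = k%:R%:E.
  move=> i; have [E _ _] := co i.
  have hX : holomorphic0 (fun t => (gs i t).1 + c * (gs i t).2).
    apply: holoD; first exact: holo_comp (@holo_fst R) (hgs i) (gs0 i).
    apply: holoM; first exact: holo_cst.
    exact: holo_comp (@holo_snd R) (hgs i) (gs0 i).
  have [[k [Hk Ek]]|[Xz _]] := ordP hX; last by have := Hc i Xz.
  have k0 : (0 < k)%N by apply: ordform0 Hk _; rewrite gs0 /= mulr0 addr0.
  exists k.-1; have := etrans (esym E) Ek; rewrite -/(o i) -(prednK k0).
  case: (o i) => [r||] //= [H]; congr (_%:E).
  by move: H; rewrite -nat1r => /addrI.
have hl : holomorphic0 (fun p : C * C => p.1 + c * p.2).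
  by apply: holoD; [exact: holo_fst|apply: holoM; [exact: holo_cst|exact: holo_snd]].
(* [s + n] is the sum of the orders [1 + o i] of [x + c * y]; as [0 < n], its predecessor can serve
   as the [d] of [generic_polar]. *)
pose s := (\sum_(i < n) a i)%N.
have sn : ((s + n).-1.+1 = s + n)%N by rewrite prednK // addn_gt0 n0 orbT.
have El : mult f (fun p => p.1 + c * p.2) = ((s + n).-1.+1%:R)%:E.
  rewrite (multE _ hl) (eq_bigr (fun i => (a i).+1%:R%:E)) => [|i _]; last first.
    by have [-> _ _] := co i; rewrite -/(o i) Ha -EFinD nat1r.
  rewrite sumEFin -natr_sum sn; congr (_%:R%:E).
  rewrite (eq_bigr (fun i => a i + 1)%N) => [|i _]; last by rewrite addn1.
  by rewrite big_split /= sum1_card card_ord.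
have hw : holomorphic0 (fun p => c * dx f p - dy f p).
  apply: holoB (holo_dy hf); exact: holoM (holo_cst _ c) (holo_dx hf).
have Ew : (\sum_(i < n) w i = milnor f + (s + n).-1%:R%:E)%E.
  by rewrite -(generic_polar hf f0 El) (multE _ hw).
have w0 i : (0 <= w i)%E by exact: ord_ge0.
have sums k (u v : 'I_n -> \bar R) : (0 < k)%N -> (forall i, 0 <= u i)%E -> (forall i, 0 <= v i)%E ->
    (forall i, k%:R%:E * o i + u i = k%:R%:E * w i + v i)%E ->
    (\sum_(i < n) u i = \sum_(i < n) v i + k%:R%:E * (milnor f + (n%:R - 1)%:E))%E.
  move=> k0 u0 v0 H; apply: (cancel_orders k0 sn).
  - exact: mult_ge0.
  - exact: sume_ge0.
  - exact: sume_ge0.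
  - rewrite -Ew ge0_sume_distrr // -big_split /= -(eq_bigr _ (fun i _ => H i)) big_split /=.
    congr (_ + _)%E; rewrite /s natr_sum -sumEFin ge0_sume_distrr => [|i _]; last by rewrite lee_fin.
    by apply: eq_bigr => i _; rewrite Ha.
split; rewrite [LHS]multE.
- by apply: sums => // i; [exact: ord_ge0|exact: ord_ge0|have [_ + _] := co i].
- exact: holo_i_curve.
- by apply: sums => // i; [exact: ord_ge0|exact: ord_ge0|have [_ _ +] := co i].
- exact: holo_v_curve.
Qed.

End Formula.

Local Open Scope ereal_scope.

Theorem theorem4p1 (R : realType) :
  [/\ forall (f : Cplx R * Cplx R -> Cplx R) (g : Cplx R -> Cplx R * Cplx R),
        f 0%R = 0%R -> germ_irreducible f -> parametrisation g f ->
        I_curve f = I_param g + 3%:E * milnor f,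
      forall (f : Cplx R * Cplx R -> Cplx R) (g : Cplx R -> Cplx R * Cplx R),
        f 0%R = 0%R -> germ_irreducible f -> parametrisation g f ->
        V_curve f = V_param g + 6%:E * milnor f
    & forall (n : nat) (f : Cplx R * Cplx R -> Cplx R)
        (fs : 'I_n -> Cplx R * Cplx R -> Cplx R)
        (gs : 'I_n -> Cplx R -> Cplx R * Cplx R),
        (0 < n)%N ->
        holomorphic0 f -> f 0%R = 0%R -> germ_squarefree f ->
        germ_eq f (fun p => \prod_(i < n) fs i p)%R ->
        (forall i, germ_irreducible (fs i)) ->
        (forall i, parametrisation (gs i) (fs i)) ->
        I_curve f = \sum_(i < n) I_param (gs i)
                    + 3%:E * (milnor f + (n%:R - 1)%:E) /\
        V_curve f = \sum_(i < n) V_param (gs i)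
                    + 6%:E * (milnor f + (n%:R - 1)%:E)].
Proof.
(* An irreducible germ is a product with one factor, for which [n - 1 = 0]. *)
have branch_case (f : Cplx R * Cplx R -> Cplx R) (g : Cplx R -> Cplx R * Cplx R) :
    f 0%R = 0%R -> germ_irreducible f -> parametrisation g f ->
    I_curve f = I_param g + 3%:E * milnor f /\ V_curve f = V_param g + 6%:E * milnor f.
  move=> f0 firr par; have [hf _ _ _] := firr.
  have fE : germ_eq f (fun p => \prod_(i < 1) f p)%R.
    by apply: germ_refl => p; rewrite big_ord1.
  have := contact_formula (fs := fun=> f) (gs := fun=> g) (ltn0Sn 0) hf f0 fE
    (fun=> firr) (fun=> par).
  by rewrite !big_ord1 subrr adde0.
split.
- by move=> f g f0 firr par; have [] := branch_case f g f0 firr par.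
- by move=> f g f0 firr par; have [] := branch_case f g f0 firr par.
- move=> n f fs gs n0 hf f0 _; exact: contact_formula.
Qed.
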